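(* Let $\mathcal{B}_i\subseteq\mathcal{A}_i$, $i\in I$, be a (finite or infinite) family of unital inclusions of $C^*$-algebras. Set $\mathcal{B}=\bigotimes_{i\in I}\mathcal{B}_i$ and $\mathcal{A}=\bigotimes_{i\in I}\mathcal{A}_i$. (i) If each $\mathcal{B}_i\subseteq\mathcal{A}_i$ has the relative Dixmier property with respect to some faithful tracial state $\tau_i$ on $\mathcal{A}_i$, then $\mathcal{B}\subseteq\mathcal{A}$ also has the relative Dixmier property with respect to the faithful tracial state $\tau=\otimes_{i\in I}\tau_i$. In particular, the inclusion $\mathcal{B}\subseteq\mathcal{A}$ is $C^*$-irreducible. (ii) If each $\mathcal{B}_i\subseteq\mathcal{A}_i$ has the relative excision property with respect to a faithful state $\psi_i$ on $\mathcal{A}_i$, for each $i\in I$, then $\mathcal{B}\subseteq\mathcal{A}$ has the relative excision property with respect to the faithful state $\psi=\otimes_{i\in I}\psi_i$ on $\mathcal{A}$. In particular, if each $\mathcal{B}_i$ is simple, then the inclusion $\mathcal{B}\subseteq\mathcal{A}$ is $C^*$-irreducible.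
   Context: $\bigotimes$ denotes the minimal $C^*$-tensor product (for infinite $I$, the inductive limit of the minimal tensor products over finite subsets of $I$ along the maps $x\mapsto x\otimes1$). Let $\mathcal{B}\subseteq\mathcal{A}$ be a unital inclusion of $C^*$-algebras (the unit of $\mathcal{A}$ belongs to $\mathcal{B}$). It is $C^*$-irreducible if each intermediate $C^*$-algebra $\mathcal{B}\subseteq\mathcal{D}\subseteq\mathcal{A}$ (including $\mathcal{B}$ and $\mathcal{A}$) is simple. It has the relative Dixmier property if $C_{\mathcal{B}}(a)\cap\mathbb{C}\cdot1_{\mathcal{B}}\ne\emptyset$ for all $a\in\mathcal{A}$, where $C_{\mathcal{B}}(a)$ is the norm closure of the convex hull of $\{u^*au: u\in\mathcal{B}\text{ unitary}\}$. The phrase ''with respect to a tracial state $\tau$ on $\mathcal{A}$'' means that $C_{\mathcal{B}}(a)\cap\mathbb{C}\cdot1_{\mathcal{B}}=\{\tau(a)\cdot1_{\mathcal{B}}\}$ for all $a\in\mathcal{A}$ (which is automatic when the inclusion has the relative Dixmier property and $\tau$ is a tracial state on $\mathcal{A}$). It has the relative excision property with respect to a state $\psi$ on $\mathcal{A}$ if there is a net $\{h_\alpha\}$ of positive elements in $\mathcal{B}$ with $\|h_\alpha\|=1$ and $\lim_\alpha\|h_\alpha^{1/2}ah_\alpha^{1/2}-\psi(a)h_\alpha\|=0$ for all $a\in\mathcal{A}$. *)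

(* Defs.v *)
From HB Require Import structures.
From mathcomp Require Import all_boot all_order all_algebra finmap.
From mathcomp Require Export complex.
From mathcomp Require Import all_classical all_reals all_analysis.

Set Implicit Arguments.
Unset Strict Implicit.
Unset Printing Implicit Defensive.

Import Order.TTheory GRing.Theory Num.Theory.
Import numFieldNormedType.Exports.

Local Open Scope classical_set_scope.
Local Open Scope ring_scope.
Local Open Scope complex_scope.

(* Unital complex C*-algebras.  The norm of a normed module over R[i] takes its
   values in R[i]; they are nonnegative, hence real, for the order of R[i].
   The zero algebra, which has no states, is excluded by cone_neq0.
   HB does not allow a structure to inherit both from rings and from normed
   modules, so that the product is a field of the mixin and the ring structure
   is added to its instances afterwards. *)
HB.mixin Record isCStarAlgebra (R : realType) A
    of CompleteNormedModule R[i] A := {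
  cone : A;
  cmul : A -> A -> A;
  star : A -> A;
  cmulA : associative cmul;
  cmul1l : left_id cone cmul;
  cmul1r : right_id cone cmul;
  cmulDl : left_distributive cmul +%R;
  cmulDr : right_distributive cmul +%R;
  cone_neq0 : cone != 0;
  cmulZl : forall (c : R[i]) (a b : A), c *: cmul a b = cmul (c *: a) b;
  cmulZr : forall (c : R[i]) (a b : A), c *: cmul a b = cmul a (c *: b);
  starK : involutive star;
  starD : {morph star : a b / a + b};
  starZ : forall (c : R[i]) (a : A), star (c *: a) = c^* *: star a;
  starM : forall a b : A, star (cmul a b) = cmul (star b) (star a);
  normM_le : forall a b : A, `|cmul a b| <= `|a| * `|b|;
  norm_starM : forall a : A, `|cmul (star a) a| = `|a| ^+ 2
}.

#[short(type="cstarAlgType")]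
HB.structure Definition CStarAlgebra (R : realType) :=
  {A of isCStarAlgebra R A & CompleteNormedModule R[i] A}.

#[non_forgetful_inheritance]
HB.instance Definition _ (R : realType) (A : cstarAlgType R) :=
  GRing.Zmodule_isNzRing.Build (CStarAlgebra.sort A)
    cmulA cmul1l cmul1r cmulDl cmulDr cone_neq0.
#[non_forgetful_inheritance]
HB.instance Definition _ (R : realType) (A : cstarAlgType R) :=
  GRing.Lmodule_isLalgebra.Build R[i] (CStarAlgebra.sort A) cmulZl.
#[non_forgetful_inheritance]
HB.instance Definition _ (R : realType) (A : cstarAlgType R) :=
  GRing.Lalgebra_isAlgebra.Build R[i] (CStarAlgebra.sort A) cmulZr.

Section CStarAlgebraTheory.
Context {R : realType} {A : cstarAlgType R}.
Implicit Types (B D J : set A) (phi : A -> R[i]).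

Definition unitary (u : A) := star u * u = 1 /\ u * star u = 1.

Definition cpositive (a : A) := exists b : A, a = star b * b.

(* s = h ^ (1/2); positive square roots exist and are unique *)
Definition is_psqrt (h s : A) := cpositive s /\ s * s = h.

Record unital_cstar_subalgebra (D : set A) : Prop := {
  csub_closed : closed D;
  csub1 : D 1;
  csubD : forall a b, D a -> D b -> D (a + b);
  csubZ : forall (c : R[i]) a, D a -> D (c *: a);
  csubM : forall a b, D a -> D b -> D (a * b);
  csub_star : forall a, D a -> D (star a)
}.

Record closed_ideal (D J : set A) : Prop := {
  cideal_sub : J `<=` D;
  cideal_closed : closed J;
  cideal0 : J 0;
  cidealD : forall a b, J a -> J b -> J (a + b);
  cidealZ : forall (c : R[i]) a, J a -> J (c *: a);
  cidealMl : forall d a, D d -> J a -> J (d * a);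
  cidealMr : forall a d, J a -> D d -> J (a * d)
}.

Definition cstar_simple D :=
  forall J, closed_ideal D J -> J = [set 0] \/ J = D.

(* the inclusion of B in A *)
Definition cstar_irreducible B :=
  forall D, unital_cstar_subalgebra D -> B `<=` D -> cstar_simple D.

Definition is_state phi :=
  [/\ scalar phi, forall a, cpositive a -> 0 <= phi a & phi 1 = 1].

Definition faithful phi := forall a, cpositive a -> phi a = 0 -> a = 0.

Definition tracial phi := forall a b, phi (a * b) = phi (b * a).

Definition convex_hull (S : set A) : set A :=
  [set x | exists (n : nat) (t : 'I_n -> R[i]) (s : 'I_n -> A),
    [/\ forall k, 0 <= t k, \sum_(k < n) t k = 1, forall k, S (s k)
      & x = \sum_(k < n) t k *: s k]].

Definition dixmier_set B (a : A) : set A :=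
  closure (convex_hull [set star u * a * u | u in [set u | B u /\ unitary u]]).

Definition relative_dixmier B phi :=
  forall a : A, dixmier_set B a `&` range (fun c : R[i] => c *: (1 : A))
              = [set phi a *: (1 : A)].

Record directed_preorder (L : Type) (le : L -> L -> Prop) : Prop := {
  dir_inhabited : inhabited L;
  dir_refl : forall l, le l l;
  dir_trans : forall l m n, le l m -> le m n -> le l n;
  dir_ub : forall l m, exists n, le l n /\ le m n
}.

(* the net is h; s is the net of its square roots *)
Definition relative_excision B phi :=
  exists (L : Type) (le : L -> L -> Prop) (h s : L -> A),
    [/\ directed_preorder le,
        forall l, [/\ B (h l), cpositive (h l), `|h l| = 1 & is_psqrt (h l) (s l)]
      & forall (a : A) (e : R[i]), 0 < e -> exists l0, forall l, le l0 l ->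
          `|s l * a * s l - phi a *: h l| < e].

Definition generated_cstar (S : set A) : set A :=
  smallest unital_cstar_subalgebra S.

End CStarAlgebraTheory.

Record unital_star_morphism (R : realType) (A T : cstarAlgType R) (f : A -> T) :
    Prop := {
  smorph_linear : linear f;
  smorph1 : f 1 = 1;
  smorphM : forall a b, f (a * b) = f a * f b;
  smorph_star : forall a, f (star a) = star (f a)
}.

Section TensorProduct.
Context {R : realType} {I : choiceType} (A : I -> cstarAlgType R).

(* For F : {fset I}, the list [:: a_1; ..; a_n] of families stands for the
   element \sum_k \bigotimes_(i in F) a_k i of the algebraic tensor product of
   the A i, i in F. *)
Definition formal_tensor := seq (forall i, A i).

Definition ftmul (x y : formal_tensor) : formal_tensor :=
  [seq (fun i => a i * b i) | a <- x, b <- y].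

Definition ftstar (x : formal_tensor) : formal_tensor :=
  [seq (fun i => star (a i)) | a <- x].

Definition tensor_functional (phi : forall i, A i -> R[i]) (F : {fset I})
    (x : formal_tensor) : R[i] :=
  \sum_(a <- x) \prod_(i <- F) phi i (a i).

(* The spatial norm of x: the supremum of the operator norms of
   (\bigotimes_i pi_i) x on \bigotimes_i H_i, where pi_i on H_i is the GNS
   representation of a state phi i.  The classes of formal tensors y are dense
   in \bigotimes_i H_i, with || x y ||^2 = (\bigotimes_i phi i) ((x y)^* (x y)),
   so that the supremum runs over the unit vectors y of this form. *)
Definition spatial_norm (F : {fset I}) (x : formal_tensor) : \bar R :=
  ereal_sup [set r : \bar R |
    exists (phi : forall i, A i -> R[i]) (y : formal_tensor),
      [/\ forall i, is_state (phi i),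
          tensor_functional phi F (ftmul (ftstar y) y) = 1
        & r = (Num.sqrt (complex.Re
                (tensor_functional phi F
                  (ftmul (ftstar (ftmul x y)) (ftmul x y)))))%:E]].

Context {T : cstarAlgType R} (iota : forall i, A i -> T).
Arguments iota : clear implicits.

Definition tensor_eval (F : {fset I}) (x : formal_tensor) : T :=
  \sum_(a <- x) \prod_(i <- F) iota i (a i).

(* C*-subalgebra of T generated by the images of the B i.  If (T, iota) is the
   minimal tensor product of the A i, this is the minimal tensor product of the
   B i in its canonical embedding: spatial norms are compatible with
   inclusions of C*-algebras. *)
Definition tensor_subalgebra (B : forall i, set (A i)) : set T :=
  generated_cstar (\bigcup_i (iota i @` B i)).

(* T is the minimal tensor product of the family A, where iota i is the
   canonical embedding a |-> a \otimes 1.  For finite F the algebraic tensor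
   product of the A i, i in F, with its spatial norm embeds isometrically; as
   iota i 1 = 1, these embeddings are compatible with the maps x |-> x \otimes 1,
   and their ranges span a dense *-subalgebra, so that T is the inductive limit
   of the closures of these ranges.  This determines (T, iota) up to a unique
   isomorphism. *)
Record is_minimal_tensor_product : Prop := {
  mtp_morphism : forall i, unital_star_morphism (iota i);
  mtp_commute : forall i j, i != j -> forall (a : A i) (b : A j),
    iota i a * iota j b = iota j b * iota i a;
  mtp_isometric : forall (F : {fset I}) (x : formal_tensor),
    (complex.Re `|tensor_eval F x|)%:E = spatial_norm F x;
  mtp_dense : tensor_subalgebra (fun i => [set: A i]) = [set: T]
}.

(* phiT = \bigotimes_i phi i *)
Definition is_tensor_state (phi : forall i, A i -> R[i]) (phiT : T -> R[i]) :=
  is_state phiT /\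
  forall (F : {fset I}) (a : forall i, A i),
    phiT (\prod_(i <- F) iota i (a i)) = \prod_(i <- F) phi i (a i).

End TensorProduct.

(* Main.v *)
(* Positivity in a C*-algebra is handled without spectra: pos a says that a is
   self-adjoint and |t - a| <= t for some t.  The square root comes from the
   iteration w |-> (x + w^2) / 2, and |c| <= 1 whenever c^2 + s^2 = 1 for
   commuting self-adjoint c, s, because c + i s is then unitary.  In the
   presence of a faithful state psi, an element c with psi (y^* c y) >= 0 for
   all y is positive.

   The product functional is positive on formal tensors by the Schur product
   theorem, hence bounded for the spatial norm, and extends to T.  It is
   faithful: if Psi (z^* z) = 0, the slice map T -> A j, which is contractive
   since psi j is faithful, shows that psi j may be replaced by any state; so
   all product states that differ from Psi in finitely many factors vanish on
   y^* z^* z y for every y in the algebraic tensor product, and the definition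
   of the spatial norm gives |x| <= |x - z| for every x in it.

   The Dixmier and excision properties are checked on elementary tensors, one
   factor at a time.  A nonzero ideal J of an intermediate algebra contains
   some z^* z.  In (i) averaging puts tau (z^* z) 1 into J.  In (ii) excision
   puts an element close to a tensor product of positive h_i of norm 1 into J;
   since B_i is simple there are y_k in B_i with sum y_k^* y_k = 1 and
   sum y_k^* h_i y_k close to 1, so that J contains an element close to 1. *)

Require Import Defs.
From mathcomp Require Import all_boot all_order all_algebra finmap.
From mathcomp Require Import all_classical all_reals all_analysis.
From mathcomp Require Import ring lra.

Set Implicit Arguments.
Unset Strict Implicit.
Unset Printing Implicit Defensive.

Import Order.TTheory GRing.Theory Num.Theory.
Import numFieldNormedType.Exports.

Local Open Scope classical_set_scope.
Local Open Scope ring_scope.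
Local Open Scope complex_scope.

(** * Real-valued norms *)

(** The usual proof that [star b * b] is positive goes through spectra. Both parts of the theorem
    provide faithful states, so what comes before them uses only squares of self-adjoint elements,
    and general conjugation is postponed until a faithful state is at hand.

    In [T] only the norms of algebraic elements are given, as suprema over product states. Maps on
    [T] are therefore prescribed on elementary tensors, bounded there and extended by density, and
    identities between bounded linear maps are checked on elementary tensors alone.

    Faithfulness is the delicate point, since injectivity on a dense subspace does not pass to the
    completion: an element [z] with [Psi (star z * z) = 0] need not be algebraic. It is excluded by
    a norm estimate on its algebraic approximants. The states in the spatial norm are arbitrary, and
    the norm over [F] sees only their values on [F]; this is why finite modifications of the given
    product state are enough.

    An empty index set is treated apart: a formal tensor over it evaluates to a natural multiple of
    1, so other scalars are out of reach. *)

Section ComplexModulus.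
Context {R : realType}.
Implicit Types (c : R[i]) (r : R).

Definition cmod c : R := complex.Re `|c|.

Lemma cmodE c : `|c| = (cmod c)%:C.
Proof. by rewrite RRe_real ?normr_real. Qed.

Lemma cmod_ge0 c : 0 <= cmod c.
Proof. by rewrite -ler0c -cmodE normr_ge0. Qed.

Lemma cmodM c d : cmod (c * d) = cmod c * cmod d.
Proof. by apply: complexI; rewrite rmorphM -!cmodE normrM. Qed.

Lemma cmodD c d : cmod (c + d) <= cmod c + cmod d.
Proof. by rewrite -lecR rmorphD -!cmodE ler_normD. Qed.

Lemma cmodJ c : cmod (conjc c) = cmod c.
Proof. by rewrite /cmod normcJ. Qed.

Lemma cmodR r : cmod r%:C = `|r|.
Proof.
apply: complexI; rewrite -cmodE normc_def /= expr0n /= addr0 sqrtr_sqr //.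
Qed.

Lemma cmod_i : cmod 'i%C = 1.
Proof. by rewrite /cmod normc_def /= expr0n expr1n /= add0r sqrtr1. Qed.

Lemma cmod_eq0 c : (cmod c == 0) = (c == 0).
Proof. by rewrite -(inj_eq (@complexI R)) -cmodE normr_eq0. Qed.

Lemma Re_le_cmod c : `|complex.Re c| <= cmod c.
Proof. by rewrite -lecR -cmodE normc_ge_Re. Qed.

Lemma Im_le_cmod c : `|complex.Im c| <= cmod c.
Proof.
have := Re_le_cmod (c * 'i%C).
by rewrite ReiNIm normrN cmodM cmod_i mulr1.
Qed.

Lemma cmod_sqr c : (cmod c ^+ 2)%:C = conjc c * c.
Proof. by rewrite rmorphXn /= -cmodE sqr_normc mulrC. Qed.

Lemma ge0_Re c : 0 <= c -> (complex.Re c)%:C = c.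
Proof. by move=> /ger0_real /RRe_real. Qed.

Lemma Re_ge0 c : 0 <= c -> 0 <= complex.Re c.
Proof. by move=> c0; rewrite -ler0c ge0_Re. Qed.

Lemma Re_gt0 c : 0 < c -> 0 < complex.Re c.
Proof. by move=> c0; rewrite -ltcR ge0_Re // ltW. Qed.

Lemma ge0_cmod c : 0 <= c -> cmod c = complex.Re c.
Proof. by move=> c0; rewrite -{1}(ge0_Re c0) cmodR ger0_norm // Re_ge0. Qed.

Lemma cmod_le_ReIm c : cmod c <= `|complex.Re c| + `|complex.Im c|.
Proof.
rewrite {1}(complexE c); apply: le_trans (cmodD _ _) _.
by rewrite cmodM !cmodR cmod_i mul1r.
Qed.

End ComplexModulus.

Section NormLayer.
Context {R : realType} {V : normedModType R[i]}.
Implicit Types (a b : V) (c : R[i]) (r e : R).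

(* The norm of V takes its values in R[i], whose order is not total; nm is the
   same norm with values in R. *)
Definition nm a : R := complex.Re `|a|.

Lemma nmE a : `|a| = (nm a)%:C.
Proof. by rewrite RRe_real ?normr_real. Qed.

Lemma nm_ge0 a : 0 <= nm a.
Proof. by rewrite -ler0c -nmE normr_ge0. Qed.

Lemma nm0 : nm 0 = 0.
Proof. by rewrite /nm normr0. Qed.

Lemma nm_eq0 a : (nm a == 0) = (a == 0).
Proof. by rewrite -(inj_eq (@complexI R)) -nmE normr_eq0. Qed.

Lemma nmD a b : nm (a + b) <= nm a + nm b.
Proof. by rewrite -lecR rmorphD /= -!nmE ler_normD. Qed.

Lemma nmN a : nm (- a) = nm a.
Proof. by rewrite /nm normrN. Qed.

Lemma nm_sub a b : nm (a - b) = nm (b - a).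
Proof. by rewrite /nm distrC. Qed.

Lemma nmB a b : nm (a - b) <= nm a + nm b.
Proof. by rewrite -(nmN b) nmD. Qed.

Lemma nm_tri b a d : nm (a - d) <= nm (a - b) + nm (b - d).
Proof. by apply: le_trans (nmD _ _); rewrite addrA subrK. Qed.

Lemma nm_le_add a b : nm a <= nm b + nm (a - b).
Proof. by apply: le_trans (nmD _ _); rewrite addrC subrK. Qed.

Lemma nmZ c a : nm (c *: a) = cmod c * nm a.
Proof. by apply: complexI; rewrite rmorphM /= -!nmE -cmodE normrZ. Qed.

Lemma nmZR r a : 0 <= r -> nm (r%:C *: a) = r * nm a.
Proof. by move=> r0; rewrite nmZ cmodR ger0_norm. Qed.

Lemma nm_sum (K : Type) (s : seq K) (f : K -> V) :
  nm (\sum_(k <- s) f k) <= \sum_(k <- s) nm (f k).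
Proof.
elim: s => [|k s IH]; first by rewrite !big_nil nm0.
by rewrite !big_cons; apply: le_trans (nmD _ _) _; rewrite lerD2l.
Qed.

Lemma nm_inj a b : (forall e, 0 < e -> nm (a - b) <= e) -> a = b.
Proof.
move=> H; apply/eqP; rewrite -subr_eq0 -nm_eq0 eq_le nm_ge0 andbT.
by apply/ler_addgt0Pr => e e0; rewrite add0r H.
Qed.

Lemma closureP (S : set V) a :
  closure S a <-> forall e, 0 < e -> exists2 b, S b & nm (a - b) < e.
Proof.
split=> [Sa e e0|H U].
  have /Sa [b [Sb]] : nbhs a (ball a e%:C) by apply: nbhsx_ballx; rewrite ltcR.
  by rewrite -ball_normE /= nmE ltcR => ab; exists b.
rewrite -nbhs_ballE => -[e /= e0 aU].
have [|b Sb ab] := H (complex.Re e); first exact: Re_gt0.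
exists b; split=> //; apply: aU; rewrite -ball_normE /= nmE.
by rewrite -(ge0_Re (ltW e0)) ltcR.
Qed.

Lemma closedP (S : set V) :
  closed S <->
  forall a, (forall e, 0 < e -> exists2 b, S b & nm (a - b) < e) -> S a.
Proof.
split=> [cS a /closureP|H a /closureP]; [exact: cS|exact: H].
Qed.

End NormLayer.

Section Completeness.
Context {R : realType}.

(** A bare property, so that C*-algebras and the scalars [R[i]^o] can both be targets of
    [dense_extension]. *)
Definition nm_complete (V : normedModType R[i]) := forall u : nat -> V,
  (forall e : R, 0 < e -> exists N, forall m n, (N <= m)%N -> (N <= n)%N ->
     nm (u m - u n) < e) ->
  exists l, forall e : R, 0 < e -> exists N, forall n, (N <= n)%N ->
     nm (u n - l) < e.

Lemma completeNormedMod_complete (V : completeNormedModType R[i]) :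
  nm_complete V.
Proof.
move=> u cu.
have /cauchy_cvg/cvg_ex[l ul] : cauchy (u n @[n --> \oo]).
  apply/cauchy_ballP => e e0.
  have [|N HN] := cu (complex.Re e); first exact: Re_gt0.
  exists ([set v | exists2 n, (N <= n)%N & v = u n],
          [set v | exists2 n, (N <= n)%N & v = u n]) => /=.
    by split; exists N => // n /= Nn; exists n.
  move=> [v w] /= [[m Nm ->] [n Nn ->]].
  by rewrite -ball_normE /= nmE -(ge0_Re (ltW e0)) ltcR HN.
exists l => e e0.
have /cvgrPdist_lt/(_ e%:C) := ul.
rewrite ltcR => /(_ e0) [N _ HN]; exists N => n Nn.
by have := HN n Nn; rewrite /= nmE ltcR nm_sub.
Qed.

Lemma real_complete (u : nat -> R) :
  (forall e : R, 0 < e -> exists N, forall m n, (N <= m)%N -> (N <= n)%N ->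
     `|u m - u n| < e) ->
  exists l, forall e : R, 0 < e -> exists N, forall n, (N <= n)%N ->
     `|u n - l| < e.
Proof.
move=> cu.
have /cauchy_cvg/cvg_ex[l ul] : cauchy (u n @[n --> \oo]).
  apply/cauchy_ballP => e e0.
  have [//|N HN] := cu e.
  exists ([set v | exists2 n, (N <= n)%N & v = u n],
          [set v | exists2 n, (N <= n)%N & v = u n]) => /=.
    by split; exists N => // n /= Nn; exists n.
  move=> [v w] /= [[m Nm ->] [n Nn ->]].
  by rewrite -ball_normE /= HN.
exists l => e e0.
have /cvgrPdist_lt/(_ e e0)[N _ HN] := ul; exists N => n Nn.
by have := HN n Nn; rewrite /= distrC.
Qed.

Lemma complex_complete : nm_complete (R[i]^o : normedModType R[i]).
Proof.
move=> u cu.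
have [|a Ha] := @real_complete (fun n => complex.Re (u n)).
  move=> e /cu[N HN]; exists N => m n Nm Nn.
  apply: le_lt_trans (HN m n Nm Nn); rewrite -raddfB; exact: Re_le_cmod.
have [|b Hb] := @real_complete (fun n => complex.Im (u n)).
  move=> e /cu[N HN]; exists N => m n Nm Nn.
  apply: le_lt_trans (HN m n Nm Nn); rewrite -raddfB; exact: Im_le_cmod.
exists (a +i* b) => e e0.
have e2 : 0 < e / 2 by lra.
have [N HN] := Ha _ e2; have [M HM] := Hb _ e2.
exists (maxn N M) => n; rewrite geq_max => /andP[/HN Hn /HM Hm].
apply: le_lt_trans (cmod_le_ReIm _) _.
rewrite !raddfB /=; lra.
Qed.

End Completeness.

(** * Square roots in C*-algebras *)

Section CStarBasics.
Context {R : realType} {A : cstarAlgType R}.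
Implicit Types (a b x y : A) (r t e : R) (D : set A).

Lemma star_mul a b : star (a * b) = star b * star a.
Proof. exact: starM. Qed.

Lemma star1 : star (1 : A) = 1.
Proof.
have : star (1 * star 1) = 1 :> A by rewrite mul1r starK.
by rewrite star_mul starK mul1r.
Qed.

Lemma star0 : star (0 : A) = 0.
Proof. by apply: (addrI (star 0)); rewrite -starD !addr0. Qed.

Lemma starN a : star (- a) = - star a.
Proof. by apply: (addrI (star a)); rewrite -starD !subrr star0. Qed.

Lemma starB a b : star (a - b) = star a - star b.
Proof. by rewrite starD starN. Qed.

Lemma star_sum (K : Type) (s : seq K) (f : K -> A) :
  star (\sum_(k <- s) f k) = \sum_(k <- s) star (f k).
Proof. exact: (big_morph _ (@starD _ _) star0). Qed.

Lemma star_scale (c : R[i]) a : star (c *: a) = conjc c *: star a.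
Proof. exact: starZ. Qed.

Lemma starZR r a : star (r%:C *: a) = r%:C *: star a.
Proof. by rewrite star_scale conjc_real. Qed.

Lemma star_scaleM (c d : R[i]) a b :
  star (c *: a) * (d *: b) = (conjc c * d) *: (star a * b).
Proof. by rewrite star_scale -scalerAl -scalerAr scalerA. Qed.

Lemma nmM a b : nm (a * b) <= nm a * nm b.
Proof. by rewrite -lecR rmorphM /= -!nmE; exact: normM_le. Qed.

Lemma nm_starM a : nm (star a * a) = nm a ^+ 2.
Proof. by apply: complexI; rewrite rmorphXn /= -!nmE; exact: norm_starM. Qed.

Lemma nm_star a : nm (star a) = nm a.
Proof.
suff le b : nm b <= nm (star b).
  by apply/eqP; rewrite eq_le le andbT -{2}(starK a) le.
have [->|b0] := eqVneq (nm b) 0; first exact: nm_ge0.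
have {}b0 : 0 < nm b by rewrite lt_neqAle eq_sym b0 nm_ge0.
rewrite -(ler_pM2r b0) -expr2 -nm_starM; exact: nmM.
Qed.

Lemma nm1 : nm (1 : A) = 1.
Proof.
have := nm_starM 1; rewrite star1 mulr1 => n1.
have : nm (1 : A) != 0 by rewrite nm_eq0 oner_eq0.
by move=> /mulfI; apply; rewrite mulr1 -expr2.
Qed.

Definition sa a := star a = a.

Lemma sa0 : sa 0. Proof. exact: star0. Qed.
Lemma sa1 : sa 1. Proof. exact: star1. Qed.
Lemma saD a b : sa a -> sa b -> sa (a + b).
Proof. by rewrite /sa starD => -> ->. Qed.
Lemma saN a : sa a -> sa (- a).
Proof. by rewrite /sa starN => ->. Qed.
Lemma saB a b : sa a -> sa b -> sa (a - b).
Proof. by move=> sa_a sb; apply: saD => //; apply: saN. Qed.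
Lemma saZ r a : sa a -> sa (r%:C *: a).
Proof. by rewrite /sa starZR => ->. Qed.
Lemma saM a b : sa a -> sa b -> a * b = b * a -> sa (a * b).
Proof. by rewrite /sa star_mul => -> -> ->. Qed.
Lemma sa_sqr a : sa a -> sa (a * a).
Proof. by move=> h; apply: saM. Qed.
Lemma sa_conj a y : sa a -> sa (star y * a * y).
Proof. by move=> h; rewrite /sa !star_mul starK h mulrA. Qed.
Lemma sa_starM a : sa (star a * a).
Proof. by rewrite /sa star_mul starK. Qed.
Lemma sa_scalar r : sa (r%:C *: 1).
Proof. exact/saZ/sa1. Qed.

Lemma nm_sqr a : sa a -> nm (a * a) = nm a ^+ 2.
Proof. by move=> h; rewrite -{1}h nm_starM. Qed.

Lemma sa_sqr_eq0 a : sa a -> a * a = 0 -> a = 0.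
Proof.
move=> h a0; have := nm_sqr h.
by rewrite a0 nm0 => /esym/eqP; rewrite sqrf_eq0 nm_eq0 => /eqP.
Qed.

Lemma closed_sa : closed (sa : set A).
Proof.
apply/closedP => a H; apply: nm_inj => e e0.
have [|b sb ab] := H (e / 2); first lra.
have -> : star a - a = star (a - b) - (a - b).
  by rewrite starB sb opprB addrA subrK.
apply: le_trans (nmB _ _) _; rewrite nm_star; lra.
Qed.

Lemma scalar_mull r a : (r%:C *: 1) * a = r%:C *: a.
Proof. by rewrite -scalerAl mul1r. Qed.

Lemma scalar_mulr r a : a * (r%:C *: 1) = r%:C *: a.
Proof. by rewrite -scalerAr mulr1. Qed.

(** Square roots and Neumann series of an element lie in each such set that contains the element. A
    C*-subalgebra as [D] gives membership, a commutant gives commutation; closure under [star] is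
    left out so that the commutant of any element qualifies. *)
Record real_subalgebra D : Prop := {
  rsub_closed : closed D;
  rsub1 : D 1;
  rsubD : forall a b, D a -> D b -> D (a + b);
  rsubZ : forall r a, D a -> D (r%:C *: a);
  rsubM : forall a b, D a -> D b -> D (a * b)
}.

Lemma csub_real_subalgebra D : unital_cstar_subalgebra D -> real_subalgebra D.
Proof. by case=> ? ? ? sZ ? ?; split=> // r a; apply: sZ. Qed.

Lemma rsub0 D : real_subalgebra D -> D 0.
Proof. by move=> sD; rewrite -(scale0r 1); exact: (rsubZ sD 0 (rsub1 sD)). Qed.

Lemma rsubN D a : real_subalgebra D -> D a -> D (- a).
Proof.
by move=> sD Da; rewrite -scaleN1r -(rmorphN1 (real_complex R)); apply: rsubZ.
Qed.

Lemma rsubB D a b : real_subalgebra D -> D a -> D b -> D (a - b).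
Proof. by move=> sD Da Db; apply: rsubD => //; apply: rsubN. Qed.

Definition commutant b : set A := [set a | a * b = b * a].

Lemma commutant_real_subalgebra b : real_subalgebra (commutant b).
Proof.
split=> [|||r a|a a'] /=; rewrite /commutant /=.
- apply/closedP => a H; apply: nm_inj => e e0.
  have p : 0 < 2 * nm b + 1 by have := nm_ge0 b; lra.
  have [|c cb ac] := H (e / (2 * nm b + 1)); first exact: divr_gt0.
  have -> : a * b - b * a = (a - c) * b - b * (a - c).
    by rewrite mulrBl mulrBr cb opprB addrA subrK.
  apply: le_trans (nmB _ _) _; move: ac; rewrite ltr_pdivlMr // => ac.
  have := nmM (a - c) b; have := nmM b (a - c); have := nm_ge0 (a - c).
  by lra.
- by rewrite mul1r mulr1.
- by move=> a a' /= h h'; rewrite mulrDl mulrDr h h'.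
- by move=> /= h; rewrite -scalerAl -scalerAr h.
- by move=> /= h h'; rewrite -mulrA h' mulrA h mulrA.
Qed.

Definition limit (u : nat -> A) (l : A) :=
  forall e, 0 < e -> exists N, forall n, (N <= n)%N -> nm (u n - l) < e.

Lemma closed_limit D u l : closed D -> (forall n, D (u n)) -> limit u l -> D l.
Proof.
move=> /closedP cD Du ul; apply: cD => e /ul[N HN].
by exists (u N) => //; rewrite nm_sub HN.
Qed.

Lemma limit_nm_le u l r : (forall n, nm (u n) <= r) -> limit u l -> nm l <= r.
Proof.
move=> ur ul; apply/ler_addgt0Pr => e /ul[N /(_ N (leqnn _)) HN].
apply: le_trans (nm_le_add _ (u N)) _; rewrite nm_sub; have := ur N; lra.
Qed.

(* Completeness in the form used for the square root and for the Neumann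
   series: the increments are dominated by those of a bounded real sequence. *)
Lemma dominated_limit (u : nat -> A) (om : nat -> R) (M : R) :
  (forall n, nm (u n.+1 - u n) <= om n.+1 - om n) -> (forall n, om n <= M) ->
  exists l, limit u l.
Proof.
move=> dom bnd; apply: completeNormedMod_complete => e e0.
have om_mono : {homo om : n m / (n <= m)%N >-> n <= m}.
  apply: homo_leq => [//|y x z|n]; first exact: le_trans.
  by rewrite -subr_ge0; apply: le_trans (dom n); apply: nm_ge0.
have [l _ Hl] : exists2 l, True & forall e, 0 < e -> exists N, forall n, (N <= n)%N ->
     `|om n - l| < e.
  have /cvg_ex[l ol] : cvgn om.
    apply: nondecreasing_is_cvgn => //; exists M => _ [n _ <-]; exact: bnd.
  exists l => // d d0.
  have /cvgrPdist_lt/(_ d d0)[N _ HN] := ol; exists N => n Nn.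
  by have := HN n Nn; rewrite /= distrC.
have [|N HN] := Hl (e / 2); first lra.
exists N => m n Nm Nn.
wlog mn : m n Nm Nn / (n <= m)%N.
  by move=> W; have [/W|/ltnW/W] := leqP n m; [exact|rewrite nm_sub; exact].
have le k : nm (u (n + k)%N - u n) <= om (n + k)%N - om n.
  elim: k => [|k IH]; first by rewrite addn0 !subrr nm0.
  apply: le_trans (nm_tri (u (n + k)%N) _ _) _.
  by have := dom (n + k)%N; rewrite addnS; lra.
have := le (m - n)%N; rewrite subnKC //.
have := HN m Nm; have := HN n Nn.
rewrite !ltr_norml => /andP[? ?] /andP[? ?]; lra.
Qed.

Lemma sqr_sub a b : a * a - b * b = a * (a - b) + (a - b) * b.
Proof. by rewrite mulrBr mulrBl addrA subrK. Qed.

(* 1 - w is the square root of 1 - x. *)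
Lemma sqrt_series x : nm x <= 1 ->
  exists w : A, [/\ nm w <= 1, w + w = x + w * w & forall D, closed D -> D 0 ->
    (forall v, D v -> D (2^-1%:C *: (x + v * v))) -> D w].
Proof.
move=> x1.
pose f (v : A) : A := 2^-1%:C *: (x + v * v).
(* The scalar iteration with [x] replaced by its bound 1. It stays below 1 and, as the coefficients
   of [f] are positive, it dominates the norms and the increments of [w]. *)
pose g (o : R) := (1 + o ^+ 2) / 2.
pose w n : A := iter n f 0; pose om n := iter n g 0.
have half0 : (0 : R) <= 2^-1 by rewrite invr_ge0.
have fB (v v' : A) : nm (f v - f v') <= 2^-1 * ((nm v + nm v') * nm (v - v')).
  rewrite /f -scalerBr nmZR // ler_wpM2l // opprD addrACA subrr add0r sqr_sub.
  apply: le_trans (nmD _ _) _.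
  rewrite [leRHS]mulrDl; apply: lerD; first exact: nmM.
  by rewrite [_ * nm (v - v')]mulrC; exact: nmM.
have omb n : 0 <= om n <= 1.
  elim: n => [|n /andP[IH0 IH1]]; first by rewrite /om /= lexx ler01.
  rewrite /om /= -/(om n) /g; apply/andP; split; first nra.
  by nra.
have wom n : nm (w n) <= om n.
  elim: n => [|n IH]; first by rewrite nm0.
  rewrite /w /om /= -/(w n) -/(om n) /f /g nmZR //.
  have := nmD x (w n * w n); have := nmM (w n) (w n); have := nm_ge0 (w n).
  have /andP[] := omb n; nra.
have dom n : nm (w n.+1 - w n) <= om n.+1 - om n.
  elim: n => [|n IH].
    have := wom 1%N; by rewrite /w /om /= !subr0.
  rewrite {1}/w {1}/w /= -/(w n.+1) -/(w n).
  apply: le_trans (fB _ _) _.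
  have -> : om n.+2 - om n.+1 = 2^-1 * ((om n.+1 + om n) * (om n.+1 - om n)).
    rewrite {1}/om {2}/om /= -/(om n.+1) -/(om n) /g; by field.
  rewrite ler_wpM2l //; apply: ler_pM => //.
  - by rewrite addr_ge0 // nm_ge0.
  - exact: nm_ge0.
  - by apply: lerD; [exact: (wom n.+1)|exact: wom].
have [n|l wl] := dominated_limit dom (M := 1).
  by have /andP[] := omb n.
have l1 : nm l <= 1.
  apply: limit_nm_le wl => n; apply: le_trans (wom n) _; by have /andP[] := omb n.
have fl : f l = l.
  apply: nm_inj => e e0; have [|N HN] := wl (e / 2); first lra.
  apply: le_trans (nm_tri (f (w N)) _ _) _.
  have := HN N (leqnn _); have := HN N.+1 (leqnSn _).
  rewrite /w iterS -/(w N) => h1 h2.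
  have h3 := fB l (w N); rewrite (nm_sub l) in h3.
  have := nm_ge0 l; have := nm_ge0 (w N); have := nm_ge0 (w N - l).
  have w1 : nm (w N) <= 1 by apply: le_trans (wom N) _; have /andP[] := omb N.
  nra.
exists l; split=> //.
  rewrite -[in LHS]fl /f -scalerDl -rmorphD /=.
  by rewrite (_ : 2^-1 + 2^-1 = 1) ?scale1r //; lra.
move=> D cD D0 Df; apply: closed_limit wl => // n.
by elim: n => //= n IH; apply: Df.
Qed.

End CStarBasics.

(** * Positive elements *)

Section Positivity.
Context {R : realType} {A : cstarAlgType R}.
Implicit Types (a b c d s x y p q : A) (r t e : R) (D : set A).

(* For self-adjoint a this says that the spectrum of a is nonnegative; unlike
   cpositive it is visibly closed under sums.  The two notions agree, see
   pos_cpositive and pos_starM. *)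
Definition pos a := sa a /\ exists t : R, nm (t%:C *: 1 - a) <= t.

Lemma posD a b : pos a -> pos b -> pos (a + b).
Proof.
move=> [sa_a [t ta]] [sb [r rb]]; split; first exact: saD.
exists (t + r); rewrite rmorphD scalerDl opprD addrACA.
by apply: le_trans (nmD _ _) _; apply: lerD.
Qed.

Lemma posZ r a : 0 <= r -> pos a -> pos (r%:C *: a).
Proof.
move=> r0 [sa_a [t ta]]; split; first exact: saZ.
exists (r * t); rewrite rmorphM -scalerA -scalerBr nmZR //.
exact: ler_wpM2l.
Qed.

Lemma pos_scalar r : 0 <= r -> pos (r%:C *: 1).
Proof.
by move=> r0; split; [exact: sa_scalar|exists r; rewrite subrr nm0].
Qed.

Lemma pos0 : pos 0.
Proof. by rewrite -(scale0r 1); exact: (@pos_scalar 0). Qed.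

Lemma pos_sum (K : Type) (l : seq K) (f : K -> A) :
  (forall k, pos (f k)) -> pos (\sum_(k <- l) f k).
Proof.
move=> pf; elim: l => [|k l IH]; first by rewrite big_nil; exact: pos0.
by rewrite big_cons; exact: posD.
Qed.

Lemma pos_nm_sub x t : sa x -> nm x <= t -> pos (t%:C *: 1 - x).
Proof.
move=> sx xt; split; first by apply: saB => //; exact: sa_scalar.
by exists t; rewrite opprB addrC subrK.
Qed.

Lemma pos_nm_add x t : sa x -> nm x <= t -> pos (t%:C *: 1 + x).
Proof.
move=> sx xt; rewrite -{1}(opprK x); apply: pos_nm_sub; first exact: saN.
by rewrite nmN.
Qed.

(** The bound in [pos] says that [x = 1 - a / t] has norm at most 1. As [1 - w] is the root of
    [1 - x = a / t], the root of [a] is [sqrt t (1 - w)], a limit of real polynomials in [a]. *)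
Lemma pos_sqrt a : pos a -> exists s, [/\ pos s, s * s = a
  & forall D, real_subalgebra D -> D a -> D s].
Proof.
move=> [sa_a [t ta]].
have [t0|t0] := leP t 0.
  have a0 : a = 0.
    have tz : t = 0 by apply/eqP; rewrite eq_le t0 (le_trans (nm_ge0 _) ta).
    move: ta; rewrite tz scale0r sub0r nmN => ta.
    by apply/eqP; rewrite -nm_eq0 eq_le ta nm_ge0.
  exists 0; split; [exact: pos0|by rewrite a0 mulr0|].
  by move=> D sD _; apply: rsub0.
pose x : A := t^-1%:C *: (t%:C *: 1 - a).
have ti0 : 0 <= t^-1 by rewrite invr_ge0 ltW.
have [|w [w1 ww Dw]] := @sqrt_series _ _ x.
  by rewrite nmZR // mulrC ler_pdivrMr // mul1r.
have sw : sa w.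
  apply: (Dw _ closed_sa sa0) => v sv; apply: saZ; apply: saD; last exact: sa_sqr.
  by apply/saZ/saB => //; exact: sa_scalar.
have x1 : 1 - x = t^-1%:C *: a.
  rewrite /x scalerBr scalerA -rmorphM mulVf ?gt_eqF // scale1r.
  by rewrite opprB addrC subrK.
have sq : (1 - w) * (1 - w) = t^-1%:C *: a.
  rewrite mulrBr mulr1 mulrBl mul1r opprB -x1 -addrA; congr (1 + _).
  have -> : x = w + w - w * w by rewrite ww addrK.
  by rewrite opprB addrA addrC addrA opprD [LHS]addrC addrA.
exists ((Num.sqrt t)%:C *: (1 - w)); split.
- apply: posZ; first exact: sqrtr_ge0.
  split; first by apply: saB => //; exact: sa1.
  by exists 1; rewrite scale1r opprB addrC subrK.
- rewrite -scalerAl -scalerAr scalerA -rmorphM -expr2 sqr_sqrtr ?ltW // sq.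
  by rewrite scalerA -rmorphM mulfV ?gt_eqF // scale1r.
- move=> D sD Da; apply: (rsubZ sD); apply: (rsubB sD); first exact: rsub1.
  apply: Dw => [||v Dv]; [exact: (rsub_closed sD)|exact: rsub0|].
  apply: (rsubZ sD); apply: (rsubD sD); last exact: (rsubM sD).
  by apply/(rsubZ sD)/(rsubB sD) => //; apply/(rsubZ sD)/(rsub1 sD).
Qed.

Lemma unitary_part_nm c s : sa c -> sa s -> c * s = s * c ->
  c * c + s * s = 1 -> nm c <= 1.
Proof.
move=> sc ss cs1 sum1; pose u := c + 'i%C *: s.
have su : star u = c - 'i%C *: s.
  rewrite /u starD star_scale sc ss -scaleNr; congr (_ + _ *: _).
  by apply/eqP; rewrite eq_complex /= oppr0 !eqxx.
have u1 : nm u = 1.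
  have : nm u ^+ 2 = 1.
    rewrite -nm_starM su /u mulrDr !mulrBl -!scalerAl -!scalerAr cs1 scalerA.
    have -> : 'i%C * 'i%C = -1 :> R[i] by rewrite -expr2 sqr_i.
    by rewrite scaleN1r opprK addrA subrK sum1 nm1.
  by move=> /eqP; rewrite sqrf_eq1 => /orP[/eqP //|/eqP uN]; have := nm_ge0 u; lra.
have : nm (c + c) <= nm u + nm (star u).
  have -> : c + c = u + star u by rewrite su /u addrACA subrr addr0.
  exact: nmD.
rewrite nm_star u1 -mulr2n -scaler_nat -(rmorph_nat (real_complex R)) nmZR //; lra.
Qed.

(** For [x = s^2 / t] the elements [1 - w] and [s / sqrt t] commute and their squares add up to 1.
    So [1 - w] is contractive, and [t - s^2 = t (1 - w)^2]. This makes squares of self-adjoint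
    elements positive. *)
Lemma sqr_nm_le s t : sa s -> 0 < t -> nm s ^+ 2 <= t ->
  nm (t%:C *: 1 - s * s) <= t.
Proof.
move=> ss t0 st.
have ti0 : 0 <= t^-1 by rewrite invr_ge0 ltW.
pose x : A := t^-1%:C *: (s * s).
have [|w [w1 ww Dw]] := @sqrt_series _ _ x.
  by rewrite nmZR // nm_sqr // mulrC ler_pdivrMr // mul1r.
have sw : sa w.
  apply: (Dw _ closed_sa sa0) => v sv; apply: saZ; apply: saD; last exact: sa_sqr.
  by apply/saZ/sa_sqr.
have cw : w * s = s * w.
  have cs := commutant_real_subalgebra s.
  apply: (Dw _ (rsub_closed cs) (rsub0 cs)) => v sv.
  apply: (rsubZ cs); apply: (rsubD cs); last exact: (rsubM cs).
  by apply: (rsubZ cs); rewrite /commutant /= mulrA.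
have sq : (1 - w) * (1 - w) = 1 - x.
  rewrite mulrBr mulr1 mulrBl mul1r opprB -addrA; congr (1 + _).
  have -> : x = w + w - w * w by rewrite ww addrK.
  by rewrite opprB addrA addrC addrA opprD [LHS]addrC addrA.
have st2 : (Num.sqrt t)^-1 * (Num.sqrt t)^-1 = t^-1.
  by rewrite -invfM -expr2 sqr_sqrtr // ltW.
have s1w : sa (1 - w) by apply: saB => //; exact: sa1.
have n1 : nm (1 - w) <= 1.
  apply: (@unitary_part_nm _ ((Num.sqrt t)^-1%:C *: s)) => //.
  - exact: saZ.
  - by rewrite -scalerAl -scalerAr mulrBl mulrBr cw mul1r mulr1.
  - by rewrite -scalerAl -scalerAr scalerA -rmorphM st2 sq subrK.
have -> : t%:C *: 1 - s * s = t%:C *: ((1 - w) * (1 - w)).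
  by rewrite sq scalerBr scalerA -rmorphM mulfV ?gt_eqF // scale1r.
rewrite nmZR ?(ltW t0) // nm_sqr // ger_pMr //.
by apply: exprn_ile1 => //; exact: nm_ge0.
Qed.

Lemma pos_sqr s : sa s -> pos (s * s).
Proof.
move=> ss; split; first exact: sa_sqr.
exists (nm s ^+ 2 + 1); have := sqr_ge0 (nm s) => h.
by apply: sqr_nm_le => //; lra.
Qed.

(** If [q] is the root of [d], this is the square of the self-adjoint element [q y]. Commutation
    takes the place of the faithful state used in [pos_conj]. *)
Lemma pos_conj_comm d y : pos d -> sa y -> d * y = y * d -> pos (y * d * y).
Proof.
move=> /pos_sqrt[q [[sq _] <- Dq]] sy cy.
have qy : q * y = y * q by apply: (Dq _ (commutant_real_subalgebra y)).
rewrite mulrA -mulrA -qy; apply: pos_sqr; exact: saM.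
Qed.

(** The roots [p] and [q] of [t - x] and [t + x] satisfy [(p q)^2 = t^2 - x^2], so that the squares
    of [x / t] and [p q / t] add up to 1. *)
Lemma pos_bound x t : sa x -> 0 < t -> pos (t%:C *: 1 - x) ->
  pos (t%:C *: 1 + x) -> nm x <= t.
Proof.
move=> sx t0 /pos_sqrt[p [[sp _] pp Dp]] /pos_sqrt[q [[sq _] qq Dq]].
have px : p * x = x * p.
  apply: (Dp _ (commutant_real_subalgebra x)).
  by rewrite /commutant /= mulrBl mulrBr scalar_mull scalar_mulr.
have qx : q * x = x * q.
  apply: (Dq _ (commutant_real_subalgebra x)).
  by rewrite /commutant /= mulrDl mulrDr scalar_mull scalar_mulr.
have qp : q * p = p * q.
  apply: (Dq _ (commutant_real_subalgebra p)).
  by rewrite /commutant /= mulrDl mulrDr scalar_mull scalar_mulr px.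
have ti0 : 0 <= t^-1 by rewrite invr_ge0 ltW.
suff : nm (t^-1%:C *: x) <= 1.
  by rewrite nmZR // mulrC ler_pdivrMr // mul1r.
apply: (@unitary_part_nm _ (t^-1%:C *: (p * q))).
- exact: saZ.
- by apply/saZ/saM.
- by rewrite -!scalerAl -!scalerAr mulrA -px -!mulrA qx.
- have -> : (t^-1%:C *: (p * q)) * (t^-1%:C *: (p * q)) =
            t^-1%:C *: (t^-1%:C *: ((p * p) * (q * q))).
    by rewrite -!scalerAl -!scalerAr !mulrA -(mulrA p q p) qp !mulrA.
  rewrite pp qq -scalerAl -scalerAr -!scalerDr.
  have -> : (t%:C *: 1 - x) * (t%:C *: 1 + x) = t%:C *: (t%:C *: 1) - x * x.
    rewrite mulrBl scalar_mull mulrDr scalar_mulr scalerDr opprD addrA.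
    by rewrite addrK.
  rewrite addrC subrK !scalerA -!rmorphM /=.
  rewrite (_ : t^-1 * t^-1 * (t * t) = 1) ?scale1r //.
  by rewrite mulrACA mulVf ?gt_eqF // mulr1.
Qed.

Lemma pos_antisym x : pos x -> pos (- x) -> x = 0.
Proof.
move=> px pnx; apply: nm_inj => e e0; rewrite subr0.
have pe : pos (e%:C *: 1) by apply: pos_scalar; exact: ltW.
by apply: pos_bound => //; [by case: px|exact: posD|exact: posD].
Qed.

Lemma pos_le_nm x t : pos x -> pos (t%:C *: 1 - x) -> 0 < t -> nm x <= t.
Proof.
move=> px ptx t0; apply: pos_bound => //; first by case: px.
by apply: posD => //; apply: pos_scalar; exact: ltW.
Qed.

(** For [r = p - q] one has [r (p + q) = p^2 - q^2 = 0], so the positive elements [r p r] and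
    [r q r] add up to 0 and both vanish. Their difference is [r^3], and a self-adjoint element with
    a vanishing power is 0. *)
Lemma pos_sqrt_unique p q : pos p -> pos q -> p * q = q * p ->
  p * p = q * q -> p = q.
Proof.
move=> pp pq cpq e; pose r := p - q.
have sr : sa r by apply: saB; [case: pp|case: pq].
have pr : p * r = r * p by rewrite /r mulrBl mulrBr cpq.
have qr : q * r = r * q by rewrite /r mulrBl mulrBr cpq.
have s0 : r * p * r + r * q * r = 0.
  rewrite -mulrDl -mulrDr.
  have -> : r * (p + q) = 0.
    rewrite /r mulrBl !mulrDr e cpq opprD addrACA -[q * q + _ + _]addrA.
    by rewrite addKr subrr.
  by rewrite mul0r.
have r1 := pos_conj_comm pp sr pr; have r2 := pos_conj_comm pq sr qr.
have rp0 : r * p * r = 0.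
  by apply: pos_antisym => //; rewrite (addr0_eq s0).
have rq0 : r * q * r = 0 by move: s0; rewrite rp0 add0r.
have r3 : r * r * r = 0 by rewrite -[RHS](subrr 0) -{1}rp0 -rq0 -mulrBl -mulrBr.
have r4 : r * r = 0.
  by apply: sa_sqr_eq0; [exact: sa_sqr|rewrite mulrA r3 mul0r].
by apply/eqP; rewrite -subr_eq0; apply/eqP; apply: sa_sqr_eq0.
Qed.

Lemma pos_abs c : sa c -> exists d, [/\ pos d, d * d = c * c, d * c = c * d
  & forall D, real_subalgebra D -> D c -> D d].
Proof.
move=> sc; have [d [pd dd Dd]] := pos_sqrt (pos_sqr sc); exists d; split=> //.
  by apply: (Dd _ (commutant_real_subalgebra c)); rewrite /commutant /= mulrA.
by move=> D sD Dc; apply: Dd => //; apply: rsubM.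
Qed.

Lemma pos_cpositive a : pos a -> cpositive a.
Proof. by move=> /pos_sqrt[s [[ss _] <- _]]; exists s; rewrite ss. Qed.

End Positivity.

(** * States *)

Section CauchySchwarz.
Context {R : realType}.
Implicit Types (p r : R) (q c : R[i]).

(** Taking for [c] a real multiple [t] of the conjugate of [q] leaves a real quadratic in [t],
    evaluated at [t = - 1 / r]. The form without vectors serves both states and positive
    semidefinite kernels. *)
Lemma discriminant_le p r q : 0 <= r ->
  (forall c, 0 <= p%:C + c * q + conjc (c * q) + (cmod c ^+ 2 * r)%:C) ->
  cmod q ^+ 2 <= p * r.
Proof.
move=> r0 H.
have real (t : R) : 0 <= p + 2 * t * cmod q ^+ 2 + t ^+ 2 * cmod q ^+ 2 * r.
  have := H (t%:C * conjc q); rewrite cmodM cmodJ cmodR exprMn real_normK ?num_real //.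
  have -> : t%:C * conjc q * q = (t * cmod q ^+ 2)%:C.
    by rewrite -mulrA -cmod_sqr -rmorphM.
  rewrite conjc_real -!rmorphD ler0c => h; apply: le_trans h _.
  by rewrite le_eqVlt; apply/orP; left; apply/eqP; ring.
have Q0 := sqr_ge0 (cmod q); set Q := cmod q ^+ 2 in real Q0 *.
have [r00|rn0] := eqVneq r 0.
  rewrite r00 mulr0 leNgt; apply/negP => Qp.
  (* For [r = 0] the expression is affine in [t], and this [t] gives it the value -1. *)
  have := real (- (p + 1) / (2 * Q)).
  rewrite r00 mulr0 addr0.
  have -> : p + 2 * (- (p + 1) / (2 * Q)) * Q = -1 by field; rewrite gt_eqF.
  lra.
have {}r0 : 0 < r by rewrite lt_neqAle eq_sym rn0 r0.
have := real (- r^-1).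
have -> : p + 2 * - r^-1 * Q + (- r^-1) ^+ 2 * Q * r = (p * r - Q) / r.
  by field.
by rewrite ler_pdivlMr // mul0r subr_ge0.
Qed.

End CauchySchwarz.

Section States.
Context {R : realType} {A : cstarAlgType R} (phi : A -> R[i]).
Context (phi_state : is_state phi).
Implicit Types (a b c d s x y p q : A) (r t e : R).

Lemma stateP : scalar phi. Proof. by case: phi_state. Qed.

Lemma state1 : phi 1 = 1. Proof. by case: phi_state. Qed.

Lemma stateD a b : phi (a + b) = phi a + phi b.
Proof. by have := stateP 1 a b; rewrite scale1r mul1r. Qed.

Lemma state0 : phi 0 = 0.
Proof. by apply: (addrI (phi 0)); rewrite -stateD !addr0. Qed.

Lemma stateZ (c : R[i]) a : phi (c *: a) = c * phi a.
Proof. by have := stateP c a 0; rewrite !addr0 state0 addr0. Qed.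

Lemma stateN a : phi (- a) = - phi a.
Proof. by rewrite -scaleN1r stateZ mulN1r. Qed.

Lemma stateB a b : phi (a - b) = phi a - phi b.
Proof. by rewrite stateD stateN. Qed.

Lemma state_sum (K : Type) (l : seq K) (f : K -> A) :
  phi (\sum_(k <- l) f k) = \sum_(k <- l) phi (f k).
Proof. exact: (big_morph _ stateD state0). Qed.

Lemma state_starM a : 0 <= phi (star a * a).
Proof. by case: phi_state => _ + _; apply; exists a. Qed.

Lemma state_pos a : pos a -> 0 <= phi a.
Proof. by move=> /pos_cpositive; case: phi_state => _ + _; apply. Qed.

(** Adding the scalar [|a|] makes [a] positive, and the value of a state at a positive element is
    real. *)
Lemma state_sa a : sa a -> conjc (phi a) = phi a.
Proof.
move=> sa_a; have p0 := state_pos (pos_nm_add sa_a (lexx _)).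
have -> : phi a = (complex.Re (phi ((nm a)%:C *: 1 + a)) - nm a)%:C.
  rewrite (rmorphB (real_complex R)) /= (ge0_Re p0) stateD stateZ state1 mulr1.
  by rewrite [RHS]addrC addKr.
exact: conjc_real.
Qed.

Lemma state_star a : phi (star a) = conjc (phi a).
Proof.
have e1 : conjc (phi a + phi (star a)) = phi a + phi (star a).
  by rewrite -stateD state_sa // /sa starD starK addrC.
have e2 : conjc ('i%C * (phi a - phi (star a))) = 'i%C * (phi a - phi (star a)).
  rewrite -stateB -stateZ state_sa // /sa star_scale starB starK -opprB scalerN.
  by rewrite -scaleNr; congr (_ *: _); apply/eqP; rewrite eq_complex /= opprK oppr0 !eqxx.
move: e1 e2; case: (phi a) (phi (star a)) => [u v] [w z].
by move=> /= [e1] [e2]; congr (_ +i* _); lra.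
Qed.

Lemma state_CS a b :
  cmod (phi (star a * b)) ^+ 2 <=
  complex.Re (phi (star a * a)) * complex.Re (phi (star b * b)).
Proof.
apply: discriminant_le; first exact/Re_ge0/state_starM.
move=> z; have := state_starM (a + z *: b).
have -> : phi (star (a + z *: b) * (a + z *: b)) = phi (star a * a) +
    z * phi (star a * b) + conjc z * conjc (phi (star a * b)) +
    conjc z * z * phi (star b * b).
  rewrite -state_star star_mul starK starD star_scale mulrDl !mulrDr.
  rewrite -!scalerAl -!scalerAr !stateD !stateZ.
  move: (phi _) (phi _) (phi _) (phi _).
  by move=> *; rewrite addrA.
congr (0 <= _); rewrite ge0_Re ?state_starM // rmorphM; congr (_ + _).
by rewrite -cmod_sqr -{1}(ge0_Re (state_starM b)) -rmorphM.
Qed.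

Lemma state_starM_le a : complex.Re (phi (star a * a)) <= nm a ^+ 2.
Proof.
have := state_pos (pos_nm_sub (sa_starM a) (lexx _)).
by rewrite stateB stateZ state1 mulr1 subr_ge0 nm_starM lecE /= => /andP[].
Qed.

Lemma state_le a : cmod (phi a) <= nm a.
Proof.
have := state_CS 1 a; rewrite star1 !mul1r state1 /= mul1r => h.
have := state_starM_le a => h2.
rewrite -(ler_pXn2r (n := 2)) ?nnegrE ?cmod_ge0 ?nm_ge0 //; lra.
Qed.

(** With [s] the root of [|a|^2 - star a * a], the difference of the sides is the value of [phi] at
    [star (s y) * (s y)]. In GNS terms, [a] acts with norm at most [|a|]. *)
Lemma state_starM_conj_le a y :
  complex.Re (phi (star y * (star a * a) * y)) <=
  nm a ^+ 2 * complex.Re (phi (star y * y)).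
Proof.
have [s [[ss _] e _]] := pos_sqrt (pos_nm_sub (sa_starM a) (lexx _)).
have := state_starM (s * y).
rewrite star_mul mulrA -(mulrA _ _ s) ss e nm_starM mulrBr mulrBl scalar_mulr.
rewrite stateB -scalerAl stateZ subr_ge0 lecE => /andP[_].
by rewrite -{1}(ge0_Re (state_starM y)) -rmorphM.
Qed.

Context (phi_faithful : faithful phi).

Lemma faithful_pos a : pos a -> phi a = 0 -> a = 0.
Proof. by move=> /pos_cpositive; exact: phi_faithful. Qed.

(* With d = |c| and e = d - c one has e c e = - e d e, so that
   phi (e c e) >= 0 forces phi (e d e) = 0, and then e = 0. *)
Lemma pos_of_sa_conj c : sa c -> (forall y, 0 <= phi (star y * c * y)) -> pos c.
Proof.
move=> sc H; have [d [pd dd dc _]] := pos_abs sc.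
pose e := d - c; have se : sa e by apply: saB => //; case: pd.
have de : d * e = e * d by rewrite /e mulrBl mulrBr dc.
have ce : c * e = - (d * e) by rewrite /e !mulrBr dd dc opprB.
have pede := pos_conj_comm pd se de.
have e0 : phi (e * d * e) = 0.
  apply/eqP; rewrite eq_le state_pos // andbT.
  by have := H e; rewrite se -mulrA ce mulrN stateN oppr_ge0 mulrA.
have {}e0 := faithful_pos pede e0.
have [q [pq qq Dq]] := pos_sqrt pd.
have qe : q * e = e * q by apply: (Dq _ (commutant_real_subalgebra e)).
have sq : sa q by case: pq.
have qe0 : q * e = 0.
  by apply: sa_sqr_eq0; [exact: saM|rewrite {1}qe mulrA -(mulrA e) qq].
have de0 : d * e = 0 by rewrite -qq -mulrA qe0 mulr0.
suff /eqP : e = 0 by rewrite /e subr_eq0 => /eqP <-.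
by apply: sa_sqr_eq0 => //; rewrite {1}/e mulrBl ce de0 oppr0 subrr.
Qed.

(** Real values exclude a skew part: [phi (star y * k * y) = 0] for [k = i (c - star c)] and all
    [y], so [k] and [- k] are both positive, [k = 0], and the self-adjoint case applies. *)
Lemma pos_of_conj c : (forall y, 0 <= phi (star y * c * y)) -> pos c.
Proof.
move=> H; apply: pos_of_sa_conj => //.
have Hs y : phi (star y * star c * y) = phi (star y * c * y).
  have -> : star y * star c * y = star (star y * c * y).
    by rewrite !star_mul starK mulrA.
  by rewrite state_star -(ge0_Re (H y)) conjc_real.
pose k := 'i%C *: (c - star c).
have sk : sa k.
  rewrite /sa /k star_scale starB starK -opprB scalerN -scaleNr; congr (_ *: _).
  by apply/eqP; rewrite eq_complex /= opprK oppr0 !eqxx.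
have k0 y : phi (star y * k * y) = 0.
  by rewrite /k -scalerAr -scalerAl stateZ mulrBr mulrBl stateB Hs subrr mulr0.
have : k = 0.
  apply: pos_antisym; apply: pos_of_sa_conj; rewrite ?/sa ?starN ?sk // => y.
    by rewrite k0.
  by rewrite mulrN mulNr stateN k0 oppr0.
move=> /eqP; rewrite scaler_eq0 subr_eq0 => /orP[|/eqP //].
by rewrite eq_complex /= oner_eq0 andbF.
Qed.

Lemma pos_starM b : pos (star b * b).
Proof.
apply: pos_of_conj => y.
by rewrite mulrA -star_mul -mulrA state_starM.
Qed.

Lemma pos_conj p b : pos p -> pos (star b * p * b).
Proof.
move=> /pos_sqrt[s [[ss _] <- _]].
by rewrite -{1}ss mulrA -star_mul -mulrA; exact: pos_starM.
Qed.

Lemma starM_eq0 b : phi (star b * b) = 0 -> b = 0.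
Proof.
move=> h; have /eqP := phi_faithful (ex_intro _ b erefl) h.
by rewrite -nm_eq0 nm_starM sqrf_eq0 nm_eq0 => /eqP.
Qed.

End States.

(** * Simple subalgebras *)

Section SimpleAverage.
Context {R : realType} {A : cstarAlgType R}.
Implicit Types (a b c d h k s w x y p q : A) (r t e : R) (B D J S : set A).

Lemma neumann_series w : nm w < 1 -> exists v, [/\ v * (1 - w) = 1,
  (1 - w) * v = 1 & forall D, real_subalgebra D -> D w -> D v].
Proof.
move=> w1; have w0 := nm_ge0 w.
pose u n : A := iter n (fun v => 1 + w * v) 0.
pose om n := (1 - nm w ^+ n) / (1 - nm w).
have q0 : 0 < 1 - nm w by lra.
have du n : nm (u n.+1 - u n) <= nm w ^+ n.
  elim: n => [|n IH]; first by rewrite /u /= mulr0 addr0 subr0 nm1 expr0.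
  rewrite /u /= -/(u n) opprD addrACA subrr add0r -mulrBr exprS.
  by apply: le_trans (nmM _ _) _; apply: ler_wpM2l.
have [n|n|v uv] := @dominated_limit _ _ u om (1 - nm w)^-1.
- apply: le_trans (du n) _; rewrite /om -mulrBl ler_pdivlMr // exprS; lra.
- rewrite /om ler_pdivrMr // mulVf ?gt_eqF // gerBl; exact: exprn_ge0.
have fv : 1 + w * v = v.
  apply: nm_inj => e e0; have [|N HN] := uv (e / 2); first lra.
  apply: le_trans (nm_tri (u N.+1) _ _) _.
  have h1 := HN N (leqnn _); have h2 := HN N.+1 (leqnSn _).
  have : nm (1 + w * v - u N.+1) <= nm w * nm (u N - v).
    rewrite /u /= -/(u N) opprD addrACA subrr add0r -mulrBr (nm_sub (u N)).
    exact: nmM.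
  have := nm_ge0 (u N - v); nra.
have Dv D : real_subalgebra D -> D w -> D v.
  move=> sD Dw; apply: closed_limit uv; first exact: (rsub_closed sD).
  elim=> [|n IH]; first exact: rsub0.
  by apply: (rsubD sD); [exact: (rsub1 sD)|exact: (rsubM sD)].
have vw : v * w = w * v by apply: (Dv _ (commutant_real_subalgebra w)).
have e1 : v - w * v = 1 by rewrite -{1}fv addrK.
by exists v; split=> //; [rewrite mulrBr mulr1 vw|rewrite mulrBl mul1r].
Qed.

(** The element sought is [s^(-1/2)], obtained as [s^(1/2) s^(-1)]; the inverse exists because
    [s >= 1]. *)
Lemma pos_inv_sqrt s : pos s -> pos (s - 1) -> exists q, [/\ sa q,
  q * s * q = 1 & forall D, real_subalgebra D -> D s -> D q].
Proof.
move=> ps ps1; have [ss _] := ps.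
(* Any [t] above 1 and [|s|] would do: then [0 <= 1 - s / t <= 1 - 1 / t], and the Neumann series
   inverts [s / t]. *)
pose t := nm s + 2; have t1 : 1 < t by have := nm_ge0 s; rewrite /t; lra.
have t0 : 0 < t by lra.
have ti0 : 0 <= t^-1 by rewrite invr_ge0 ltW.
have ti1 : t^-1 < 1 by rewrite invf_lt1.
have tt : t^-1%:C * t%:C = 1 :> R[i].
  by rewrite -(rmorphM (real_complex R)) mulVf ?gt_eqF.
pose w : A := 1 - t^-1%:C *: s.
have w1 : nm w < 1.
  apply: (@le_lt_trans _ _ (1 - t^-1)); last by have : 0 < t^-1; [rewrite invr_gt0|lra].
  apply: pos_le_nm; last by lra.
    have -> : w = t^-1%:C *: (t%:C *: 1 - s) by rewrite scalerBr scalerA tt scale1r.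
    by apply/posZ/pos_nm_sub => //; rewrite /t; lra.
  have -> : (1 - t^-1)%:C *: 1 - w = t^-1%:C *: (s - 1).
    rewrite rmorphB scalerBl scale1r /w opprB addrA addrC addrA addrC.
    by rewrite addKr scalerBr addrC.
  exact: posZ.
have [v' [v1 v2 Dv']] := neumann_series w1.
have sE : 1 - w = t^-1%:C *: s by rewrite /w opprB addrC subrK.
rewrite sE in v1 v2.
pose v : A := t^-1%:C *: v'.
have vs : v * s = 1 by rewrite -scalerAl scalerAr.
have sv : s * v = 1 by rewrite -scalerAr scalerAl.
have sav : sa v.
  have h : star v * s = 1 by rewrite -{1}ss -star_mul sv star1.
  by rewrite /sa -[LHS]mulr1 -sv mulrA h mul1r.
have [q [[sq _] qq Dq]] := pos_sqrt ps.
have qs : q * s = s * q by rewrite -qq mulrA.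
have qv : q * v = v * q.
  by rewrite -[RHS]mulr1 -sv mulrA -(mulrA v) qs mulrA vs mul1r.
exists (q * v); split; first exact: saM.
- by rewrite -(mulrA q v s) vs mulr1 mulrA qq sv.
- move=> D sD Ds; apply: (rsubM sD); first exact: Dq.
  apply: (rsubZ sD); apply: Dv' => //; apply: rsubB => //; first exact: rsub1.
  exact: (rsubZ sD).
Qed.

Lemma closure_lipschitz (f : A -> A) (K : R) S S' a : 0 <= K ->
  (forall a b, nm (f a - f b) <= K * nm (a - b)) ->
  (forall s, S s -> S' (f s)) -> closure S a -> closure S' (f a).
Proof.
move=> K0 lip Sf /closureP Sa; apply/closureP => e e0.
have K1 : 0 < K + 1 by lra.
have [|b Sb ab] := Sa (e / (K + 1)); first exact: divr_gt0.
exists (f b); first exact: Sf.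
apply: le_lt_trans (lip _ _) _; move: ab; rewrite ltr_pdivlMr //.
by have := nm_ge0 (a - b); lra.
Qed.

Lemma closure_add S a b : (forall s s', S s -> S s' -> S (s + s')) ->
  closure S a -> closure S b -> closure S (a + b).
Proof.
move=> SD /closureP Sa /closureP Sb; apply/closureP => e e0.
have e2 : 0 < e / 2 by lra.
have [s Ss as_] := Sa _ e2; have [s' Ss' bs'] := Sb _ e2.
exists (s + s'); first exact: SD.
by rewrite opprD addrACA; apply: le_lt_trans (nmD _ _) _; lra.
Qed.

Definition spanned_ideal B k : set A := [set x | exists l : seq (A * A),
  (forall u, u \in l -> B u.1 /\ B u.2) /\ x = \sum_(u <- l) u.1 * k * u.2].

Lemma closed_spanned_ideal B k : unital_cstar_subalgebra B -> B k ->
  closed_ideal B (closure (spanned_ideal B k)).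
Proof.
move=> sB Bk; have BR := csub_real_subalgebra sB.
split.
- move=> x xJ; apply: (csub_closed sB); move: x xJ; apply: closure_subset.
  move=> _ [l [Bl ->]]; elim: l Bl => [|u l IH] Bl.
    by rewrite big_nil; exact: rsub0.
  rewrite big_cons; have [|B1 B2] := Bl u; first exact: mem_head.
  apply: (csubD sB); last by apply: IH => v vl; apply: Bl; rewrite in_cons vl orbT.
  by apply: (csubM sB) => //; apply: (csubM sB).
- exact: closed_closure.
- by apply: subset_closure; exists [::]; rewrite big_nil.
- move=> a b; apply: closure_add => _ _ [l [Bl ->]] [l' [Bl' ->]].
  exists (l ++ l'); rewrite big_cat; split=> // u.
  by rewrite mem_cat => /orP[/Bl|/Bl'].
- move=> c a; apply: (@closure_lipschitz (fun x => c *: x) (cmod c)).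
  + exact: cmod_ge0.
  + by move=> x y /=; rewrite -scalerBr nmZ.
  + move=> _ [l [Bl ->]]; exists [seq (c *: u.1, u.2) | u <- l]; split.
      move=> _ /mapP[u /Bl[B1 B2] ->] /=; split=> //; exact: (csubZ sB).
    rewrite big_map scaler_sumr; apply: eq_bigr => u _ /=.
    by rewrite !scalerAl.
- move=> d a Bd; apply: (@closure_lipschitz (fun x => d * x) (nm d)).
  + exact: nm_ge0.
  + by move=> x y /=; rewrite -mulrBr nmM.
  + move=> _ [l [Bl ->]]; exists [seq (d * u.1, u.2) | u <- l]; split.
      move=> _ /mapP[u /Bl[B1 B2] ->] /=; split=> //; exact: (csubM sB).
    by rewrite big_map mulr_sumr; apply: eq_bigr => u _ /=; rewrite !mulrA.
- move=> a d aJ Bd; move: aJ.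
  apply: (@closure_lipschitz (fun x => x * d) (nm d)).
  + exact: nm_ge0.
  + by move=> x y /=; rewrite -mulrBl mulrC; apply: le_trans (nmM _ _) _; rewrite mulrC.
  + move=> _ [l [Bl ->]]; exists [seq (u.1, u.2 * d) | u <- l]; split.
      move=> _ /mapP[u /Bl[B1 B2] ->] /=; split=> //; exact: (csubM sB).
    by rewrite big_map mulr_suml; apply: eq_bigr => u _ /=; rewrite !mulrA.
Qed.

Lemma simple_spanned_ideal B k : unital_cstar_subalgebra B -> cstar_simple B ->
  B k -> k <> 0 -> closure (spanned_ideal B k) 1.
Proof.
move=> sB simpleB Bk k0.
have [J0|->] := simpleB _ (closed_spanned_ideal sB Bk); last exact: csub1.
have : closure (spanned_ideal B k) k.
  apply: subset_closure; exists [:: (1, 1)]; rewrite big_seq1 /= mul1r mulr1.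
  by split=> // u; rewrite inE => /eqP -> /=; split; exact: csub1.
by rewrite J0.
Qed.

Context (phi : A -> R[i]) (phi_state : is_state phi).
Context (phi_faithful : faithful phi).

(* The y are multiples of a nonzero element k of the C*-algebra generated by h
   with k h k >= (1 - e) k k, which exists because 1 = |h| is in the spectrum
   of h; by simplicity the ideal generated by k k contains 1. *)
Lemma simple_average B h e : unital_cstar_subalgebra B -> cstar_simple B ->
  B h -> pos h -> nm h = 1 -> 0 < e -> exists ys : seq A,
  [/\ forall y, y \in ys -> B y, \sum_(y <- ys) star y * y = 1
    & nm (1 - \sum_(y <- ys) star y * h * y) <= e].
Proof.
move=> sB simpleB Bh ph h1.
(* For [e >= 1] the list found for 1/2 serves as well. Below, [1 - e] has to be positive. *)
wlog e1 : e / e < 1.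
  move=> W e0; have [|e1] := ltP e 1; first by move=> lt_e1; exact: W.
  have [||ys [Bys ys1 yse]] := W (1 / 2); try lra.
  by exists ys; split=> //; lra.
move=> e0; have BR := csub_real_subalgebra sB.
have [sh _] := ph.
pose c := h - (1 - e)%:C *: 1.
have sc : sa c by apply: saB => //; exact: sa_scalar.
have Bc : B c by apply: rsubB => //; apply: (csubZ sB); exact: csub1.
have [d [pd dd dc Dd]] := pos_abs sc.
(* Twice the positive part of [c]. Were it 0, then [c <= 0], that is [h <= 1 - e], against
   [|h| = 1]. *)
pose k := d + c.
have sk : sa k by apply: saD => //; case: pd.
have Bk : B k by apply: (csubD sB) => //; exact: Dd.
have kck : pos (k * c * k).
  have -> : k * c = k * d by rewrite /k !(mulrDl d c) dc dd [RHS]addrC.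
  by apply: pos_conj_comm => //; rewrite /k (mulrDl d c) (mulrDr d d c) dc.
have kk0 : k * k <> 0.
  move=> /(sa_sqr_eq0 sk) k0.
  have cd : c = - d by apply/eqP; rewrite -addr_eq0 addrC; apply/eqP.
  suff : nm h <= 1 - e by rewrite h1; lra.
  apply: pos_le_nm => //; last lra.
  by rewrite -opprB -/c cd opprK.
have /closureP/(_ (1 / 2))[|m [l [Bl mE]] m1] :=
  simple_spanned_ideal sB simpleB (csubM sB Bk Bk) kk0; first lra.
(* Both [star a] and [b] are listed for each term [a k^2 b] of [m]: expanding the square of
   [k (star a - b)] gives [s >= m + star m], and [|1 - m| < 1/2] turns this into [s >= 1]. *)
pose gs := flatten [seq [:: star u.1; u.2] | u <- l].
have Bgs g : g \in gs -> B g.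
  move=> /flattenP[_ /mapP[u /Bl[B1 B2] ->]].
  by rewrite !inE => /orP[/eqP ->|/eqP -> //]; apply: (csub_star sB).
pose s := \sum_(g <- gs) star (k * g) * (k * g).
have ps : pos s by apply: pos_sum => g; exact: (pos_starM phi_state).
have ps1 : pos (s - 1).
  have -> : s - 1 = \sum_(u <- l) star (k * (star u.1 - u.2)) * (k * (star u.1 - u.2))
                    + (1%:C *: 1 - ((1 - m) + star (1 - m))).
    have -> : s = \sum_(u <- l) (star (k * star u.1) * (k * star u.1) +
                                 star (k * u.2) * (k * u.2)).
      rewrite /s /gs; elim: (l) => [|u l' IH]; first by rewrite !big_nil.
      by rewrite /= !big_cons IH addrA.
    have -> : 1%:C *: 1 - ((1 - m) + star (1 - m)) = m + star m - 1.
      rewrite scale1r starB star1 opprD !opprB addrA [1 + _]addrC subrK.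
      by rewrite addrA.
    rewrite addrA; congr (_ - 1); rewrite mE star_sum -!big_split /=.
    apply: eq_bigr => u _; rewrite mulrBr starB mulrBr !mulrBl.
    have -> : star (k * star u.1) * (k * u.2) = u.1 * (k * k) * u.2.
      by rewrite star_mul starK sk !mulrA.
    have -> : star (k * u.2) * (k * star u.1) = star (u.1 * (k * k) * u.2).
      by rewrite !star_mul sk !mulrA.
    rewrite opprB (addrACA (star (k * star u.1) * _)) -opprD.
    by rewrite [star (u.1 * _ * _) + _]addrC subrK.
  apply: posD; first by apply: pos_sum => u; exact: (pos_starM phi_state).
  apply: pos_nm_sub; first by rewrite /sa starD starK addrC.
  by apply: le_trans (nmD _ _) _; rewrite nm_star; lra.
have [q [sq qsq Dq]] := pos_inv_sqrt ps ps1.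
have Bq : B q.
  apply: Dq => //; rewrite /s big_seq; elim/big_ind: _ => [|x y|g gg].
  - exact: rsub0.
  - exact: (csubD sB).
  - have := csubM sB Bk (Bgs g gg) => Bkg.
    by apply: (csubM sB) => //; exact: (csub_star sB).
(* Right multiplication by [q = s^(-1/2)] normalises the sum of squares from [s] to 1. *)
pose ys := [seq k * g * q | g <- gs].
have ys1 : \sum_(y <- ys) star y * y = 1.
  rewrite big_map -qsq /s mulr_sumr mulr_suml; apply: eq_bigr => g _.
  by rewrite star_mul sq !mulrA.
exists ys; split=> //.
  move=> _ /mapP[g /Bgs Bg ->]; apply: (csubM sB) => //; exact: (csubM sB).
apply: pos_le_nm => //.
  rewrite -ys1 -sumrB; apply: pos_sum => y.
  have -> : star y * y - star y * h * y = star y * (1%:C *: 1 - h) * y.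
    by rewrite mulrBr scale1r mulr1 mulrBl.
  apply: (pos_conj phi_state) => //; apply: pos_nm_sub => //; by rewrite h1.
have -> : e%:C *: 1 - (1 - \sum_(y <- ys) star y * h * y) =
          \sum_(y <- ys) star y * c * y.
  have -> : \sum_(y <- ys) star y * c * y =
      \sum_(y <- ys) star y * h * y - (1 - e)%:C *: \sum_(y <- ys) star y * y.
    rewrite scaler_sumr -sumrB; apply: eq_bigr => y _.
    by rewrite /c mulrBr mulrBl scalar_mulr scalerAl.
  by rewrite ys1 rmorphB scalerBl scale1r !opprB addrC addrAC addrA.
rewrite big_map; apply: pos_sum => g.
have -> : star (k * g * q) * c * (k * g * q) = star (g * q) * (k * c * k) * (g * q).
  by rewrite !star_mul sk !mulrA.
exact: (pos_conj phi_state).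
Qed.

End SimpleAverage.

(** * Positive kernels and the Schur product *)

Section PositiveKernels.
Context {R : realType}.

Definition hermitian_kernel (X : Type) (K : X -> X -> R[i]) :=
  forall a b, K b a = conjc (K a b).

Definition gram (X : Type) (K : X -> X -> R[i]) (l : seq (R[i] * X)) :=
  \sum_(u <- l) \sum_(v <- l) conjc u.1 * v.1 * K u.2 v.2.

Definition psd_kernel (X : Type) (K : X -> X -> R[i]) :=
  forall l, 0 <= gram K l.

(* Diagonalising K over the points of l writes it as a sum of kernels
   d f(a)^* f(b) with d >= 0, and each of these may be absorbed into the
   coefficients. *)
Lemma psd_kernelM (X : Type) (K K' : X -> X -> R[i]) :
  hermitian_kernel K -> psd_kernel K -> psd_kernel K' ->
  psd_kernel (fun a b => K a b * K' a b).
Proof.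
move=> hK pK pK' l; pose n := size l.
pose c (i : 'I_n) := (tnth (in_tuple l) i).1.
pose x (i : 'I_n) := (tnth (in_tuple l) i).2.
have sumE (F : R[i] * X -> R[i] * X -> R[i]) :
    \sum_(u <- l) \sum_(v <- l) F u v =
    \sum_(i < n) \sum_(j < n) F (c i, x i) (c j, x j).
  rewrite big_tnth; apply: eq_bigr => i _; rewrite big_tnth.
  by apply: eq_bigr => j _; rewrite /c /x -!surjective_pairing.
have psdE (L : X -> X -> R[i]) (b : 'I_n -> R[i]) : psd_kernel L ->
    0 <= \sum_(i < n) \sum_(j < n) conjc (b i) * b j * L (x i) (x j).
  move=> /(_ [seq (b i, x i) | i <- index_enum 'I_n]).
  rewrite /gram big_map; congr (0 <= _).
  by apply: eq_bigr => i _; rewrite big_map.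
pose M : 'M[R[i]]_n := \matrix_(i, j) K (x i) (x j).
have hM : M \is hermsymmx.
  apply/is_hermitianmxP; apply/matrixP => i j; rewrite !mxE expr0 mul1r.
  exact: hK.
have /orthomx_spectralP ME := hermitian_normalmx hM.
set P := spectralmx M in ME; set d := spectral_diag M in ME.
have Pu : P \is unitarymx := spectral_unitarymx M.
have invP : invmx P = \matrix_(i, j) conjc (P j i).
  by rewrite invmx_unitary //; apply/matrixP => i j; rewrite !mxE.
have MijE i j : K (x i) (x j) = \sum_(m < n) conjc (P m i) * d 0 m * P m j.
  have := congr1 (fun N : 'M[R[i]]_n => N i j) ME; rewrite /M mxE => ->.
  rewrite mxE; apply: eq_bigr => m _; rewrite mul_mx_diag mxE invP mxE //.
have dE m : d 0 m = \sum_(i < n) \sum_(j < n) conjc (conjc (P m i)) * conjc (P m j) * K (x i) (x j).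
  have : P *m M *m invmx P = diag_mx d.
    by rewrite ME !mulmxA mulmxV ?unitarymx_unit // mul1mx mulmxK ?unitarymx_unit.
  move=> /(congr1 (fun N : 'M[R[i]]_n => N m m)); rewrite [X in _ = X]mxE eqxx mulr1n => <-.
  rewrite invP mxE exchange_big; apply: eq_bigr => j _.
  rewrite mxE mulr_suml; apply: eq_bigr => i _.
  by rewrite !mxE conjcK mulrAC.
have d0 m : 0 <= d 0 m by rewrite dE; apply: psdE.
rewrite /gram sumE /=.
have -> : \sum_(i < n) \sum_(j < n) conjc (c i) * c j * (K (x i) (x j) * K' (x i) (x j)) =
    \sum_(m < n) d 0 m * \sum_(i < n) \sum_(j < n)
      conjc (P m i * c i) * (P m j * c j) * K' (x i) (x j).
  under [RHS]eq_bigr do rewrite mulr_sumr.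
  rewrite [RHS]exchange_big; apply: eq_bigr => i _.
  under [RHS]eq_bigr do rewrite mulr_sumr.
  rewrite [RHS]exchange_big; apply: eq_bigr => j _.
  rewrite MijE mulr_suml mulr_sumr; apply: eq_bigr => m _.
  rewrite rmorphM /=; ring.
by apply: sumr_ge0 => m _; apply: mulr_ge0 => //; exact: psdE.
Qed.

Lemma psd_kernel_prod (X I : Type) (s : seq I) (K : I -> X -> X -> R[i]) :
  (forall i, hermitian_kernel (K i)) -> (forall i, psd_kernel (K i)) ->
  psd_kernel (fun a b => \prod_(i <- s) K i a b).
Proof.
move=> hK pK; elim: s => [|i s IH] l.
  rewrite /gram.
  have -> : \sum_(u <- l) \sum_(v <- l) conjc u.1 * v.1 * (\prod_(i <- [::]) K i u.2 v.2)
      = conjc (\sum_(u <- l) u.1) * \sum_(u <- l) u.1.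
    rewrite rmorph_sum /= mulr_suml; apply: eq_bigr => u _.
    by rewrite mulr_sumr; apply: eq_bigr => v _; rewrite big_nil mulr1.
  by rewrite mulrC mulcJ_ge0.
have := psd_kernelM (hK i) (pK i) IH l; congr (0 <= _).
by apply: eq_bigr => u _; apply: eq_bigr => v _; rewrite big_cons.
Qed.

(** Positivity on [o] with weight 1 followed by [z] times [l] is a quadratic expression in [z], to
    which [discriminant_le] applies. *)
Lemma psd_kernel_CS (X : Type) (K : X -> X -> R[i]) (o : X) (l : seq (R[i] * X)) :
  hermitian_kernel K -> psd_kernel K ->
  cmod (\sum_(u <- l) u.1 * K o u.2) ^+ 2 <=
  complex.Re (K o o) * complex.Re (gram K l).
Proof.
move=> hK pK; apply: discriminant_le; first exact/Re_ge0/pK.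
move=> z; have := pK ((1, o) :: [seq (z * u.1, u.2) | u <- l]).
have o0 : 0 <= K o o.
  by have := pK [:: (1, o)]; rewrite /gram !big_seq1 mulr1 conjc1 mul1r.
congr (0 <= _); rewrite (ge0_Re o0) {1}/gram big_cons big_cons /=.
rewrite oppr0 !mul1r -!addrA; congr (_ + _); rewrite !big_map /=.
congr (_ + _).
  by rewrite mulr_sumr; apply: eq_bigr => u _; rewrite mul1r mulrA.
have -> : (cmod z ^+ 2 * complex.Re (gram K l))%:C = conjc z * z * gram K l.
  by rewrite -cmod_sqr -{2}(ge0_Re (pK l)) -(rmorphM (real_complex R)).
rewrite rmorphM /= rmorph_sum mulr_sumr mulr_sumr -big_split /=.
apply: eq_bigr => u _; rewrite big_cons big_map /= mulr1.
congr (_ + _); first by rewrite !rmorphM /= hK mulrA.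
by rewrite mulr_sumr; apply: eq_bigr => v _; rewrite rmorphM /=; ring.
Qed.

Lemma ge0_limit (w : R[i]) :
  (forall e, 0 < e -> exists2 z, 0 <= z & cmod (w - z) < e) -> 0 <= w.
Proof.
move=> H; rewrite lecE /=; apply/andP; split.
  rewrite -normr_le0; apply/ler_addgt0Pr => e /H[z z0 wz]; rewrite add0r.
  apply: le_trans _ (ltW wz); have := Im_le_cmod (w - z).
  by rewrite raddfB /= (ger0_Im z0) subr0.
apply/ler_addgt0Pr => e /H[z z0 wz].
have := Re_le_cmod (w - z); rewrite raddfB /= => h.
have := Re_ge0 z0; move: (le_lt_trans h wz); rewrite ltr_norml => /andP[]; lra.
Qed.

End PositiveKernels.

Lemma natSinv_small {R : realType} (e : R) : 0 < e ->
  exists N, forall n, (N <= n)%N -> (n.+1%:R : R)^-1 < e.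
Proof.
by move=> e0; have [N _ HN] := near_infty_natSinv_lt (PosNum e0); exists N.
Qed.

Section DenseExtension.
Context {R : realType} {V W : normedModType R[i]} {K : Type}.
Context (e : K -> V) (g : K -> W).

Let E (l : seq (R[i] * K)) := \sum_(u <- l) u.1 *: e u.2.
Let G (l : seq (R[i] * K)) := \sum_(u <- l) u.1 *: g u.2.

(** The value at [v] is characterised by [|f v - G l| <= |v - E l|] for all formal combinations [l];
    the limit of [G] along combinations approaching [v] has this property. Linearity, the bound ([l]
    empty) and the values at [e k] all follow from this inequality, even if the [e k] are linearly
    dependent. *)
Lemma dense_extension : nm_complete W ->
  (forall l : seq (R[i] * K), nm (\sum_(u <- l) u.1 *: g u.2) <=
                              nm (\sum_(u <- l) u.1 *: e u.2)) ->
  (forall v r, 0 < r -> exists l : seq (R[i] * K),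
     nm (v - \sum_(u <- l) u.1 *: e u.2) < r) ->
  exists f : V -> W, [/\ linear f, forall v, nm (f v) <= nm v
    & forall k, f (e k) = g k].
Proof.
move=> cW bnd dense.
pose scal c l : seq (R[i] * K) := [seq (c * u.1, u.2) | u <- l].
have Escal c l : E (scal c l) = c *: E l.
  by rewrite /E big_map scaler_sumr; apply: eq_bigr => u _; rewrite scalerA.
have Gscal c l : G (scal c l) = c *: G l.
  by rewrite /G big_map scaler_sumr; apply: eq_bigr => u _; rewrite scalerA.
have Ecat l l' : E (l ++ l') = E l + E l' by rewrite /E big_cat.
have Gcat l l' : G (l ++ l') = G l + G l' by rewrite /G big_cat.
have bnd2 l l' : nm (G l - G l') <= nm (E l - E l').
  by have := bnd (l ++ scal (-1) l'); rewrite -/(E _) -/(G _) Ecat Gcat Escal Gscal !scaleN1r.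
have ex v : exists w, forall l, nm (w - G l) <= nm (v - E l).
  have inv0 n : 0 < (n.+1%:R : R)^-1 by rewrite invr_gt0.
  pose L n := sval (cid (dense v _ (inv0 n))).
  have HL n : nm (v - E (L n)) < n.+1%:R^-1 by exact: svalP (cid (dense v _ (inv0 n))).
  have small r : 0 < r -> exists N, forall n, (N <= n)%N -> nm (v - E (L n)) < r.
    move=> /natSinv_small[N HN]; exists N => n /HN; exact: lt_trans.
  have [r r0|w Hw] := cW (fun n => G (L n)).
    have [|N HN] := small (r / 2); first lra.
    exists N => m n /HN hm /HN hn; apply: le_lt_trans (bnd2 _ _) _.
    by apply: le_lt_trans (nm_tri v _ _) _; rewrite nm_sub; lra.
  exists w => l; apply/ler_addgt0Pr => r r0.
  have r2 : 0 < r / 2 by lra.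
  have [N HN] := Hw _ r2; have [M HM] := small _ r2.
  have hN := HN (maxn N M) (leq_maxl _ _); have hM := HM (maxn N M) (leq_maxr _ _).
  apply: le_trans (nm_tri (G (L (maxn N M))) _ _) _; rewrite nm_sub.
  have := bnd2 (L (maxn N M)) l; have := nm_tri v (E (L (maxn N M))) (E l).
  by rewrite (nm_sub _ v); lra.
pose f v := sval (cid (ex v)).
have fP v l : nm (f v - G l) <= nm (v - E l) := svalP (cid (ex v)) l.
exists f; split.
- move=> c v v'; apply: nm_inj => r r0.
  pose r' := r / (2 * (cmod c + 2)); have c0 := cmod_ge0 c.
  have r'0 : 0 < r' by apply: divr_gt0 => //; lra.
  have [l Hl] := dense v _ r'0; have [l' Hl'] := dense v' _ r'0.
  have F1 := fP (c *: v + v') (scal c l ++ l'); have F2 := fP v l; have F3 := fP v' l'.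
  have h1 : nm (c *: v + v' - E (scal c l ++ l')) <= cmod c * nm (v - E l) + nm (v' - E l').
    by rewrite Ecat Escal opprD addrACA -scalerBr; apply: le_trans (nmD _ _) _; rewrite nmZ.
  have h2 : nm (G (scal c l ++ l') - (c *: f v + f v')) <= cmod c * nm (f v - G l) + nm (f v' - G l').
    rewrite nm_sub Gcat Gscal opprD addrACA -scalerBr; apply: le_trans (nmD _ _) _.
    by rewrite nmZ.
  apply: le_trans (nm_tri (G (scal c l ++ l')) _ _) _.
  have : r = r' * (2 * (cmod c + 2)) by rewrite /r' divfK // gt_eqF //; lra.
  nra.
- move=> v; have := fP v [::]; by rewrite /G /E !big_nil !subr0.
- move=> k; apply: nm_inj => r r0; have := fP (e k) [:: (1, k)].
  rewrite /G /E !big_seq1 !scale1r subrr nm0 => h; exact: le_trans h (ltW r0).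
Qed.

End DenseExtension.

(** * Elementary tensors *)

Section CommutingProducts.
Context {I : eqType} {Z : pzRingType}.
Implicit Types (f g : I -> Z) (r s : seq I).

Lemma comm_prod x r f : (forall i, i \in r -> x * f i = f i * x) ->
  x * (\prod_(i <- r) f i) = (\prod_(i <- r) f i) * x.
Proof.
elim: r => [|i r IH] H; first by rewrite big_nil mulr1 mul1r.
rewrite big_cons mulrA H ?mem_head // -mulrA IH ?mulrA // => j jr.
by rewrite H // in_cons jr orbT.
Qed.

Lemma comm_prod_rem f r i : (forall i j, i != j -> f i * f j = f j * f i) ->
  i \in r -> \prod_(j <- r) f j = f i * \prod_(j <- rem i r) f j.
Proof.
move=> fC; elim: r => //= j r IH; rewrite in_cons eq_sym.
have [-> _|ji /= ir] := eqVneq j i; first by rewrite big_cons.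
by rewrite !big_cons (IH ir) !mulrA fC.
Qed.

(** Only factors at distinct indices commute, and the two lists may be ordered differently. So the
    head of [r] is pulled out of [s] each time, and what is left of [s] at the end carries only
    units. *)
Lemma comm_prod_widen f r s : (forall i j, i != j -> f i * f j = f j * f i) ->
  uniq r -> uniq s -> {subset r <= s} ->
  (forall i, i \in s -> i \notin r -> f i = 1) ->
  \prod_(i <- r) f i = \prod_(i <- s) f i.
Proof.
move=> fC; elim: r s => [|i r IH] s.
  by move=> _ _ _ H; rewrite big_nil big_seq big1 // => i /H ->.
move=> /= /andP[ir ur] us rs H.
have ins : i \in s by apply: rs; exact: mem_head.
rewrite big_cons (comm_prod_rem fC ins) (IH (rem i s)) ?rem_uniq //.
- move=> j jr; rewrite mem_rem_uniq // inE rs ?in_cons ?jr ?orbT // andbT.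
  by apply: contraNneq ir => <-.
- move=> j; rewrite mem_rem_uniq // inE => /andP[ji js] jr.
  by rewrite H // in_cons negb_or ji.
Qed.

Lemma comm_prod_mul f g r : (forall i j, i != j -> f i * g j = g j * f i) ->
  uniq r ->
  (\prod_(i <- r) f i) * (\prod_(i <- r) g i) = \prod_(i <- r) (f i * g i).
Proof.
move=> fg; elim: r => [|i r IH]; first by rewrite !big_nil mulr1.
move=> /= /andP[ir ur]; rewrite !big_cons -(IH ur) !mulrA; congr (_ * _).
rewrite -!mulrA; congr (_ * _); rewrite comm_prod // => j jr.
by rewrite fg //; apply: contraNneq ir => <-.
Qed.

End CommutingProducts.

Lemma star_comm_prod (R : realType) (A : cstarAlgType R) (I : eqType)
    (f : I -> A) (r : seq I) :
  (forall i j, i != j -> f i * f j = f j * f i) -> uniq r ->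
  star (\prod_(i <- r) f i) = \prod_(i <- r) star (f i).
Proof.
move=> fC; elim: r => [|i r IH]; first by rewrite !big_nil star1.
move=> /= /andP[ir ur]; rewrite !big_cons comm_prod; last first.
  by move=> j jr; apply: fC; apply: contraNneq ir => ->.
by rewrite star_mul IH.
Qed.

Section StateKernels.
Context {R : realType} {A : cstarAlgType R} (phi : A -> R[i]).
Context (phi_state : is_state phi) {X : Type} (f : X -> A).

Lemma state_hermitian_kernel : hermitian_kernel (fun a b => phi (star (f a) * f b)).
Proof. by move=> a b; rewrite -(state_star phi_state) star_mul starK. Qed.

Lemma state_gram (l : seq (R[i] * X)) :
  gram (fun a b => phi (star (f a) * f b)) l =
  phi (star (\sum_(u <- l) u.1 *: f u.2) * (\sum_(u <- l) u.1 *: f u.2)).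
Proof.
rewrite star_sum mulr_suml (state_sum phi_state); apply: eq_bigr => u _.
rewrite mulr_sumr (state_sum phi_state); apply: eq_bigr => v _.
by rewrite star_scaleM (stateZ phi_state).
Qed.

Lemma state_psd_kernel : psd_kernel (fun a b => phi (star (f a) * f b)).
Proof. by move=> l; rewrite state_gram; exact: state_starM. Qed.

End StateKernels.

Section TensorTerms.
Context {R : realType} {I : choiceType} {A : I -> cstarAlgType R}.
Context {T : cstarAlgType R} {iota : forall i, A i -> T}.
Context (T_tensor : is_minimal_tensor_product iota).
Arguments iota : clear implicits.

Local Notation family := (forall i, A i).
Local Notation term := ({fset I} * (forall i, A i))%type.
Implicit Types (a b : family) (u v : term) (F G : {fset I}) (r : seq I).

Lemma iotaM i (x y : A i) : iota i (x * y) = iota i x * iota i y.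
Proof. exact: (smorphM (mtp_morphism T_tensor i)). Qed.

Lemma iota1 i : iota i 1 = 1.
Proof. exact: (smorph1 (mtp_morphism T_tensor i)). Qed.

Lemma iota_star i (x : A i) : iota i (star x) = star (iota i x).
Proof. exact: (smorph_star (mtp_morphism T_tensor i)). Qed.

Lemma iotaD i (x y : A i) : iota i (x + y) = iota i x + iota i y.
Proof.
by have := smorph_linear (mtp_morphism T_tensor i) 1 x y; rewrite !scale1r.
Qed.

Lemma iota0 i : iota i 0 = 0.
Proof. by apply: (addrI (iota i 0)); rewrite -iotaD !addr0. Qed.

Lemma iotaZ i (c : R[i]) (x : A i) : iota i (c *: x) = c *: iota i x.
Proof.
have := smorph_linear (mtp_morphism T_tensor i) c x 0.
by rewrite !addr0 iota0 addr0.
Qed.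

Lemma iotaB i (x y : A i) : iota i (x - y) = iota i x - iota i y.
Proof. by rewrite iotaD -scaleN1r iotaZ scaleN1r. Qed.

Lemma iota_sum i (K : Type) (l : seq K) (f : K -> A i) :
  iota i (\sum_(k <- l) f k) = \sum_(k <- l) iota i (f k).
Proof. exact: (big_morph _ (@iotaD i) (@iota0 i)). Qed.

Lemma iotaC i j (x : A i) (y : A j) : i != j ->
  iota i x * iota j y = iota j y * iota i x.
Proof. by move=> ij; exact: (mtp_commute T_tensor). Qed.

Definition elem r a : T := \prod_(i <- r) iota i (a i).

Lemma elem_comm r a i (x : A i) : i \notin r ->
  iota i x * elem r a = elem r a * iota i x.
Proof.
by move=> ir; apply: comm_prod => j jr; apply: iotaC; apply: contraNneq ir => ->.
Qed.

Lemma elemM r a b : uniq r -> elem r a * elem r b = elem r (fun i => a i * b i).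
Proof.
move=> ur; rewrite comm_prod_mul //; last by move=> i j; apply: iotaC.
by apply: eq_bigr => i _; rewrite iotaM.
Qed.

Lemma star_elem r a : uniq r -> star (elem r a) = elem r (fun i => star (a i)).
Proof.
move=> ur; rewrite star_comm_prod //; last by move=> i j; apply: iotaC.
by apply: eq_bigr => i _; rewrite iota_star.
Qed.

Lemma elem_rem r a i : i \in r -> elem r a = iota i (a i) * elem (rem i r) a.
Proof.
by move=> ir; apply: (comm_prod_rem (f := fun i => iota i (a i))) => // j k; apply: iotaC.
Qed.

Lemma eq_elem r a b : {in r, forall i, a i = b i} -> elem r a = elem r b.
Proof. by move=> ab; apply: eq_big_seq => i /ab ->. Qed.

Definition with_coord a i (x : A i) : family := @dfwith I A a i x.

Lemma with_coord_in a i (x : A i) : with_coord a x i = x.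
Proof. exact: dfwith_in. Qed.

Lemma with_coord_out a i (x : A i) j : i != j -> with_coord a x j = a j.
Proof. exact: dfwith_out. Qed.

Lemma elem_with_coord r a i (x : A i) : uniq r -> i \in r ->
  elem r (with_coord a x) = iota i x * elem (rem i r) a.
Proof.
move=> ur ir; rewrite (elem_rem _ ir) with_coord_in; congr (_ * _).
apply: eq_elem => j; rewrite mem_rem_uniq // inE => /andP[ji _].
by rewrite with_coord_out // eq_sym.
Qed.

(** Coordinates outside the index set of a term are arbitrary. Resetting them to 1 moves terms to a
    common larger index set without changing their values under [tev] or under unital
    functionals. *)
Definition pad u : family := fun i => if i \in u.1 then u.2 i else 1.

Definition tev u : T := elem u.1 u.2.

Lemma tev_pad u G : (u.1 `<=` G)%fset -> tev u = elem G (pad u).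
Proof.
move=> /fsubsetP uG; rewrite /tev (@eq_elem _ _ (pad u)); last first.
  by move=> i iu; rewrite /pad iu.
apply: (comm_prod_widen (f := fun i => iota i (pad u i))) => //.
- by move=> i j; apply: iotaC.
- by move=> i _ iu; rewrite /pad (negbTE iu) iota1.
Qed.

Definition pfun (phi : forall i, A i -> R[i]) u : R[i] :=
  \prod_(i <- u.1) phi i (u.2 i).

Lemma pfun_pad phi u G : (forall i, phi i 1 = 1) -> (u.1 `<=` G)%fset ->
  pfun phi u = \prod_(i <- G) phi i (pad u i).
Proof.
move=> phi1 /fsubsetP uG; rewrite /pfun (@eq_big_seq _ _ _ _ _ _ (fun i => phi i (pad u i))); last first.
  by move=> i iu; rewrite /pad iu.
apply: (comm_prod_widen (f := fun i => phi i (pad u i))) => //.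
- by move=> i j _; rewrite mulrC.
- by move=> i _ iu; rewrite /pad (negbTE iu) phi1.
Qed.

Definition tstar u : term := (u.1, fun i => star (u.2 i)).
Definition tmul u v : term := ((u.1 `|` v.1)%fset, fun i => pad u i * pad v i).

Lemma tev_star u : tev (tstar u) = star (tev u).
Proof. by rewrite /tev star_elem. Qed.

Lemma tevM u v : tev (tmul u v) = tev u * tev v.
Proof.
rewrite (tev_pad (fsubsetUl u.1 v.1)) (tev_pad (fsubsetUr u.1 v.1)) elemM //.
Qed.

Definition lin (l : seq (R[i] * term)) : T := \sum_(x <- l) x.1 *: tev x.2.
Definition plin phi (l : seq (R[i] * term)) : R[i] :=
  \sum_(x <- l) x.1 * pfun phi x.2.

Definition supp (l : seq (R[i] * term)) : {fset I} :=
  foldr (fun x G => x.2.1 `|` G)%fset fset0 l.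

Lemma lin_pad l G : (supp l `<=` G)%fset ->
  lin l = \sum_(x <- l) x.1 *: elem G (pad x.2).
Proof.
elim: l => [|x l IH] /=; first by rewrite /lin !big_nil.
rewrite fsubUset => /andP[xG /IH lG].
by rewrite /lin !big_cons -/(lin l) lG (tev_pad xG).
Qed.

Lemma plin_pad phi l G : (forall i, phi i 1 = 1) -> (supp l `<=` G)%fset ->
  plin phi l = \sum_(x <- l) x.1 * \prod_(i <- G) phi i (pad x.2 i).
Proof.
move=> phi1; elim: l => [|x l IH] /=; first by rewrite /plin !big_nil.
rewrite fsubUset => /andP[xG /IH lG].
by rewrite /plin !big_cons -/(plin phi l) lG (pfun_pad phi1 xG).
Qed.

Definition pkernel (phi : forall i, A i -> R[i]) F a b :=
  \prod_(i <- F) phi i (star (a i) * b i).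

Lemma pkernel_hermitian phi F : (forall i, is_state (phi i)) ->
  hermitian_kernel (pkernel phi F).
Proof.
move=> sphi a b; rewrite /pkernel rmorph_prod; apply: eq_bigr => i _.
exact: (state_hermitian_kernel (sphi i) (fun a => a i)).
Qed.

Lemma pkernel_psd phi F : (forall i, is_state (phi i)) ->
  psd_kernel (pkernel phi F).
Proof.
move=> sphi; apply: psd_kernel_prod => i.
  exact: (state_hermitian_kernel (sphi i) (fun a => a i)).
exact: (state_psd_kernel (sphi i) (fun a => a i)).
Qed.

Lemma tensor_functional_gram phi F (y : formal_tensor A) :
  tensor_functional phi F (ftmul (ftstar y) y) =
  gram (pkernel phi F) [seq (1, a) | a <- y].
Proof.
rewrite /tensor_functional /gram big_allpairs_dep /ftstar !big_map.
apply: eq_bigr => a _; rewrite !big_map; apply: eq_bigr => b _.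
by rewrite /= oppr0 !mul1r.
Qed.

Lemma ftmul1 (x : formal_tensor A) : ftmul x [:: fun i => 1] = x.
Proof.
elim: x => //= a x IH; rewrite /ftmul /=; congr (_ :: _); last exact: IH.
by apply: functional_extensionality_dep => i; rewrite mulr1.
Qed.

Lemma spatial_le (phi : forall i, A i -> R[i]) F (x y : formal_tensor A) :
  (forall i, is_state (phi i)) ->
  tensor_functional phi F (ftmul (ftstar y) y) = 1 ->
  Num.sqrt (complex.Re (tensor_functional phi F
    (ftmul (ftstar (ftmul x y)) (ftmul x y)))) <= nm (tensor_eval iota F x).
Proof.
move=> sphi y1; rewrite -lee_fin (mtp_isometric T_tensor).
by apply: ereal_sup_ubound; exists phi, y.
Qed.

(** The unit vector [y = 1] in the spatial norm yields the root of the functional at [star x * x],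
    which dominates its modulus at [x] by Cauchy-Schwarz for [pkernel]. *)
Lemma tensor_functional_le (phi : forall i, A i -> R[i]) F (x : formal_tensor A) :
  (forall i, is_state (phi i)) ->
  cmod (tensor_functional phi F x) <= nm (tensor_eval iota F x).
Proof.
move=> sphi.
have K11 : pkernel phi F (fun i => 1) (fun i => 1) = 1.
  by rewrite /pkernel big1 // => i _; rewrite star1 mulr1 (state1 (sphi i)).
have h1 : tensor_functional phi F (ftmul (ftstar [:: fun i => 1]) [:: fun i => 1]) = 1.
  by rewrite tensor_functional_gram /gram !big_seq1 K11 conjc1 !mul1r.
have := spatial_le x sphi h1; rewrite ftmul1 tensor_functional_gram.
apply: le_trans.
rewrite -(ger0_norm (cmod_ge0 _)) -sqrtr_sqr ler_sqrt; last exact/Re_ge0/pkernel_psd.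
have := psd_kernel_CS (fun i => 1) [seq (1, a) | a <- x]
  (pkernel_hermitian F sphi) (pkernel_psd F sphi).
rewrite big_map K11 mul1r /=.
have -> // : \sum_(a <- x) 1 * pkernel phi F (fun i => 1) a = tensor_functional phi F x.
apply: eq_bigr => a _; rewrite mul1r; apply: eq_bigr => i _.
by rewrite star1 mul1r.
Qed.

(* Scalars are absorbed into the coordinate i0; this is impossible over the
   empty set of indices. *)
Definition formal i0 (l : seq (R[i] * term)) : formal_tensor A :=
  [seq with_coord (pad x.2) (x.1 *: pad x.2 i0) | x <- l].

Lemma tensor_eval_formal i0 l G : i0 \in G -> (supp l `<=` G)%fset ->
  tensor_eval iota G (formal i0 l) = lin l.
Proof.
move=> iG lG; rewrite (lin_pad lG) /tensor_eval big_map; apply: eq_bigr => x _.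
rewrite -/(elem _ _) elem_with_coord // iotaZ -scalerAl.
by rewrite -elem_rem.
Qed.

Lemma tensor_functional_formal phi i0 l G : (forall i, is_state (phi i)) ->
  i0 \in G -> (supp l `<=` G)%fset ->
  tensor_functional phi G (formal i0 l) = plin phi l.
Proof.
move=> sphi iG lG; rewrite (plin_pad (fun i => state1 (sphi i)) lG).
rewrite /tensor_functional big_map; apply: eq_bigr => x _.
have C (f : I -> R[i]) i j : i != j -> f i * f j = f j * f i by rewrite mulrC.
rewrite !(comm_prod_rem (C _) iG) with_coord_in (stateZ (sphi i0)) mulrA.
congr (_ * _); apply: eq_big_seq => j; rewrite mem_rem_uniq // inE => /andP[ji _].
by rewrite with_coord_out // eq_sym.
Qed.

Lemma plin_le phi l : (forall i, is_state (phi i)) ->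
  cmod (plin phi l) <= nm (lin l).
Proof.
move=> sphi; have [[i0]|noI] := pselect (inhabited I).
  pose G := (i0 |` supp l)%fset.
  have iG : i0 \in G by rewrite !inE eqxx.
  have lG : (supp l `<=` G)%fset by exact: fsubsetUr.
  rewrite -(tensor_functional_formal sphi iG lG) -(tensor_eval_formal iG lG).
  exact: tensor_functional_le.
(* Without indices each term evaluates to 1, and the bound is an equality between scalars. *)
have nil F : F = fset0 by apply/fsetP => i; case: noI; exists.
have -> : lin l = plin phi l *: 1.
  rewrite /lin /plin scaler_suml; apply: eq_bigr => x _.
  by rewrite /tev /pfun (nil x.2.1) /elem !big_nil mulr1.
by rewrite nmZ nm1 mulr1.
Qed.

Definition spanned : set T := range lin.

Lemma spannedD s t : spanned s -> spanned t -> spanned (s + t).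
Proof. by move=> [l _ <-] [l' _ <-]; exists (l ++ l') => //; rewrite /lin big_cat. Qed.

Lemma spannedZ (c : R[i]) s : spanned s -> spanned (c *: s).
Proof.
move=> [l _ <-]; exists [seq (c * x.1, x.2) | x <- l] => //.
by rewrite /lin big_map scaler_sumr; apply: eq_bigr => x _; rewrite scalerA.
Qed.

Lemma spanned_tev u : spanned (tev u).
Proof. by exists [:: (1, u)] => //; rewrite /lin big_seq1 scale1r. Qed.

Lemma spanned_lin (K : Type) (l : seq K) (f : K -> T) :
  (forall k, spanned (f k)) -> spanned (\sum_(k <- l) f k).
Proof.
move=> sf; elim: l => [|k l IH]; last by rewrite big_cons; exact: spannedD.
by exists [::] => //; rewrite /lin !big_nil.
Qed.

Lemma spannedM s t : spanned s -> spanned t -> spanned (s * t).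
Proof.
move=> [l _ <-] [l' _ <-]; rewrite /lin mulr_suml; apply: spanned_lin => x.
rewrite mulr_sumr; apply: spanned_lin => y.
rewrite -scalerAl -scalerAr -tevM; do 2 apply: spannedZ; exact: spanned_tev.
Qed.

Lemma spanned_star s : spanned s -> spanned (star s).
Proof.
move=> [l _ <-]; rewrite /lin star_sum; apply: spanned_lin => x.
rewrite star_scale -tev_star; apply: spannedZ; exact: spanned_tev.
Qed.

Lemma closure_spanned_csub : unital_cstar_subalgebra (closure spanned).
Proof.
split.
- exact: closed_closure.
- apply: subset_closure; have := spanned_tev (fset0, fun i => 1).
  by rewrite /tev /elem big_nil.
- by move=> a b; apply: closure_add => s s'; exact: spannedD.
- move=> c a; apply: (@closure_lipschitz _ _ (fun x => c *: x) (cmod c)).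
  + exact: cmod_ge0.
  + by move=> x y /=; rewrite -scalerBr nmZ.
  + by move=> s; apply: spannedZ.
(* Multiplication is extended to the closure in one factor at a time. *)
- have step s t : spanned s -> closure spanned t -> closure spanned (s * t).
    move=> ss; apply: (@closure_lipschitz _ _ (fun x => s * x) (nm s)).
    + exact: nm_ge0.
    + by move=> x y /=; rewrite -mulrBr nmM.
    + by move=> s'; apply: spannedM.
  move=> a b aS bS; rewrite (proj1 (closure_id _) (@closed_closure _ spanned)).
  move: aS; apply: (@closure_lipschitz _ _ (fun x => x * b) (nm b)).
  + exact: nm_ge0.
  + by move=> x y /=; rewrite -mulrBl [leRHS]mulrC nmM.
  + by move=> s ss; apply: step.
- move=> a; apply: (@closure_lipschitz _ _ (fun x => star x) 1) => //.
  + by move=> x y; rewrite -starB nm_star mul1r.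
  + exact: spanned_star.
Qed.

Lemma spanned_dense t e : 0 < e -> exists l, nm (t - lin l) < e.
Proof.
move=> e0; have : closure spanned t.
  have : (setT : set T) t by [].
  rewrite -(mtp_dense T_tensor) => /(_ (closure spanned)); apply; split.
    exact: closure_spanned_csub.
  move=> _ [i _ [x _ <-]]; apply: subset_closure.
  have := spanned_tev ([fset i]%fset, with_coord (fun i => 1) x).
  by rewrite /tev /elem /= big_seq_fset1 with_coord_in.
by move=> /closureP/(_ e e0)[_ [l _ <-] h]; exists l.
Qed.

End TensorTerms.

Lemma starM_sub_le (R : realType) (A : cstarAlgType R) (a b : A) :
  nm (star a * a - star b * b) <= nm (a - b) * (nm a + nm b).
Proof.
have -> : star a * a - star b * b = star (a - b) * a + star b * (a - b).
  by rewrite starB mulrBl mulrBr addrA subrK.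
apply: le_trans (nmD _ _) _; rewrite [leRHS]mulrDr; apply: lerD.
  by rewrite -(nm_star (a - b)) nmM.
by rewrite mulrC -(nm_star b) nmM.
Qed.

Lemma state_null (R : realType) (A : cstarAlgType R) (phi : A -> R[i]) (a b : A) :
  is_state phi -> phi (star a * a) = 0 -> phi (star a * b) = 0.
Proof.
move=> sphi a0; apply/eqP; rewrite -cmod_eq0 -sqrf_eq0 eq_le sqr_ge0 andbT.
by have := state_CS sphi a b; rewrite a0 /= mul0r.
Qed.

Lemma state_null_sub (R : realType) (A : cstarAlgType R) (phi : A -> R[i]) (a b : A) :
  is_state phi -> phi (star b * b) = 0 ->
  phi (star (a - b) * (a - b)) = phi (star a * a).
Proof.
move=> sphi b0; rewrite starB mulrBr !mulrBl !(stateB sphi) b0.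
have ba := state_null a sphi b0.
have -> : phi (star a * b) = 0.
  by rewrite -[b in LHS]starK -star_mul (state_star sphi) ba conjc0.
by rewrite ba !subr0.
Qed.

(** * Product states *)

Section ProductStates.
Context {R : realType} {I : choiceType} {A : I -> cstarAlgType R}.
Context {T : cstarAlgType R} {iota : forall i, A i -> T}.
Context (T_tensor : is_minimal_tensor_product iota).
Arguments iota : clear implicits.

Local Notation term := ({fset I} * (forall i, A i))%type.
Implicit Types (u v : term) (F G : {fset I}).
Local Notation tev := (@tev R I A T iota).
Local Notation lin := (@lin R I A T iota).

Lemma linear_ext (W : normedModType R[i]) (f g : T -> W) (K : R) :
  linear f -> linear g -> (forall t, nm (f t) <= K * nm t) ->
  (forall t, nm (g t) <= K * nm t) -> (forall u, f (tev u) = g (tev u)) ->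
  forall t, f t = g t.
Proof.
move=> lf lg bf bg fg t.
have D (h : T -> W) : linear h -> {morph h : a b / a + b >-> a + b}.
  by move=> lh a b; have := lh 1 a b; rewrite !scale1r.
have Z (h : T -> W) : linear h -> forall c a, h (c *: a) = c *: h a.
  move=> lh c a; have h0 : h 0 = 0.
    by apply: (addrI (h 0)); rewrite -(D _ lh) !addr0.
  by have := lh c a 0; rewrite h0 !addr0.
have B (h : T -> W) : linear h -> forall a b, h (a - b) = h a - h b.
  by move=> lh a b; rewrite D // -scaleN1r Z // scaleN1r.
have fgl l : f (lin l) = g (lin l).
  elim: l => [|x l IH]; last first.
    by rewrite /lin big_cons !(D f, D g) // !(Z f, Z g) // fg -/(lin l) IH.
  by rewrite /lin big_nil -(scale0r 0) !(Z f, Z g) // !scale0r.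
have K0 : 0 <= K by have := bf 1; rewrite nm1 mulr1; apply: le_trans; exact: nm_ge0.
apply: nm_inj => e e0.
have [|l tl] := spanned_dense T_tensor t (e := e / (2 * K + 1)).
  by apply: divr_gt0 => //; lra.
have -> : f t - g t = f (t - lin l) - g (t - lin l).
  by rewrite !(B f, B g) // fgl opprB addrA subrK.
apply: le_trans (nmB _ _) _; move: tl; rewrite ltr_pdivlMr; last lra.
have := bf (t - lin l); have := bg (t - lin l); have := nm_ge0 (t - lin l).
by lra.
Qed.

Lemma state_linear (phi : T -> R[i]) : is_state phi -> linear (phi : T -> R[i]^o).
Proof. by case. Qed.

Lemma state_bounded (phi : T -> R[i]) : is_state phi ->
  forall t, nm (phi t : R[i]^o) <= 1 * nm t.
Proof. by move=> sphi t; rewrite mul1r; exact: state_le. Qed.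

Lemma tensor_state_tev phi (Phi : T -> R[i]) u :
  is_tensor_state iota phi Phi -> Phi (tev u) = pfun phi u.
Proof. by case=> _; apply. Qed.

Lemma tensor_state_unique phi (Phi Psi : T -> R[i]) :
  is_tensor_state iota phi Phi -> is_tensor_state iota phi Psi -> Phi = Psi.
Proof.
move=> tPhi tPsi; apply/funext.
have [sPhi _] := tPhi; have [sPsi _] := tPsi.
apply: (linear_ext (W := R[i]^o) (state_linear sPhi) (state_linear sPsi)
  (state_bounded sPhi) (state_bounded sPsi)) => u.
by rewrite (tensor_state_tev _ tPhi) (tensor_state_tev _ tPsi).
Qed.

Lemma pad_tmul u v i : pad (tmul u v) i = pad u i * pad v i.
Proof.
rewrite {1}/pad /= inE; case: ifP => // /negbT; rewrite negb_or /pad.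
by case: ifP => //; case: ifP => //; rewrite mulr1.
Qed.

Lemma tensor_state_exists (phi : forall i, A i -> R[i]) :
  (forall i, is_state (phi i)) ->
  exists Phi, is_tensor_state iota phi Phi.
Proof.
move=> sphi; have phi1 i := state1 (sphi i).
have [f [lf bf ftev]] := @dense_extension R T R[i]^o _ tev (pfun phi)
  (@complex_complete R) (fun l => plin_le T_tensor l sphi)
  (fun t e => @spanned_dense _ _ _ _ _ T_tensor t e).
exists f; split; last by move=> F a; exact: (ftev (F, a)).
have fD a b : f (a + b) = f a + f b by have := lf 1 a b; rewrite !scale1r.
have f0 : f 0 = 0 by apply: (addrI (f 0)); rewrite -fD !addr0.
have fZ c a : f (c *: a) = c * f a by have := lf c a 0; rewrite !addr0 f0 addr0.
have fB a b : f (a - b) = f a - f b by rewrite fD -scaleN1r fZ mulN1r.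
have fsum (K : Type) (l : seq K) (h : K -> T) :
    f (\sum_(k <- l) h k) = \sum_(k <- l) f (h k).
  exact: (big_morph _ fD f0).
split; first exact: lf.
  move=> _ [b ->].
  have pos_lin l : 0 <= f (star (lin l) * lin l).
    have := pkernel_psd (supp l) sphi [seq (x.1, pad x.2) | x <- l].
    congr (0 <= _); rewrite (lin_pad T_tensor (fsubset_refl _)).
    rewrite star_sum mulr_suml fsum /gram big_map; apply: eq_bigr => x _.
    rewrite mulr_sumr fsum big_map; apply: eq_bigr => y _ /=.
    rewrite star_scaleM fZ; congr (_ * _).
    rewrite (star_elem T_tensor) // (elemM T_tensor) //.
    by rewrite (ftev (supp l, fun i => star (pad x.2 i) * pad y.2 i)).
  apply: ge0_limit => e e0; have nb := nm_ge0 b.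
  (* Then [d < 1], so [|b - lin l| (|b| + |lin l|)] is at most [d (2 |b| + 1) < e]. *)
  pose d := e / (2 * nm b + 1 + e).
  have p : 0 < 2 * nm b + 1 + e by lra.
  have d0 : 0 < d by exact: divr_gt0.
  have ed : d * (2 * nm b + 1 + e) = e by rewrite /d divfK // gt_eqF.
  have [l bl] := spanned_dense T_tensor b d0.
  exists (f (star (lin l) * lin l)) => //.
  rewrite -fB; apply: le_lt_trans (bf _) _.
  apply: le_lt_trans (starM_sub_le _ _) _.
  have := nm_le_add (lin l) b; rewrite nm_sub; have := nm_ge0 (lin l).
  have := nm_ge0 (b - lin l); nra.
have := ftev (fset0, fun i => 1); rewrite /tev /elem /pfun !big_nil.
by [].
Qed.

Definition sing j (x : A j) : term := ([fset j]%fset, with_coord (fun i => 1) x).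

Lemma tev_sing j (x : A j) : tev (sing x) = iota j x.
Proof. by rewrite /tev /elem /= big_seq_fset1 with_coord_in. Qed.

Lemma pad_sing_in j (x : A j) : pad (sing x) j = x.
Proof. by rewrite /pad /= inE eqxx with_coord_in. Qed.

Lemma pad_sing_out j (x : A j) i : i != j -> pad (sing x) i = 1.
Proof. by move=> ij; rewrite /pad inE (negbTE ij). Qed.

Definition pfun_except (phi : forall i, A i -> R[i]) j u :=
  \prod_(i <- rem j u.1) phi i (u.2 i).

Lemma pfun_split phi j u : (forall i, phi i 1 = 1) ->
  pfun phi u = phi j (pad u j) * pfun_except phi j u.
Proof.
move=> phi1; rewrite /pfun /pfun_except /pad; case: ifP => ju.
  by apply: (comm_prod_rem (f := fun i => phi i (u.2 i))) => // i k _; rewrite mulrC.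
by rewrite phi1 mul1r rem_id // ju.
Qed.

Lemma pfun_sandwich phi j (x y : A j) u : (forall i, phi i 1 = 1) ->
  pfun phi (tmul (tmul (sing x) u) (sing y)) =
  phi j (x * pad u j * y) * pfun_except phi j u.
Proof.
move=> phi1; set v := tmul _ _; rewrite (pfun_split j v phi1).
rewrite /v !pad_tmul !pad_sing_in; congr (_ * _).
rewrite /pfun_except.
have -> : \prod_(i <- rem j u.1) phi i (u.2 i) = \prod_(i <- rem j u.1) phi i (pad u i).
  by apply: eq_big_seq => i /mem_rem iu; rewrite /pad iu.
have -> : \prod_(i <- rem j v.1) phi i (v.2 i) = \prod_(i <- rem j v.1) phi i (pad u i).
  apply: eq_big_seq => i; rewrite mem_rem_uniq // inE => /andP[ij _].
  by rewrite /v /= pad_tmul !pad_sing_out // mul1r mulr1.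
apply/esym; apply: (comm_prod_widen (f := fun i => phi i (pad u i))).
- by move=> i k _; rewrite mulrC.
- exact: rem_uniq.
- exact: rem_uniq.
- move=> i; rewrite !mem_rem_uniq // !inE => /andP[ij iu].
  by rewrite ij iu orbT.
- move=> i; rewrite !mem_rem_uniq // !inE => /andP[ij _].
  by rewrite negb_and ij /= /pad => /negbTE ->.
Qed.

Lemma tensor_state_sandwich phi (Phi : T -> R[i]) j (x y : A j) u :
  (forall i, is_state (phi i)) -> is_tensor_state iota phi Phi ->
  Phi (iota j x * tev u * iota j y) = phi j (x * pad u j * y) * pfun_except phi j u.
Proof.
move=> sphi tPhi; rewrite -!tev_sing -!(tevM T_tensor) (tensor_state_tev _ tPhi).
by rewrite pfun_sandwich // => i; exact: state1.
Qed.

Lemma tensor_state_iota phi (Phi : T -> R[i]) j (x : A j) :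
  is_tensor_state iota phi Phi -> Phi (iota j x) = phi j x.
Proof.
move=> tPhi; rewrite -tev_sing (tensor_state_tev _ tPhi).
by rewrite /pfun /= big_seq_fset1 with_coord_in.
Qed.

End ProductStates.

(** * Faithfulness of product states *)

Section Faithfulness.
Context {R : realType} {I : choiceType} {A : I -> cstarAlgType R}.
Context {T : cstarAlgType R} {iota : forall i, A i -> T}.
Context (T_tensor : is_minimal_tensor_product iota).
Arguments iota : clear implicits.

Local Notation term := ({fset I} * (forall i, A i))%type.
Local Notation functionals := (forall i, A i -> R[i]).
Implicit Types (u v : term) (F G : {fset I}) (phi psi : functionals).
Local Notation tev := (@tev R I A T iota).
Local Notation lin := (@lin R I A T iota).
Local Notation elem := (@elem R I A T iota).

Definition with_state phi j (chi : A j -> R[i]) : functionals :=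
  @dfwith I (fun i => A i -> R[i]) phi j chi.
Arguments with_state phi [j] chi i _.

Lemma with_state_in phi j chi : @with_state phi j chi j = chi.
Proof. exact: dfwith_in. Qed.

Lemma with_state_out phi j (chi : A j -> R[i]) i : j != i ->
  with_state phi chi i = phi i.
Proof. exact: dfwith_out. Qed.

Lemma with_state_is_state phi j (chi : A j -> R[i]) :
  (forall i, is_state (phi i)) -> is_state chi ->
  forall i, is_state (with_state phi chi i).
Proof. by move=> sphi schi i; rewrite /with_state; case: dfwithP. Qed.

Lemma pfun_except_with_state phi j (chi : A j -> R[i]) u :
  pfun_except (with_state phi chi) j u = pfun_except phi j u.
Proof.
apply: eq_big_seq => i; rewrite mem_rem_uniq // inE => /andP[ij _].
by rewrite with_state_out // eq_sym.
Qed.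

(** The slice map on elementary tensors: [phi i] is applied in each coordinate other than [j], and
    coordinate [j] is kept. *)
Definition slice phi j u : A j := pfun_except phi j u *: pad u j.

(* If a is the image of x then psi (y^* a^* a y) = Phi ((a y)^* x y) for
   psi = phi j, and Cauchy-Schwarz bounds its square by
   psi (y^* a^* a y) |x|^2 psi (y^* y); faithfulness of psi turns this into
   a^* a <= |x|^2. *)
Lemma slice_le phi Phi j l : (forall i, is_state (phi i)) -> faithful (phi j) ->
  is_tensor_state iota phi Phi ->
  nm (\sum_(x <- l) x.1 *: slice phi j x.2) <= nm (lin l).
Proof.
move=> sphi fj tPhi; have [sPhi _] := tPhi; have sj := sphi j.
set a := \sum_(x <- l) _; set x := lin l.
have key y w : phi j (y * a * w) = Phi (iota j y * x * iota j w).
  rewrite /a /x /lin !mulr_sumr !mulr_suml (state_sum sj) (state_sum sPhi).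
  apply: eq_bigr => z _; rewrite -!scalerAr -!scalerAl (stateZ sj) (stateZ sPhi).
  by rewrite (tensor_state_sandwich T_tensor _ _ _ sphi tPhi) (stateZ sj) [pfun_except _ _ _ * _]mulrC.
have bound y : complex.Re (phi j (star y * (star a * a) * y)) <=
    nm x ^+ 2 * complex.Re (phi j (star y * y)).
  have -> : star y * (star a * a) * y = star (a * y) * a * y.
    by rewrite star_mul !mulrA.
  set p := complex.Re _; set q := complex.Re _.
  have pE : star (a * y) * a * y = star (a * y) * (a * y) by rewrite mulrA.
  have p0 : 0 <= p by rewrite /p pE; exact/Re_ge0/state_starM.
  have q0 : 0 <= q by exact/Re_ge0/state_starM.
  have : p ^+ 2 <= p * (nm x ^+ 2 * q).
    have := state_CS sPhi (iota j (a * y)) (x * iota j y).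
    have -> : cmod (Phi (star (iota j (a * y)) * (x * iota j y))) = p.
      by rewrite -(iota_star T_tensor) mulrA -key ge0_cmod // pE; exact: state_starM.
    have -> : complex.Re (Phi (star (iota j (a * y)) * iota j (a * y))) = p.
      by rewrite -(iota_star T_tensor) -(iotaM T_tensor) (tensor_state_iota _ tPhi) /p pE.
    move=> /le_trans; apply; apply: ler_wpM2l => //.
    have -> : star (x * iota j y) * (x * iota j y) =
              star (iota j y) * (star x * x) * iota j y by rewrite star_mul !mulrA.
    apply: le_trans (state_starM_conj_le sPhi _ _) _.
    by rewrite -(iota_star T_tensor) -(iotaM T_tensor) (tensor_state_iota _ tPhi).
  have [->|pn0] := eqVneq p 0; first by move=> _; apply: mulr_ge0 => //; exact: sqr_ge0.
  by rewrite expr2 ler_pM2l // lt_neqAle eq_sym pn0.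
have pos1 : pos ((nm x ^+ 2)%:C *: 1 - star a * a).
  apply: (pos_of_conj sj fj) => y.
  rewrite mulrBr mulrBl scalar_mulr -scalerAl (stateB sj) (stateZ sj) subr_ge0.
  have e1 : star y * (star a * a) * y = star (a * y) * (a * y).
    by rewrite star_mul !mulrA.
  rewrite -(ge0_Re (state_starM sj y)) -(rmorphM (real_complex R)).
  by rewrite -[leLHS]ge0_Re ?lecR ?bound // e1; exact: state_starM.
rewrite -(ler_pXn2r (n := 2)) ?nnegrE ?nm_ge0 // -nm_starM.
apply/ler_addgt0Pr => e e0; apply: pos_le_nm.
- exact: (pos_starM sj fj).
- rewrite [nm x ^+ 2 + e]addrC rmorphD scalerDl -addrA; apply: posD => //.
  by apply: pos_scalar; exact: ltW.
- by have := sqr_ge0 (nm x); lra.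
Qed.

(** The first property carries positivity from [T] to [A j] by way of [pos_of_conj]. The second
    turns a replacement of the state at [j] into composition of [E] with the new state. *)
Lemma slice_map phi Phi j : (forall i, is_state (phi i)) -> faithful (phi j) ->
  is_tensor_state iota phi Phi ->
  exists E : T -> A j,
    (forall t (y : A j), Phi (star (iota j y) * t * iota j y) = phi j (star y * E t * y)) /\
    (forall chi Psi, is_state chi -> is_tensor_state iota (with_state phi chi) Psi ->
       forall t, Psi t = chi (E t)).
Proof.
move=> sphi fj tPhi; have [sPhi _] := tPhi; have sj := sphi j.
have [E [lE bE Etev]] := @dense_extension R T (A j) _ tev (slice phi j)
  (@completeNormedMod_complete R (A j))
  (fun l => slice_le l sphi fj tPhi)
  (fun t e => @spanned_dense _ _ _ _ _ T_tensor t e).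
have EZ c t : E (c *: t) = c *: E t.
  have E0 : E 0 = 0.
    apply: (addrI (E 0)); have := lE 1 0 0.
    by rewrite !scale1r !addr0.
  by have := lE c t 0; rewrite E0 !addr0.
have ED s t : E (s + t) = E s + E t by have := lE 1 s t; rewrite !scale1r.
exists E; split.
  move=> t y; move: t.
  pose K := nm (iota j y) ^+ 2 + nm y ^+ 2.
  apply: (linear_ext T_tensor (W := R[i]^o) (K := K)).
  - move=> c s t /=; rewrite mulrDr mulrDl -scalerAr -scalerAl (stateD sPhi).
    by rewrite (stateZ sPhi).
  - move=> c s t /=; rewrite ED EZ mulrDr mulrDl -scalerAr -scalerAl (stateD sj).
    by rewrite (stateZ sj).
  - move=> t; apply: le_trans (state_le sPhi _) _.
    apply: le_trans (nmM _ _) _; have := nmM (star (iota j y)) t.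
    rewrite nm_star /K; have := nm_ge0 t; have := nm_ge0 (iota j y).
    have := sqr_ge0 (nm y); nra.
  - move=> t; apply: le_trans (state_le sj _) _.
    apply: le_trans (nmM _ _) _; have := nmM (star y) (E t).
    rewrite nm_star /K; have := nm_ge0 t; have := nm_ge0 y; have := bE t.
    have := sqr_ge0 (nm (iota j y)); have := nm_ge0 (E t); nra.
  - move=> u; rewrite -(iota_star T_tensor) (tensor_state_sandwich T_tensor _ _ _ sphi tPhi).
    by rewrite Etev /slice -scalerAr -scalerAl (stateZ sj) mulrC.
move=> chi Psi schi tPsi; have [sPsi _] := tPsi.
apply: (linear_ext T_tensor (W := R[i]^o) (K := 1)).
- exact: state_linear.
- by move=> c s t /=; rewrite ED EZ (stateD schi) (stateZ schi).
- exact: state_bounded.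
- by move=> t; rewrite mul1r; apply: le_trans (state_le schi _) (bE _).
- move=> u; rewrite (tensor_state_tev _ tPsi) Etev (stateZ schi) mulrC.
  rewrite (@pfun_split _ _ _ _ j) ?with_state_in ?pfun_except_with_state //.
  by move=> i; apply: state1; exact: with_state_is_state.
Qed.

(** [E (star z * z)] is positive and [phi j] vanishes there, so it is 0 by faithfulness of [phi j];
    hence every [chi] vanishes there. *)
Lemma tensor_state_replace phi Phi j chi Psi z : (forall i, is_state (phi i)) ->
  faithful (phi j) -> is_tensor_state iota phi Phi -> is_state chi ->
  is_tensor_state iota (with_state (j := j) phi chi) Psi ->
  Phi (star z * z) = 0 -> Psi (star z * z) = 0.
Proof.
move=> sphi fj tPhi schi tPsi z0; have [sPhi _] := tPhi; have sj := sphi j.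
have [E [EPhi EPsi]] := slice_map sphi fj tPhi.
have pE : pos (E (star z * z)).
  apply: (pos_of_conj sj fj) => y; rewrite -EPhi mulrA -star_mul -mulrA.
  exact: state_starM.
rewrite (EPsi chi) // (faithful_pos fj pE) ?(state0 schi) //.
have := EPhi (star z * z) 1.
by rewrite (iota1 T_tensor) star1 !mulr1 star1 !mul1r z0 => <-.
Qed.

Context (psi : functionals).
Arguments psi : clear implicits.
Context (psi_state : forall i, is_state (psi i)).

Definition finitely_modified phi :=
  (forall i, is_state (phi i)) /\ exists r : seq I, forall i, i \notin r -> phi i = psi i.

(** The elements that annihilate the cyclic vector of each finitely modified product state.
    Quantifying over all modifications is what makes the set stable under right multiplication by
    elementary tensors. *)
Definition null z := forall phi Phi, finitely_modified phi ->
  is_tensor_state iota phi Phi -> Phi (star z * z) = 0.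

Lemma finitely_modified_with_state phi j (chi : A j -> R[i]) :
  finitely_modified phi -> is_state chi -> finitely_modified (with_state phi chi).
Proof.
move=> [sphi [r rphi]] schi; split; first exact: with_state_is_state.
exists (j :: r) => i; rewrite in_cons negb_or eq_sym => /andP[ij ir].
by rewrite with_state_out // rphi.
Qed.

(** Induction on the modified indices: [phi'] restores [psi j], the induction hypothesis covers it,
    and then the faithful [psi j] is exchanged for [phi j]. Other factors of [phi'] may fail to be
    faithful, so the exchange may rely on faithfulness at [j] alone. *)
Lemma null_of_faithful Psi z : (forall i, faithful (psi i)) ->
  is_tensor_state iota psi Psi -> Psi (star z * z) = 0 -> null z.
Proof.
move=> fpsi tPsi z0 phi Phi [sphi [r]].
elim: r phi Phi sphi => [|j r IH] phi Phi sphi rphi tPhi.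
  have e : phi = psi by apply: functional_extensionality_dep => i; apply: rphi.
  by rewrite e in tPhi; rewrite (tensor_state_unique T_tensor tPhi tPsi).
pose phi' := with_state phi (psi j).
have sphi' : forall i, is_state (phi' i) by exact: with_state_is_state.
have [Phi' tPhi'] := tensor_state_exists T_tensor sphi'.
have z0' : Phi' (star z * z) = 0.
  apply: IH tPhi' => // i ir; rewrite /phi'.
  have [<-|ji] := eqVneq j i; first exact: with_state_in.
  by rewrite with_state_out // rphi // in_cons negb_or eq_sym ji.
apply: (tensor_state_replace sphi' _ tPhi' (sphi j) _ z0').
  by rewrite /phi' with_state_in.
suff -> : with_state phi' (phi j) = phi by [].
apply: functional_extensionality_dep => i.
have [<-|ji] := eqVneq j i; first exact: with_state_in.
by rewrite with_state_out // /phi' with_state_out.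
Qed.

Lemma nullD z w : null z -> null w -> null (z + w).
Proof.
move=> nz nw phi Phi mphi tPhi; have [sPhi _] := tPhi.
have z0 := nz _ _ mphi tPhi; have w0 := nw _ _ mphi tPhi.
rewrite starD mulrDl !mulrDr !(stateD sPhi) z0 w0.
by rewrite (state_null w sPhi z0) (state_null z sPhi w0) !addr0.
Qed.

Lemma null0 : null 0.
Proof. by move=> phi Phi _ [sPhi _]; rewrite mulr0 (state0 sPhi). Qed.

(* t |-> Phi ((iota j b)^* t (iota j b)) is a multiple of the product state
   of the family obtained from phi by replacing phi j. *)
Lemma null_mul_iota z j (b : A j) : null z -> null (z * iota j b).
Proof.
move=> nz phi Phi mphi tPhi; have [sPhi _] := tPhi; have [sphi _] := mphi.
have sj := sphi j.
have -> : star (z * iota j b) * (z * iota j b) =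
          star (iota j b) * (star z * z) * iota j b by rewrite star_mul !mulrA.
(* With weight 0 there is no state to normalise; Cauchy-Schwarz gives the value 0 directly. *)
have [q0|qn0] := eqVneq (phi j (star b * b)) 0.
  rewrite -mulrA; apply: state_null => //.
  by rewrite -(iota_star T_tensor) -(iotaM T_tensor) (tensor_state_iota _ tPhi).
set q := phi j (star b * b) in qn0.
have q0 : 0 <= q := state_starM sj b.
pose chi (x : A j) := q^-1 * phi j (star b * x * b).
have schi : is_state chi.
  split.
  - move=> c x y; rewrite /chi mulrDr mulrDl -scalerAr -scalerAl (stateD sj).
    by rewrite (stateZ sj) mulrDr mulrCA.
  - move=> _ [y ->]; rewrite /chi; apply: mulr_ge0; first by rewrite invr_ge0.
    by rewrite mulrA -star_mul -mulrA; exact: state_starM.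
  - by rewrite /chi mulr1 mulVf.
have mphi' := finitely_modified_with_state mphi schi.
have [Phi' tPhi'] := tensor_state_exists T_tensor mphi'.1.
have [sPhi' _] := tPhi'.
suff -> : Phi (star (iota j b) * (star z * z) * iota j b) = q * Phi' (star z * z).
  by rewrite (nz _ _ mphi' tPhi') mulr0.
move: (star z * z).
apply: (linear_ext T_tensor (W := R[i]^o) (K := nm (iota j b) ^+ 2 + cmod q)).
- move=> c s t /=; rewrite mulrDr mulrDl -scalerAr -scalerAl (stateD sPhi).
  by rewrite (stateZ sPhi).
- move=> c s t /=; rewrite (stateD sPhi') (stateZ sPhi') mulrDr; congr (_ + _).
  exact: mulrCA.
- move=> t; apply: le_trans (state_le sPhi _) _.
  apply: le_trans (nmM _ _) _; have := nmM (star (iota j b)) t.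
  rewrite nm_star; have := nm_ge0 t; have := nm_ge0 (iota j b).
  have := cmod_ge0 q; nra.
- move=> t; rewrite /nm -/(cmod _) cmodM; have := state_le sPhi' t.
  have := cmod_ge0 q; have := sqr_ge0 (nm (iota j b)); have := nm_ge0 t.
  have := cmod_ge0 (Phi' t); nra.
- move=> u; rewrite -(iota_star T_tensor) (tensor_state_sandwich T_tensor _ _ _ sphi tPhi).
  rewrite (tensor_state_tev _ tPhi') (@pfun_split _ _ _ _ j); last first.
    by move=> i; apply: state1; exact: mphi'.1.
  by rewrite with_state_in pfun_except_with_state /chi !mulrA mulfV // mul1r.
Qed.

Lemma null_mul_elem z r a : null z -> null (z * elem r a).
Proof.
elim: r z => [|j r IH] z nz; first by rewrite /elem big_nil mulr1.
by rewrite /elem big_cons mulrA; apply: IH; exact: null_mul_iota.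
Qed.

Lemma null_mul_eval z F y : null z -> null (z * tensor_eval iota F y).
Proof.
move=> nz; rewrite /tensor_eval mulr_sumr.
elim: y => [|a y IH]; first by rewrite big_nil; exact: null0.
by rewrite big_cons; apply: nullD => //; exact: null_mul_elem.
Qed.

Lemma tensor_evalM F x y :
  tensor_eval iota F (ftmul x y) = tensor_eval iota F x * tensor_eval iota F y.
Proof.
rewrite /tensor_eval big_allpairs_dep mulr_suml; apply: eq_bigr => a _.
rewrite mulr_sumr; apply: eq_bigr => b _.
by rewrite -/(elem F a) -/(elem F b) (elemM T_tensor).
Qed.

Lemma tensor_eval_star F x :
  tensor_eval iota F (ftstar x) = star (tensor_eval iota F x).
Proof.
rewrite /tensor_eval big_map star_sum; apply: eq_bigr => a _.
by rewrite -/(elem F a) (star_elem T_tensor).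
Qed.

Lemma tensor_functional_eval phi Phi F x : is_tensor_state iota phi Phi ->
  tensor_functional phi F x = Phi (tensor_eval iota F x).
Proof.
move=> tPhi; have [sPhi _] := tPhi; rewrite (state_sum sPhi).
by apply: eq_bigr => a _; rewrite (tensor_state_tev (F, a) tPhi).
Qed.

(** For states [phi] and a unit vector [y] tested by the spatial norm, replacing [phi] by [psi]
    outside [F] changes nothing over [F]. Then [z y] is a null vector, whence
    [|x y| = |(x - z) y| <= |x - z|] in the GNS seminorm. *)
Lemma null_approx z F x : null z ->
  nm (tensor_eval iota F x) <= nm (tensor_eval iota F x - z).
Proof.
move=> nz; rewrite -lee_fin (mtp_isometric T_tensor).
apply: ge_ereal_sup => _ [phi [y [sphi y1 ->]]]; rewrite lee_fin.
pose phi' : functionals := fun i => if i \in F then phi i else psi i.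
have mphi' : finitely_modified phi'.
  split; first by move=> i; rewrite /phi'; case: ifP.
  by exists F => i; rewrite /phi' => /negbTE ->.
have [Phi tPhi] := tensor_state_exists T_tensor mphi'.1; have [sPhi _] := tPhi.
have E w : tensor_functional phi F w = Phi (tensor_eval iota F w).
  rewrite -(tensor_functional_eval _ _ tPhi); apply: eq_bigr => a _.
  by apply: eq_big_seq => i iF; rewrite /phi' iF.
move: y1; rewrite !E !tensor_evalM !tensor_eval_star !tensor_evalM.
set X := tensor_eval iota F x; set Y := tensor_eval iota F y => y1.
have zY : Phi (star (z * Y) * (z * Y)) = 0 by exact: (null_mul_eval F y nz mphi' tPhi).
rewrite -(state_null_sub _ sPhi zY) -mulrBl.
have -> : star ((X - z) * Y) * ((X - z) * Y) = star Y * (star (X - z) * (X - z)) * Y.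
  by rewrite star_mul !mulrA.
rewrite -(ger0_norm (nm_ge0 (X - z))) -sqrtr_sqr ler_sqrt ?sqr_ge0 //.
by apply: le_trans (state_starM_conj_le sPhi _ _) _; rewrite y1 /= mulr1.
Qed.

Lemma null_eq0 Psi z : is_tensor_state iota psi Psi -> null z -> z = 0.
Proof.
move=> tPsi nz; have [sPsi _] := tPsi.
apply: nm_inj => e e0; rewrite subr0.
have [|l zl] := spanned_dense T_tensor z (e := e / 2); first lra.
suff : nm (lin l) <= nm (lin l - z).
  have := nm_le_add z (lin l); rewrite (nm_sub (lin l)); lra.
have [[i0]|noI] := pselect (inhabited I).
  pose G := (i0 |` supp l)%fset.
  have iG : i0 \in G by rewrite !inE eqxx.
  have lG : (supp l `<=` G)%fset by exact: fsubsetUr.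
  by rewrite -(tensor_eval_formal T_tensor iG lG); exact: null_approx.
(* Without indices the approximant is a scalar [c], and [|c|^2] is the value of [Psi] at
   [star (c - z) * (c - z)], hence at most [|c - z|^2]. *)
have nil F : F = fset0 by apply/fsetP => i; case: noI; exists.
have [c ->] : exists c : R[i], lin l = c *: 1.
  exists (\sum_(x <- l) x.1); rewrite /lin scaler_suml; apply: eq_bigr => x _.
  by rewrite /tev (nil x.2.1) /elem big_nil.
have z0 : Psi (star z * z) = 0.
  by apply: nz tPsi; split=> //; exists [::].
rewrite nmZ nm1 mulr1 -(ler_pXn2r (n := 2)) ?nnegrE ?cmod_ge0 ?nm_ge0 //.
apply: le_trans _ (state_starM_le sPsi _); rewrite (state_null_sub _ sPsi z0).
by rewrite star_scaleM star1 mulr1 (stateZ sPsi) (state1 sPsi) mulr1 -cmod_sqr.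
Qed.

Lemma tensor_state_faithful Psi : (forall i, faithful (psi i)) ->
  is_tensor_state iota psi Psi -> faithful Psi.
Proof.
move=> fpsi tPsi _ [z ->] z0.
by rewrite (null_eq0 tPsi (null_of_faithful fpsi tPsi z0)) mulr0.
Qed.

End Faithfulness.

(** * The relative Dixmier property *)

Section Averaging.
Context {R : realType} {A : cstarAlgType R}.
Implicit Types (a b x : A) (B D : set A) (l : seq (R[i] * A)).

Definition avg l a := \sum_(u <- l) u.1 *: (star u.2 * a * u.2).

(** Recording weights and unitaries, rather than a point of the convex hull, lets one averaging act
    on several elements and be composed with others. *)
Definition averaging B l :=
  (forall u, u \in l -> [/\ 0 <= u.1, B u.2 & unitary u.2]) /\
  \sum_(u <- l) u.1 = 1.

Lemma avgD l a b : avg l (a + b) = avg l a + avg l b.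
Proof.
by rewrite -big_split; apply: eq_bigr => u _; rewrite mulrDr mulrDl scalerDr.
Qed.

Lemma avgZ l (c : R[i]) a : avg l (c *: a) = c *: avg l a.
Proof.
rewrite /avg scaler_sumr; apply: eq_bigr => u _.
by rewrite -scalerAr -scalerAl !scalerA mulrC.
Qed.

Lemma avgB l a b : avg l (a - b) = avg l a - avg l b.
Proof. by rewrite avgD -scaleN1r avgZ scaleN1r. Qed.

Lemma avg_sum l (K : Type) (s : seq K) (f : K -> A) :
  avg l (\sum_(k <- s) f k) = \sum_(k <- s) avg l (f k).
Proof.
apply: (big_morph _ (avgD l)).
by apply: (addrI (avg l 0)); rewrite -avgD !addr0.
Qed.

Lemma avg_scalar B l (c : R[i]) : averaging B l -> avg l (c *: 1) = c *: 1.
Proof.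
move=> [Bl l1]; rewrite avgZ; congr (_ *: _); rewrite /avg big_seq.
under eq_bigr => u /Bl[_ _ [uu _]] do rewrite mulr1 uu.
by rewrite -big_seq -scaler_suml l1 scale1r.
Qed.

Lemma nm_unitary (u : A) : unitary u -> nm u = 1.
Proof.
move=> [uu _]; have := nm_starM u; rewrite uu nm1 => /esym/eqP.
by rewrite sqrf_eq1 => /orP[/eqP //|/eqP uN]; have := nm_ge0 u; lra.
Qed.

Lemma nm_avg B l a : averaging B l -> nm (avg l a) <= nm a.
Proof.
move=> [Bl l1]; apply: le_trans (nm_sum _ _) _.
have -> : nm a = \sum_(u <- l) cmod u.1 * nm a.
  rewrite -mulr_suml -[LHS]mul1r; congr (_ * _); apply: complexI.
  transitivity (\sum_(u <- l) u.1); first by rewrite l1.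
  rewrite rmorph_sum big_seq [RHS]big_seq; apply: eq_bigr => u /Bl[u0 _ _].
  by rewrite /= ge0_cmod // ge0_Re.
rewrite big_seq [leRHS]big_seq; apply: ler_sum => u /Bl[u0 _ uu].
rewrite nmZ ler_wpM2l ?cmod_ge0 //.
apply: le_trans (nmM _ _) _; rewrite (nm_unitary uu) mulr1.
by apply: le_trans (nmM _ _) _; rewrite nm_star (nm_unitary uu) mul1r.
Qed.

Lemma averaging_comp B l l' : (forall a b, B a -> B b -> B (a * b)) ->
  averaging B l -> averaging B l' ->
  exists2 l'', averaging B l'' & forall a, avg l'' a = avg l (avg l' a).
Proof.
move=> BM [Bl l1] [Bl' l1'].
exists [seq (u.1 * v.1, v.2 * u.2) | u <- l, v <- l']; first split.
- move=> _ /allpairsP[[u v] /= [/Bl[u0 Bu [uu u_u]] /Bl'[v0 Bv [vv v_v]] ->]] /=.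
  split; [exact: mulr_ge0|exact: BM|split; rewrite star_mul].
    by rewrite mulrA -(mulrA (star u.2)) vv mulr1.
  by rewrite mulrA -(mulrA v.2) u_u mulr1.
- rewrite big_allpairs_dep /= -l1 -[RHS]mulr1 -l1' mulr_suml.
  by apply: eq_bigr => u _; rewrite mulr_sumr.
- move=> a; rewrite /avg big_allpairs_dep /=; apply: eq_bigr => u _.
  rewrite mulr_sumr mulr_suml scaler_sumr; apply: eq_bigr => v _.
  by rewrite star_mul -scalerAr -scalerAl scalerA !mulrA.
Qed.

Lemma averaging_id B : B 1 -> averaging B [:: (1, 1)] /\
  forall a, avg [:: (1, 1)] a = a.
Proof.
move=> B1; split; last by move=> a; rewrite /avg big_seq1 scale1r star1 mulr1 mul1r.
split; last by rewrite big_seq1.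
by move=> u; rewrite inE => /eqP ->; split; rewrite ?ler01 // /unitary star1 mulr1.
Qed.

Lemma state_avg phi B l a : is_state phi -> tracial phi -> averaging B l ->
  phi (avg l a) = phi a.
Proof.
move=> sphi tr [Bl l1]; rewrite (state_sum sphi) -[RHS]mul1r -l1 mulr_suml.
rewrite big_seq [RHS]big_seq; apply: eq_bigr => u /Bl[_ _ [_ uu]].
by rewrite (stateZ sphi) -mulrA tr -mulrA uu mulr1.
Qed.

Lemma convex_hullP B a x :
  convex_hull [set star u * a * u | u in [set u | B u /\ unitary u]] x <->
  exists2 l, averaging B l & x = avg l a.
Proof.
split=> [[n [t [s [t0 t1 Ss ->]]]]|[l [Bl l1] ->]].
  have ex k : exists u, (B u /\ unitary u) /\ star u * a * u = s k.
    by have [u Bu us] := Ss k; exists u.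
  pose u k := sval (cid (ex k)).
  have uP k : (B (u k) /\ unitary (u k)) /\ star (u k) * a * u k = s k :=
    svalP (cid (ex k)).
  exists [seq (t k, u k) | k <- index_enum 'I_n].
    split; last by rewrite big_map.
    move=> _ /mapP[k _ ->] /=; have [[Bu uu] _] := uP k.
    by split.
  rewrite /avg big_map; apply: eq_bigr => k _ /=.
  by have [_ ->] := uP k.
exists (size l), (fun k => (tnth (in_tuple l) k).1).
exists (fun k => star (tnth (in_tuple l) k).2 * a * (tnth (in_tuple l) k).2).
have lP k : tnth (in_tuple l) k \in l by exact: mem_tnth.
split.
- by move=> k; have [] := Bl _ (lP k).
- by rewrite -l1 [RHS]big_tnth.
- move=> k; have [_ Bu uu] := Bl _ (lP k).
  by exists (tnth (in_tuple l) k).2.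
- by rewrite /avg big_tnth.
Qed.

Lemma dixmier_avg phi B a (e : R) : relative_dixmier B phi -> 0 < e ->
  exists2 l, averaging B l & nm (avg l a - phi a *: 1) < e.
Proof.
move=> dix e0; have : [set phi a *: 1] (phi a *: 1 : A) by [].
rewrite -dix => -[/closureP/(_ e e0)[x /convex_hullP[l Bl ->] xe] _].
by exists l => //; rewrite nm_sub.
Qed.

(** A tracial state is continuous and constant on the averages of [a], so [phi a] is the only scalar
    that the closure can contain. *)
Lemma relative_dixmierI phi B : is_state phi -> tracial phi ->
  (forall a e, 0 < e -> exists2 l, averaging B l & nm (avg l a - phi a *: 1) < e) ->
  relative_dixmier B phi.
Proof.
move=> sphi tr H a; apply/seteqP; split=> [x|_ ->] /=.
  move=> [/closureP xS [c _ cx]]; rewrite -cx; congr (_ *: _).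
  apply: (@nm_inj R R[i]^o) => e e0.
  have [y /convex_hullP[l Bl ->] xe] := xS e e0.
  apply: le_trans _ (ltW xe); apply: le_trans _ (state_le sphi _).
  by rewrite (stateB sphi) (state_avg _ sphi tr Bl) -cx (stateZ sphi) (state1 sphi) mulr1.
split; last by exists (phi a).
apply/closureP => e e0; have [l Bl le] := H a e e0.
by exists (avg l a); [apply/convex_hullP; exists l|rewrite nm_sub].
Qed.

Lemma dixmier_irreducible phi B : is_state phi -> faithful phi ->
  relative_dixmier B phi -> cstar_irreducible B.
Proof.
move=> sphi fphi dix D sD BD J idJ.
have [[z Jz z0]|noz] := pselect (exists2 z, J z & z <> 0); last first.
  left; apply/seteqP; split=> [x Jx|_ ->]; last exact: (cideal0 idJ).
  by apply: contrapT => x0; apply: noz; exists x.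
right; apply/seteqP; split; first exact: (cideal_sub idJ).
have Jzz : J (star z * z).
  by apply: (cidealMl idJ) => //; apply: (csub_star sD); exact: (cideal_sub idJ).
have Jc : J (phi (star z * z) *: 1).
  apply: (proj1 (closedP J) (cideal_closed idJ)) => e e0.
  have [l [Bl l1] le] := dixmier_avg (star z * z) dix e0.
  exists (avg l (star z * z)); last by rewrite nm_sub.
  rewrite /avg big_seq; elim/big_ind: _ => [|x y|u /Bl[_ Bu _]].
  - exact: (cideal0 idJ).
  - exact: (cidealD idJ).
  - apply: (cidealZ idJ); apply: (cidealMr idJ); last exact: BD.
    by apply: (cidealMl idJ) => //; apply: (csub_star sD); exact: BD.
have c0 : phi (star z * z) != 0.
  by apply/eqP => c0; apply: z0; exact: (starM_eq0 fphi c0).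
have J1 : J 1.
  by have := cidealZ idJ (phi (star z * z))^-1 Jc; rewrite scalerA mulVf // scale1r.
by move=> d Dd; rewrite -(mulr1 d); exact: (cidealMl idJ).
Qed.

(** The next element is averaged after the earlier averaging, which preserves its trace. Earlier
    elements stay close to their scalars because averagings are contractive and fix scalars. *)
Lemma dixmier_avg_seq phi B (s : seq A) (e : R) :
  unital_cstar_subalgebra B -> is_state phi -> tracial phi ->
  relative_dixmier B phi -> 0 < e ->
  exists2 l, averaging B l & forall a, a \in s -> nm (avg l a - phi a *: 1) < e.
Proof.
move=> sB sphi tr dix e0; elim: s => [|a s [l Bl IH]].
  by exists [:: (1, 1)] => //; apply: (averaging_id _).1; exact: csub1.
have [l' Bl' le'] := dixmier_avg (avg l a) dix e0.
have [l'' Bl'' E] := averaging_comp (csubM sB) Bl' Bl.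
exists l'' => // b; rewrite in_cons E => /orP[/eqP ->|/IH le].
  by move: le'; rewrite (state_avg _ sphi tr Bl).
rewrite -(avg_scalar (phi b) Bl') -avgB; apply: le_lt_trans (nm_avg _ Bl') le.
Qed.

End Averaging.

Section StarMorphism.
Context {R : realType} {A T : cstarAlgType R} (f : A -> T).
Context (f_morph : unital_star_morphism f).

Lemma star_morphism_pos a : pos a -> pos (f a).
Proof.
move=> /pos_sqrt[s [[ss _] <- _]]; rewrite (smorphM f_morph); apply: pos_sqr.
by rewrite /sa -(smorph_star f_morph) ss.
Qed.

(** For self-adjoint [x] the order bounds by [|x| + e] are transported by [f], and [pos_bound] reads
    off the norm; the C*-identity reduces the general case to this one. *)
Lemma star_morphism_nm a : nm (f a) <= nm a.
Proof.
have fl (c : R[i]) (x y : A) : f (c *: x + y) = c *: f x + f y := smorph_linear f_morph c x y.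
have f0 : f 0 = 0.
  have := fl 1 0 0; rewrite !scale1r !addr0 => h.
  by apply: (addrI (f 0)); rewrite addr0 -h.
have le_sa x : sa x -> nm (f x) <= nm x.
  move=> sx; apply/ler_addgt0Pr => e e0.
  have t0 : nm x <= nm x + e by lra.
  apply: pos_bound.
  - by rewrite /sa -(smorph_star f_morph) sx.
  - by have := nm_ge0 x; lra.
  - have := star_morphism_pos (pos_nm_sub sx t0).
    have -> : (nm x + e)%:C *: 1 - x = -1 *: x + (nm x + e)%:C *: 1.
      by rewrite scaleN1r addrC.
    rewrite fl -[(nm x + e)%:C *: 1]addr0 fl (smorph1 f_morph) scaleN1r.
    by rewrite addrC f0 addr0.
  - have := star_morphism_pos (pos_nm_add sx t0).
    by rewrite fl (smorph1 f_morph).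
rewrite -(ler_pXn2r (n := 2)) ?nnegrE ?nm_ge0 // -!nm_starM.
by rewrite -(smorph_star f_morph) -(smorphM f_morph); apply: le_sa; exact: sa_starM.
Qed.

End StarMorphism.

Lemma fin_bound (R : realType) (K : finType) (f : K -> R) :
  exists2 M, 0 <= M & forall k, f k <= M.
Proof.
exists (\sum_(k : K) `|f k|); first by apply: sumr_ge0.
move=> k; apply: le_trans (ler_norm _) _; rewrite (bigD1 k) //= lerDl.
by apply: sumr_ge0.
Qed.

Section TensorDixmier.
Context {R : realType} {I : choiceType} {A : I -> cstarAlgType R}.
Context {T : cstarAlgType R} {iota : forall i, A i -> T}.
Context (T_tensor : is_minimal_tensor_product iota).
Arguments iota : clear implicits.
Context (B : forall i, set (A i)).
Arguments B : clear implicits.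
Context (B_sub : forall i, unital_cstar_subalgebra (B i)).
Implicit Types (r : seq I).

Local Notation elem := (@elem R I A T iota).
Local Notation lin := (@lin R I A T iota).

Lemma smallest_csub (S : set T) : unital_cstar_subalgebra (generated_cstar S).
Proof.
split.
- apply: closed_bigI => D [sD _]; exact: csub_closed.
- by move=> D [sD _]; exact: csub1.
- by move=> a b Ga Gb D DS; apply: (csubD DS.1); [exact: Ga|exact: Gb].
- by move=> c a Ga D DS; apply: (csubZ DS.1); exact: Ga.
- by move=> a b Ga Gb D DS; apply: (csubM DS.1); [exact: Ga|exact: Gb].
- by move=> a Ga D DS; apply: (csub_star DS.1); exact: Ga.
Qed.

Lemma tensor_subalgebra_csub : unital_cstar_subalgebra (tensor_subalgebra iota B).
Proof. exact: smallest_csub. Qed.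

Lemma tensor_subalgebra_iota i (b : A i) : B i b -> tensor_subalgebra iota B (iota i b).
Proof. by move=> Bb D [_]; apply; exists i => //; exists b. Qed.

Lemma averaging_iota i (l : seq (R[i] * A i)) : averaging (B i) l ->
  averaging (tensor_subalgebra iota B) [seq (u.1, iota i u.2) | u <- l].
Proof.
move=> [Bl l1]; split; last by rewrite big_map.
move=> _ /mapP[u /Bl[u0 Bu [uu u_u]] ->]; split=> //=.
  exact: tensor_subalgebra_iota.
by split; rewrite -(iota_star T_tensor) -(iotaM T_tensor) ?uu ?u_u (iota1 T_tensor).
Qed.

Lemma avg_iota i (l : seq (R[i] * A i)) (x : A i) (t : T) :
  (forall y : A i, iota i y * t = t * iota i y) ->
  avg [seq (u.1, iota i u.2) | u <- l] (iota i x * t) = iota i (avg l x) * t.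
Proof.
move=> tC; rewrite /avg big_map (iota_sum T_tensor) mulr_suml.
apply: eq_bigr => u _ /=; rewrite (iotaZ T_tensor) !(iotaM T_tensor).
by rewrite (iota_star T_tensor) -scalerAl -!mulrA tC.
Qed.

Context (tau : forall i, A i -> R[i]).
Arguments tau : clear implicits.
Context (tau_state : forall i, is_state (tau i)).
Context (tau_tracial : forall i, tracial (tau i)).

(** Unitaries coming from [B i] commute with the factors in [r], so averaging by them acts on factor
    [i] alone and brings it close to a scalar; the induction hypothesis averages the rest. *)
Lemma tensor_avg_elem r (K : finType) (a : K -> forall i, A i) (e : R) :
  (forall i, relative_dixmier (B i) (tau i)) -> uniq r -> 0 < e ->
  exists2 l, averaging (tensor_subalgebra iota B) l &
    forall k, nm (avg l (elem r (a k)) - (\prod_(i <- r) tau i (a k i)) *: 1) <= e.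
Proof.
move=> dix; elim: r e => [|i r IH] e /=.
  move=> _ e0; have [h1 h2] := averaging_id (csub1 tensor_subalgebra_csub).
  exists [:: (1, 1)] => // k.
  by rewrite h2 /elem !big_nil scale1r subrr nm0 ltW.
move=> /andP[ir ur] e0.
have [M M0 HM] := fin_bound (fun k => nm (elem r (a k))).
have [N N0 HN] := fin_bound (fun k => cmod (tau i (a k i))).
(* Each of the two errors below is at most [e / 2]; the added 1 keeps the denominators nonzero. *)
have d1 : 0 < e / (2 * (M + 1)) by apply: divr_gt0 => //; lra.
have d2 : 0 < e / (2 * (N + 1)) by apply: divr_gt0 => //; lra.
have [l Bl le] := dixmier_avg_seq [seq a k i | k <- enum K] (B_sub i) (tau_state i)
  (@tau_tracial i) (dix i) d1.
have [l' Bl' le'] := IH _ ur d2.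
have Bil := averaging_iota Bl.
have [l'' Bl'' E] := averaging_comp (csubM tensor_subalgebra_csub) Bl' Bil.
exists l'' => // k; rewrite E {1}/elem !big_cons -/(elem r (a k)) avg_iota; last first.
  by move=> y; apply: elem_comm.
set x := elem r (a k); set c := tau i (a k i); set p := \prod_(j <- r) _.
have -> : avg l' (iota i (avg l (a k i)) * x) - (c * p) *: 1 =
    avg l' (iota i (avg l (a k i) - c *: 1) * x) + c *: (avg l' x - p *: 1).
  rewrite (iotaB T_tensor) (iotaZ T_tensor) (iota1 T_tensor) mulrBl avgB.
  by rewrite -scalerAl mul1r avgZ scalerBr scalerA addrA subrK.
apply: le_trans (nmD _ _) _.
have h1 : nm (avg l' (iota i (avg l (a k i) - c *: 1) * x)) <= e / (2 * (M + 1)) * M.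
  apply: le_trans (nm_avg _ Bl') _; apply: le_trans (nmM _ _) _.
  apply: ler_pM; rewrite ?nm_ge0 //; last exact: HM.
  apply: le_trans (star_morphism_nm (mtp_morphism T_tensor i) _) _; apply: ltW; apply: le.
  by apply/mapP; exists k => //; rewrite mem_enum.
have h2 : nm (c *: (avg l' x - p *: 1)) <= N * (e / (2 * (N + 1))).
  rewrite nmZ; apply: ler_pM; rewrite ?nm_ge0 ?cmod_ge0 //; first exact: HN.
  exact: le'.
have e1 : e / (2 * (M + 1)) * (2 * (M + 1)) = e by rewrite divfK // gt_eqF //; lra.
have e2 : e / (2 * (N + 1)) * (2 * (N + 1)) = e by rewrite divfK // gt_eqF //; lra.
by lra.
Qed.

Lemma tensor_dixmier tauT : (forall i, relative_dixmier (B i) (tau i)) ->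
  is_tensor_state iota tau tauT -> tracial tauT ->
  relative_dixmier (tensor_subalgebra iota B) tauT.
Proof.
move=> dix tT tr; have [sT _] := tT.
apply: relative_dixmierI => // t e e0.
(* Three errors of at most [e / 4] occur: averaging [t - lin s], its trace, and averaging
   [lin s]. *)
have [|s ts] := spanned_dense T_tensor t (e := e / 4); first lra.
pose n := size s; pose x (k : 'I_n) := tnth (in_tuple s) k.
have linE : lin s = \sum_(k < n) (x k).1 *: elem (supp s) (pad (x k).2).
  by rewrite (lin_pad T_tensor (fsubset_refl _)) big_tnth.
pose C := \sum_(k < n) cmod (x k).1.
have C0 : 0 <= C by apply: sumr_ge0 => k _; exact: cmod_ge0.
have d0 : 0 < e / (4 * (C + 1)) by apply: divr_gt0 => //; lra.
have [l Bl le] := tensor_avg_elem (fun k => pad (x k).2) dix (fset_uniq (supp s)) d0.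
exists l => //.
have tauE : tauT (lin s) = \sum_(k < n) (x k).1 * \prod_(i <- supp s) tau i (pad (x k).2 i).
  rewrite linE (state_sum sT); apply: eq_bigr => k _; rewrite (stateZ sT).
  by rewrite (tensor_state_tev (supp s, pad (x k).2) tT).
have h : nm (avg l (lin s) - tauT (lin s) *: 1) <= C * (e / (4 * (C + 1))).
  rewrite tauE linE avg_sum scaler_suml -sumrB.
  apply: le_trans (nm_sum _ _) _; rewrite mulr_suml; apply: ler_sum => k _.
  by rewrite avgZ -scalerA -scalerBr nmZ ler_wpM2l ?cmod_ge0.
have -> : avg l t - tauT t *: 1 = avg l (t - lin s) +
    ((avg l (lin s) - tauT (lin s) *: 1) - tauT (t - lin s) *: 1).
  rewrite avgB (stateB sT) scalerBl opprB !addrA.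
  by rewrite !subrK.
apply: le_lt_trans (nmD _ _) _.
have h1 := nm_avg (t - lin s) Bl.
have h2 := nmB (avg l (lin s) - tauT (lin s) *: 1) (tauT (t - lin s) *: 1).
have h3 : nm (tauT (t - lin s) *: 1 : T) <= nm (t - lin s).
  by rewrite nmZ nm1 mulr1; exact: state_le.
have e1 : e / (4 * (C + 1)) * (4 * (C + 1)) = e by rewrite divfK // gt_eqF //; lra.
by lra.
Qed.

(** Both sides are bounded and bilinear, so [linear_ext] is used once in each variable; on
    elementary tensors the identity holds factor by factor. *)
Lemma tensor_tracial tauT : is_tensor_state iota tau tauT -> tracial tauT.
Proof.
move=> tT s t; have [sT _] := tT; move: s.
have lin1 s : linear (fun t => tauT (s * t) : R[i]^o).
  by move=> c x y; rewrite mulrDr -scalerAr (stateD sT) (stateZ sT).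
have lin2 s : linear (fun t => tauT (t * s) : R[i]^o).
  by move=> c x y; rewrite mulrDl -scalerAl (stateD sT) (stateZ sT).
have bnd1 s u : nm (tauT (s * u) : R[i]^o) <= nm s * nm u.
  by apply: le_trans (state_le sT _) (nmM _ _).
have bnd2 s u : nm (tauT (u * s) : R[i]^o) <= nm s * nm u.
  by apply: le_trans (state_le sT _) _; rewrite mulrC nmM.
apply: (linear_ext T_tensor (lin2 t) (lin1 t) (bnd2 t) (bnd1 t)) => u; move: t.
apply: (linear_ext T_tensor (lin1 _) (lin2 _) (bnd1 _) (bnd2 _)) => v.
rewrite -!(tevM T_tensor) !(tensor_state_tev _ tT) /pfun /= fsetUC.
by apply: eq_bigr => i _; exact: tau_tracial.
Qed.

End TensorDixmier.

(** * The relative excision property *)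

Section Excision.
Context {R : realType} {A : cstarAlgType R}.
Implicit Types (a h s t y : A) (B D J : set A).

Definition excising B h s := [/\ B h, cpositive h, nm h = 1 & is_psqrt h s].

(** Directedness of the net gives one index that serves all elements of a finite list. *)
Lemma excision_seq psi B (l : seq A) (e : R) : relative_excision B psi -> 0 < e ->
  exists h s, excising B h s /\
    forall a, a \in l -> nm (s * a * s - psi a *: h) < e.
Proof.
move=> [L [le [h [s [[[m0] refl trans ub] hP exc]]]]] e0.
suff [m Hm] : exists m, forall n, le m n -> forall a, a \in l ->
    nm (s n * a * s n - psi a *: h n) < e.
  exists (h m), (s m); split; last exact: Hm.
  have [Bh ch h1 sh] := hP m; split=> //.
  by apply: complexI; rewrite -nmE.
elim: l => [|a l [m Hm]]; first by exists m0.
have [|m' Hm'] := exc a e%:C; first by rewrite ltcR.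
have [n [mn m'n]] := ub m m'; exists n => k nk b; rewrite in_cons.
move=> /orP[/eqP ->|]; last exact: (Hm k (trans _ _ _ mn nk)).
by have := Hm' k (trans _ _ _ m'n nk); rewrite nmE ltcR.
Qed.

Lemma ideal_one D J t : unital_cstar_subalgebra D -> closed_ideal D J ->
  J t -> nm (1 - t) < 1 -> J = D.
Proof.
move=> sD idJ Jt t1; have Dt : D t by exact: (cideal_sub idJ).
have DR := csub_real_subalgebra sD.
have [v [v1 _ Dv]] := neumann_series t1.
have J1 : J 1.
  rewrite -v1 opprB addrC subrK; apply: (cidealMl idJ) => //; apply: Dv => //.
  by apply: rsubB => //; exact: csub1.
apply/seteqP; split; first exact: (cideal_sub idJ).
by move=> d Dd; rewrite -(mulr1 d); exact: (cidealMl idJ).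
Qed.

Context (psi : A -> R[i]) (psi_state : is_state psi).
Context (psi_faithful : faithful psi).

Lemma psqrt_pos h s : is_psqrt h s -> pos s.
Proof. by move=> [[b ->] _]; exact: (pos_starM psi_state). Qed.

(** [is_psqrt] does not say where [s] lies. By uniqueness [s] is the root that [pos_sqrt] builds
    inside [D]; the two commute, since [s] commutes with [h]. *)
Lemma psqrt_sub D h s : real_subalgebra D -> D h -> is_psqrt h s -> D s.
Proof.
move=> sD Dh sh; have ps := psqrt_pos sh; have [ss _] := ps.
have [_ hE] := sh.
have ph : pos h by rewrite -hE; exact: pos_sqr.
have [q [pq qq Dq]] := pos_sqrt ph.
have qs : s * q = q * s.
  by apply/esym; apply: (Dq _ (commutant_real_subalgebra s)); rewrite -hE /commutant /= mulrA.
by rewrite (pos_sqrt_unique ps pq qs) ?hE //; exact: Dq.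
Qed.

Lemma excising_psqrt B h s : excising B h s ->
  [/\ sa s, pos h, nm h = 1 & s * s = h].
Proof.
move=> [_ _ h1 sh]; have [ss _] := psqrt_pos sh; have [_ hE] := sh.
by split=> //; rewrite -hE; exact: pos_sqr.
Qed.

(** The map from [t] to the sum is unital and preserves positivity, hence contracts self-adjoint
    elements. *)
Lemma sum_conj_nm (ys : seq A) t : \sum_(y <- ys) star y * y = 1 -> sa t ->
  nm (\sum_(y <- ys) star y * t * y) <= nm t.
Proof.
move=> ys1 st; apply/ler_addgt0Pr => e e0.
have t0 : nm t <= nm t + e by lra.
have sumE (r : R) : \sum_(y <- ys) star y * (r%:C *: 1) * y = r%:C *: 1.
  rewrite -[in RHS]ys1 scaler_sumr; apply: eq_bigr => y _.
  by rewrite scalar_mulr scalerAl.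
apply: pos_bound.
- by rewrite /sa star_sum; apply: eq_bigr => y _; exact: sa_conj.
- by have := nm_ge0 t; lra.
- rewrite -sumE -sumrB; apply: pos_sum => y; rewrite -mulrBl -mulrBr.
  by apply: (pos_conj psi_state psi_faithful); exact: pos_nm_sub.
- rewrite -sumE -big_split; apply: pos_sum => y /=; rewrite -mulrDl -mulrDr.
  by apply: (pos_conj psi_state psi_faithful); exact: pos_nm_add.
Qed.

(** Otherwise [pos_of_conj] makes [1 - d - h] positive, against [|h| = 1]. *)
Lemma norming_vector h (d : R) : pos h -> nm h = 1 -> 0 < d < 1 ->
  exists y, (1 - d) * complex.Re (psi (star y * y)) < complex.Re (psi (star y * h * y)).
Proof.
move=> ph h1 /andP[d0 d1]; apply: contrapT => H.
suff : nm h <= 1 - d by rewrite h1; lra.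
apply: pos_le_nm => //; last lra.
apply: (pos_of_conj psi_state psi_faithful) => y.
rewrite mulrBr mulrBl scalar_mulr -scalerAl (stateB psi_state) (stateZ psi_state).
have hy : 0 <= psi (star y * h * y).
  by apply: (state_pos psi_state); exact: (pos_conj psi_state psi_faithful).
rewrite subr_ge0 -(ge0_Re hy) -(ge0_Re (state_starM psi_state y)).
rewrite -(rmorphM (real_complex R)) lecR leNgt; apply/negP => lt_y.
by apply: H; exists y.
Qed.

End Excision.

Lemma bernoulli_sub (R : realType) (d : R) n : 0 <= d <= 1 ->
  1 - n%:R * d <= (1 - d) ^+ n.
Proof.
move=> /andP[d0 d1]; elim: n => [|n IH]; first by rewrite mul0r subr0 expr0.
rewrite exprS -natr1; have : 0 <= n%:R :> R by []; nra.
Qed.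

Section TensorExcision.
Context {R : realType} {I : choiceType} {A : I -> cstarAlgType R}.
Context {T : cstarAlgType R} {iota : forall i, A i -> T}.
Context (T_tensor : is_minimal_tensor_product iota).
Arguments iota : clear implicits.
Context (B : forall i, set (A i)).
Arguments B : clear implicits.
Context (B_sub : forall i, unital_cstar_subalgebra (B i)).
Context (psi : forall i, A i -> R[i]).
Arguments psi : clear implicits.
Context (psi_state : forall i, is_state (psi i)).
Context (psi_faithful : forall i, faithful (psi i)).
Implicit Types (r : seq I) (h s : forall i, A i).

Local Notation elem := (@elem R I A T iota).
Local Notation lin := (@lin R I A T iota).

Lemma elem_excision r (K : finType) (a : K -> forall i, A i) (e : R) :
  (forall i, relative_excision (B i) (psi i)) -> uniq r -> 0 < e ->
  exists h s, (forall i, excising (B i) (h i) (s i)) /\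
    forall k, nm (elem r s * elem r (a k) * elem r s -
                  (\prod_(i <- r) psi i (a k i)) *: elem r h) <= e.
Proof.
move=> exc; elim: r e => [|i r IH] e /=.
  (* Over the empty list any excising pairs will do, but [h] and [s] are total families and need a
     pair at every index. *)
  move=> _ e0; have ex i : exists hs : A i * A i, excising (B i) hs.1 hs.2.
    by have [h [s [hs _]]] := excision_seq [::] (exc i) ltr01; exists (h, s).
  exists (fun i => (sval (cid (ex i))).1), (fun i => (sval (cid (ex i))).2).
  split; first by move=> i; exact: svalP (cid (ex i)).
  by move=> k; rewrite /elem !big_nil !mulr1 scale1r subrr nm0 ltW.
move=> /andP[ir ur] e0.
have [N N0 HN] := fin_bound (fun k => cmod (psi i (a k i))).
have d2 : 0 < e / (2 * (N + 1)) by apply: divr_gt0 => //; lra.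
have [h [s [hs Hr]]] := IH _ ur d2.
pose X k := elem r s * elem r (a k) * elem r s.
have [M M0 HM] := fin_bound (fun k => nm (X k)).
have d1 : 0 < e / (2 * (M + 1)) by apply: divr_gt0 => //; lra.
have [hi [si [hsi Hi]]] := excision_seq [seq a k i | k <- enum K] (exc i) d1.
exists (with_coord h hi), (with_coord s si); split.
  move=> j; have [<-|ij] := eqVneq i j; first by rewrite !with_coord_in.
  by rewrite !with_coord_out.
have hr (b : forall j, A j) (x : A i) : elem (i :: r) (with_coord b x) = iota i x * elem r b.
  rewrite /elem big_cons with_coord_in; congr (_ * _).
  apply: eq_big_seq => j jr; rewrite with_coord_out //.
  by apply: contraNneq ir => ->.
move=> k; rewrite !hr big_cons.
have -> : elem (i :: r) (a k) = iota i (a k i) * elem r (a k) by rewrite /elem big_cons.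
have -> : iota i si * elem r s * (iota i (a k i) * elem r (a k)) * (iota i si * elem r s) =
    iota i (si * a k i * si) * X k.
  have C (b : forall j, A j) (x : A i) : iota i x * elem r b = elem r b * iota i x.
    exact: (elem_comm T_tensor).
  rewrite !(iotaM T_tensor) /X !mulrA.
  rewrite -(mulrA (iota i si) (elem r s)) -C !mulrA.
  rewrite -(mulrA _ (elem r (a k))) -C !mulrA.
  by rewrite -(mulrA _ (elem r s)) -C !mulrA.
set c := psi i (a k i); set p := \prod_(j <- r) _.
(* The error of factor [i] is multiplied by [X k], bounded by [M]; the error of the others by [c],
   bounded by [N], and by [hi] of norm 1. *)
have -> : iota i (si * a k i * si) * X k - (c * p) *: (iota i hi * elem r h) =
    iota i (si * a k i * si - c *: hi) * X k +
    c *: (iota i hi * (X k - p *: elem r h)).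
  rewrite (iotaB T_tensor) (iotaZ T_tensor) mulrBl mulrBr scalerBr -scalerAl.
  by rewrite -scalerAr scalerA addrA subrK.
apply: le_trans (nmD _ _) _.
have h1 : nm (iota i (si * a k i * si - c *: hi) * X k) <= e / (2 * (M + 1)) * M.
  apply: le_trans (nmM _ (X k)) _.
  apply: ler_pM; [exact: nm_ge0|exact: nm_ge0| |exact: (HM k)].
  apply: le_trans (star_morphism_nm (mtp_morphism T_tensor i) _) _.
  by apply: ltW; apply: Hi; apply/mapP; exists k => //; rewrite mem_enum.
have h2 : nm (c *: (iota i hi * (X k - p *: elem r h))) <= N * (e / (2 * (N + 1))).
  rewrite nmZ; apply: ler_pM; rewrite ?nm_ge0 ?cmod_ge0 //; first exact: HN.
  apply: le_trans (nmM _ _) _; rewrite -[leRHS]mul1r.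
  apply: ler_pM; rewrite ?nm_ge0 //; last exact: Hr.
  apply: le_trans (star_morphism_nm (mtp_morphism T_tensor i) _) _.
  by have [_ _ -> _] := hsi.
have e1 : e / (2 * (M + 1)) * (2 * (M + 1)) = e by rewrite divfK // gt_eqF //; lra.
have e2 : e / (2 * (N + 1)) * (2 * (N + 1)) = e by rewrite divfK // gt_eqF //; lra.
by lra.
Qed.

Lemma nm_elem_le r h : (forall i, nm (h i) <= 1) -> nm (elem r h) <= 1.
Proof.
move=> h1; elim: r => [|i r IH]; first by rewrite /elem big_nil nm1.
rewrite /elem big_cons; apply: le_trans (nmM _ _) _.
apply: mulr_ile1; rewrite ?nm_ge0 //.
exact: le_trans (star_morphism_nm (mtp_morphism T_tensor i) _) (h1 i).
Qed.

Lemma elem_excising r h s : uniq r -> (forall i, excising (B i) (h i) (s i)) ->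
  [/\ sa (elem r s), elem r s * elem r s = elem r h & cpositive (elem r s)].
Proof.
move=> ur hs; have P i := excising_psqrt (psi_state i) (@psi_faithful i) (hs i).
split.
- rewrite /sa (star_elem T_tensor) //; apply: eq_elem => i _.
  by have [ss _ _ _] := P i.
- rewrite (elemM T_tensor) //; apply: eq_elem => i _.
  by have [_ _ _ ->] := P i.
- have ex i : exists b, s i = star b * b by have [_ _ _ [[b sb] _]] := hs i; exists b.
  pose b i := sval (cid (ex i)).
  exists (elem r b); rewrite (star_elem T_tensor) // (elemM T_tensor) //.
  by apply: eq_elem => i _; exact: svalP (cid (ex i)).
Qed.

(* Vectors y i which nearly attain the norm of h i in the GNS representation
   of psi i give a product vector for elem r h. *)
Lemma nm_elem_excising (F : {fset I}) h s :
  (forall i, excising (B i) (h i) (s i)) -> nm (elem F h) = 1.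
Proof.
move=> hs; have P i := excising_psqrt (psi_state i) (@psi_faithful i) (hs i).
have [sS SS _] := elem_excising (fset_uniq F) hs.
apply/eqP; rewrite eq_le; apply/andP; split.
  by apply: nm_elem_le => i; have [_ _ -> _] := P i.
have [Psi tPsi] := tensor_state_exists T_tensor psi_state; have [sPsi _] := tPsi.
have key (d : R) : 0 < d < 1 -> (1 - d) ^+ size F <= nm (elem F h).
  move=> d01; have /andP[d0 d1] := d01.
  have ex i : exists y, (1 - d) * complex.Re (psi i (star y * y)) <
                        complex.Re (psi i (star y * h i * y)).
    have [_ ph h1 _] := P i; exact: (norming_vector (psi_state i) (@psi_faithful i)).
  pose y i := sval (cid (ex i)).
  have yP i : (1 - d) * complex.Re (psi i (star (y i) * y i)) <
              complex.Re (psi i (star (y i) * h i * y i)) := svalP (cid (ex i)).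
  pose p i := complex.Re (psi i (star (y i) * h i * y i)).
  pose q i := complex.Re (psi i (star (y i) * y i)).
  have q0 i : 0 <= q i by exact/Re_ge0/state_starM.
  have qn0 i : 0 < q i.
    rewrite lt_neqAle q0 andbT; apply/eqP => qi.
    have := yP i; rewrite -/(q i) -qi mulr0.
    have y0 : y i = 0.
      apply: (starM_eq0 (@psi_faithful i)).
      by rewrite -(ge0_Re (state_starM (psi_state i) _)) -/(q i) -qi.
    by rewrite y0 mulr0 (state0 (psi_state i)) /= ltxx.
  (* As [elem F s] has square [elem F h], this bounds the product of the [p i] by [|elem F h|] times
     the product of the [q i], whereas [p i > (1 - d) q i] in each factor. *)
  have bound := state_starM_conj_le sPsi (elem F s) (elem F y).
  rewrite sS SS in bound.
  have e1 : star (elem F y) * elem F h * elem F y = elem F (fun i => star (y i) * h i * y i).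
    by rewrite (star_elem T_tensor) // !(elemM T_tensor).
  have e2 : star (elem F y) * elem F y = elem F (fun i => star (y i) * y i).
    by rewrite (star_elem T_tensor) // (elemM T_tensor).
  have ReE (f : forall i, A i) : (forall i, 0 <= psi i (f i)) ->
      complex.Re (Psi (elem F f)) = \prod_(i <- F) complex.Re (psi i (f i)).
    move=> f0; rewrite (tensor_state_tev (F, f) tPsi) /pfun /=.
    have -> // : \prod_(i <- F) psi i (f i) = (\prod_(i <- F) complex.Re (psi i (f i)))%:C.
    by rewrite rmorph_prod; apply: eq_bigr => i _; rewrite /= ge0_Re.
  have Ep : complex.Re (Psi (elem F (fun i => star (y i) * h i * y i))) = \prod_(i <- F) p i.
    apply: ReE => i; apply: (state_pos (psi_state i)).
    by apply: (pos_conj (psi_state i) (@psi_faithful i)); have [] := P i.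
  have Eq : complex.Re (Psi (elem F (fun i => star (y i) * y i))) = \prod_(i <- F) q i.
    by apply: ReE => i; exact: state_starM.
  have nS : nm (elem F s) ^+ 2 = nm (elem F h) by rewrite -SS nm_sqr.
  rewrite e1 e2 Ep Eq nS in bound.
  have Q0 : 0 < \prod_(i <- F) q i by exact: prodr_gt0.
  rewrite -(ler_pM2r Q0); apply: le_trans bound.
  elim: (enum_fset F) => [|i r' IH]; first by rewrite !big_nil expr0 mulr1.
  rewrite !big_cons /= exprS mulrACA; apply: ler_pM.
  - by apply: mulr_ge0 => //; lra.
  - apply: mulr_ge0; [by apply: exprn_ge0; lra|exact: prodr_ge0].
  - exact: ltW (yP i).
  - exact: IH.
rewrite leNgt; apply/negP => lt1.
(* With this [N], Bernoulli gives [(1 - d)^|F| >= 1 - |F| d > 1 - N d = |elem F h|], a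
   contradiction. The 2 keeps [d] below 1 when [F] is empty. *)
pose N := (size F)%:R + 2 : R; have N2 : 2 <= N by rewrite lerDr.
pose d := (1 - nm (elem F h)) / N.
have N0 : 0 < N by lra.
have dN : d * N = 1 - nm (elem F h) by rewrite /d divfK // gt_eqF.
have d0 : 0 < d by apply: divr_gt0 => //; lra.
have d1 : d < 1 by have := nm_ge0 (elem F h); nra.
have d01 : 0 <= d <= 1 by rewrite !ltW.
have := key d; rewrite d0 d1 => /(_ isT); have := bernoulli_sub (size F) d01.
move: dN; rewrite /N; nra.
Qed.

Lemma lin_excision m (t : 'I_m -> T) Psi (e : R) :
  (forall i, relative_excision (B i) (psi i)) -> is_tensor_state iota psi Psi ->
  0 < e ->
  exists (F : {fset I}) h s, (forall i, excising (B i) (h i) (s i)) /\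
    forall k, nm (elem F s * t k * elem F s - Psi (t k) *: elem F h) <= e.
Proof.
move=> exc tPsi e0; have [sPsi _] := tPsi.
have e4 : 0 < e / 4 by lra.
pose l k := sval (cid (spanned_dense T_tensor (t k) e4)).
have lP k : nm (t k - lin (l k)) < e / 4 := svalP (cid (spanned_dense T_tensor (t k) e4)).
pose F := (\bigcup_(k <- enum 'I_m) supp (l k))%fset.
have lF k : (supp (l k) `<=` F)%fset.
  by apply: (@bigfcup_sup _ _ _ k) => //; rewrite mem_enum.
(* The lists [l k] differ in length; with the common bound [n] and the filler [x0], all their terms
   form one family over ['I_m * 'I_n]. *)
pose n := \max_(k < m) size (l k).
have sn k : (size (l k) <= n)%N by exact: leq_bigmax.
pose x0 : R[i] * ({fset I} * (forall i, A i)) := (0, (fset0, fun i => 1)).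
pose x k j := nth x0 (l k) j.
have linE k : lin (l k) = \sum_(j < size (l k)) (x k j).1 *: elem F (pad (x k j).2).
  by rewrite (lin_pad T_tensor (lF k)) (big_nth x0) big_mkord.
have [C C0 HC] := fin_bound (fun k : 'I_m => \sum_(j < size (l k)) cmod (x k j).1).
have d0 : 0 < e / (4 * (C + 1)) by apply: divr_gt0 => //; lra.
have [h [s [hs Hhs]]] := @elem_excision F ('I_m * 'I_n)%type
  (fun kj => pad (x kj.1 kj.2).2) _ exc (fset_uniq F) d0.
exists F, h, s; split=> // k.
have [sS SS _] := elem_excising (fset_uniq F) hs.
have nH := nm_elem_excising F hs.
have nS : nm (elem F s) = 1.
  have := nm_sqr sS; rewrite SS nH => /esym/eqP; rewrite sqrf_eq1.
  by move=> /orP[/eqP //|/eqP sN]; have := nm_ge0 (elem F s); lra.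
set S := elem F s in nS SS sS Hhs *; set H := elem F h in nH SS Hhs *.
have h1 : nm (S * lin (l k) * S - Psi (lin (l k)) *: H) <= C * (e / (4 * (C + 1))).
  have -> : Psi (lin (l k)) =
      \sum_(j < size (l k)) (x k j).1 * \prod_(i <- F) psi i (pad (x k j).2 i).
    rewrite linE (state_sum sPsi); apply: eq_bigr => j _; rewrite (stateZ sPsi).
    by rewrite (tensor_state_tev (F, pad (x k j).2) tPsi).
  rewrite linE mulr_sumr mulr_suml scaler_suml -sumrB.
  apply: le_trans (nm_sum _ _) _; apply: le_trans (ler_wpM2r (ltW d0) (HC k)).
  rewrite mulr_suml; apply: ler_sum => j _.
  rewrite -scalerAr -scalerAl -scalerA -scalerBr nmZ ler_wpM2l ?cmod_ge0 //.
  by have := Hhs (k, widen_ord (sn k) j).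
have -> : S * t k * S - Psi (t k) *: H = S * (t k - lin (l k)) * S +
    ((S * lin (l k) * S - Psi (lin (l k)) *: H) - Psi (t k - lin (l k)) *: H).
  by rewrite (stateB sPsi) mulrBr mulrBl scalerBl opprB !addrA !subrK.
apply: le_trans (nmD _ _) _.
have h2 := nmB (S * lin (l k) * S - Psi (lin (l k)) *: H) (Psi (t k - lin (l k)) *: H).
have h3 : nm (Psi (t k - lin (l k)) *: H) <= nm (t k - lin (l k)).
  by rewrite nmZ nH mulr1; exact: state_le.
have h4 : nm (S * (t k - lin (l k)) * S) <= nm (t k - lin (l k)).
  apply: le_trans (nmM _ _) _; rewrite nS mulr1.
  by apply: le_trans (nmM _ _) _; rewrite nS mul1r.
have e1 : e / (4 * (C + 1)) * (4 * (C + 1)) = e by rewrite divfK // gt_eqF //; lra.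
by have := lP k; lra.
Qed.

Lemma elem_sub r (D : set T) (a : forall i, A i) : unital_cstar_subalgebra D ->
  (forall i, D (iota i (a i))) -> D (elem r a).
Proof.
move=> sD Da; rewrite /elem; elim/big_ind: _ => //; first exact: (csub1 sD).
by move=> x y; exact: (csubM sD).
Qed.

Lemma excising_sub i (h s : A i) : excising (B i) h s -> B i s.
Proof.
move=> [Bh _ _ sh]; apply: (psqrt_sub (psi_state i) (@psi_faithful i) _ Bh sh).
exact: csub_real_subalgebra.
Qed.

Lemma tensor_excision Psi : (forall i, relative_excision (B i) (psi i)) ->
  is_tensor_state iota psi Psi ->
  relative_excision (tensor_subalgebra iota B) Psi.
Proof.
move=> exc tPsi; pose Bt := tensor_subalgebra iota B.
have ex (ln : seq T * nat) : exists hs : T * T, excising Bt hs.1 hs.2 /\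
    forall t, t \in ln.1 -> nm (hs.2 * t * hs.2 - Psi t *: hs.1) <= (ln.2.+1%:R : R)^-1.
  case: ln => l n /=.
  have n0 : 0 < (n.+1%:R : R)^-1 by rewrite invr_gt0.
  have [F [h [s [hs Hhs]]]] := lin_excision (fun k => tnth (in_tuple l) k) exc tPsi n0.
  have [sS SS cS] := elem_excising (fset_uniq F) hs.
  exists (elem F h, elem F s) => /=; split; last first.
    by move=> t /(tnthP (in_tuple l))[k ->]; exact: Hhs.
  split=> //=.
  - apply: elem_sub; first exact: tensor_subalgebra_csub.
    by move=> i; apply: tensor_subalgebra_iota; have [] := hs i.
  - by exists (elem F s); rewrite sS SS.
  - exact: (nm_elem_excising F hs).
pose hs ln := sval (cid (ex ln)); have hsP ln := svalP (cid (ex ln)).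
(* The index is a finite list of elements to be excised together with a precision [1 / (n + 1)];
   concatenation and maximum give upper bounds. *)
exists (seq T * nat)%type, (fun x y => (forall t, t \in x.1 -> t \in y.1) /\ (x.2 <= y.2)%N).
exists (fun ln => (hs ln).1), (fun ln => (hs ln).2); split.
- split.
  + by split; exact: ([::], 0%N).
  + by [].
  + by move=> x y z [xy xy2] [yz yz2]; split; [move=> t /xy/yz|exact: leq_trans yz2].
  + move=> x y; exists (x.1 ++ y.1, maxn x.2 y.2) => /=.
    split; split=> [t|]; rewrite ?leq_maxl ?leq_maxr // mem_cat => ->; rewrite ?orbT //.
- move=> ln; have [[Bh ch h1 sh] _] := hsP ln; split=> //.
  by rewrite nmE h1.
- move=> t e e0; have [N HN] := natSinv_small (Re_gt0 e0).
  exists ([:: t], N) => ln [/= tl Nl].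
  rewrite nmE -(ge0_Re (ltW e0)) ltcR.
  have [_ H] := hsP ln; apply: le_lt_trans (H t _) (HN _ Nl).
  by apply: tl; rewrite inE.
Qed.

(* Averaging with the elements given by the simplicity of B i moves the i-th
   factor of elem r h close to 1 and preserves the ideal J. *)
Lemma near_ideal (D J : set T) Psi r h s t (d : R) :
  is_tensor_state iota psi Psi -> faithful Psi ->
  unital_cstar_subalgebra D -> tensor_subalgebra iota B `<=` D ->
  closed_ideal D J -> (forall i, cstar_simple (B i)) ->
  uniq r -> (forall i, excising (B i) (h i) (s i)) -> 0 < d -> J t -> sa t ->
  exists2 t', J t' & nm (1 - t') <= nm (elem r h - t) + (size r)%:R * d.
Proof.
move=> tPsi fPsi sD BD idJ simB + hs d0; have [sPsi _] := tPsi.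
have P i := excising_psqrt (psi_state i) (@psi_faithful i) (hs i).
elim: r t => [|i r IH] t /=.
  by move=> _ Jt st; exists t => //; rewrite mul0r addr0 /elem big_nil.
move=> /andP[ir ur] Jt st.
have [_ ph h1 _] := P i; have [Bh _ _ _] := hs i.
have [ys [Bys ys1 yse]] := simple_average (psi_state i) (@psi_faithful i)
  (B_sub i) (simB i) Bh ph h1 d0.
set g := \sum_(y <- ys) star y * h i * y in yse.
pose zs := [seq iota i y | y <- ys].
have zs1 : \sum_(z <- zs) star z * z = 1.
  rewrite big_map -(iota1 T_tensor i) -ys1 (iota_sum T_tensor).
  by apply: eq_bigr => y _; rewrite (iotaM T_tensor) (iota_star T_tensor).
pose L x := \sum_(z <- zs) star z * x * z.
have LB x y : L (x - y) = L x - L y.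
  by rewrite /L -sumrB; apply: eq_bigr => z _; rewrite mulrBr mulrBl.
have C (x : A i) : iota i x * elem r h = elem r h * iota i x.
  exact: (elem_comm T_tensor).
have LE : L (elem (i :: r) h) = iota i g * elem r h.
  rewrite /L big_map /g (iota_sum T_tensor) mulr_suml; apply: eq_bigr => y _.
  rewrite /elem big_cons -/(elem r h) !(iotaM T_tensor) (iota_star T_tensor).
  by rewrite -!mulrA C.
have DzB z : z \in zs -> D z.
  by move=> /mapP[y /Bys By ->]; apply: BD; exact: tensor_subalgebra_iota.
have JL : J (L t).
  rewrite /L big_seq; elim/big_ind: _ => [|x y|z zz].
  - exact: (cideal0 idJ).
  - exact: (cidealD idJ).
  - apply: (cidealMr idJ); last exact: DzB.
    by apply: (cidealMl idJ) => //; apply: (csub_star sD); exact: DzB.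
have sL : sa (L t).
  by rewrite /sa star_sum; apply: eq_bigr => z _; exact: sa_conj.
have sH : sa (elem (i :: r) h).
  rewrite /sa (star_elem T_tensor) /= ?ir //; apply: eq_elem => j _.
  by have [_ [shj _] _ _] := P j.
have [t' Jt' le'] := IH (L t) ur JL sL; exists t' => //.
apply: le_trans le' _; rewrite -natr1.
(* The way from [elem r h] to [L t] goes through [iota i g * elem r h]: the first leg costs at most
   [d], and on the second [L] contracts. *)
have h2 := nm_tri (iota i g * elem r h) (elem r h) (L t).
have h3 : nm (iota i g * elem r h - L t) <= nm (elem (i :: r) h - t).
  rewrite -LE -LB; apply: (sum_conj_nm sPsi fPsi zs1); exact: saB.
have h4 : nm (elem r h - iota i g * elem r h) <= d.
  have -> : elem r h - iota i g * elem r h = iota i (1 - g) * elem r h.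
    by rewrite (iotaB T_tensor) (iota1 T_tensor) mulrBl mul1r.
  apply: le_trans (nmM _ _) _; rewrite -[leRHS]mulr1.
  apply: ler_pM; rewrite ?nm_ge0 //.
    exact: le_trans (star_morphism_nm (mtp_morphism T_tensor i) _) yse.
  by apply: nm_elem_le => j; have [_ _ -> _] := P j.
lra.
Qed.

Lemma excision_irreducible Psi : (forall i, relative_excision (B i) (psi i)) ->
  is_tensor_state iota psi Psi -> faithful Psi ->
  (forall i, cstar_simple (B i)) -> cstar_irreducible (tensor_subalgebra iota B).
Proof.
move=> exc tPsi fPsi simB D sD BD J idJ; have [sPsi _] := tPsi.
have [[z Jz z0]|noz] := pselect (exists2 z, J z & z <> 0); last first.
  left; apply/seteqP; split=> [x Jx|_ ->]; last exact: (cideal0 idJ).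
  by apply: contrapT => x0; apply: noz; exists x.
right.
pose c := complex.Re (Psi (star z * z)).
have cE : c%:C = Psi (star z * z) by rewrite ge0_Re //; exact: state_starM.
have c0 : c != 0.
  apply/eqP => c0; apply: z0; apply: (starM_eq0 fPsi); by rewrite -cE c0.
(* Normalised so that [Psi a = 1]: excision then brings an element of [J] close to [elem F h]
   itself. *)
pose a := c^-1%:C *: (star z * z).
have sa_a : sa a by apply: saZ; exact: sa_starM.
have Psia : Psi a = 1.
  by rewrite (stateZ sPsi) -cE -(rmorphM (real_complex R)) mulVf.
have Ja : J a.
  apply: (cidealZ idJ); apply: (cidealMl idJ) => //.
  by apply: (csub_star sD); exact: (cideal_sub idJ).
have e4 : 0 < 1 / 4 :> R by lra.
have [F [h [s [hs /(_ ord0)]]]] := lin_excision (fun _ : 'I_1 => a) exc tPsi e4.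
rewrite Psia scale1r => near.
have [sS SS _] := elem_excising (fset_uniq F) hs.
have DS : D (elem F s).
  apply: elem_sub => // i; apply: BD; apply: tensor_subalgebra_iota.
  exact: excising_sub (hs i).
have Jt : J (elem F s * a * elem F s).
  by apply: (cidealMr idJ) => //; exact: (cidealMl idJ).
have st : sa (elem F s * a * elem F s) by rewrite -{1}sS; exact: sa_conj.
(* The averagings over [F] cost at most [|F| d < 1/4]. With the 1/4 from excision, the distance to 1
   stays below the bound 1 of [ideal_one]. *)
pose d : R := 1 / (4 * ((size F)%:R + 1)).
have n0 : 0 <= (size F)%:R :> R by [].
have d0 : 0 < d by apply: divr_gt0; lra.
have dE : d * (4 * ((size F)%:R + 1)) = 1 by rewrite /d divfK // gt_eqF //; lra.
have [t' Jt' le'] := near_ideal tPsi fPsi sD BD idJ simB (fset_uniq F) hs d0 Jt st.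
apply: (ideal_one sD idJ Jt'); apply: le_lt_trans le' _.
rewrite nm_sub; lra.
Qed.

End TensorExcision.

Theorem proposition7p2 (R : realType) (I : choiceType) (A : I -> cstarAlgType R)
    (B : forall i, set (A i)) (T : cstarAlgType R) (iota : forall i, A i -> T)
    (B_sub : forall i, unital_cstar_subalgebra (B i))
    (T_tensor : is_minimal_tensor_product iota) :
  (forall tau : forall i, A i -> R[i],
     (forall i, [/\ is_state (tau i), faithful (tau i), tracial (tau i)
                  & relative_dixmier (B i) (tau i)]) ->
     (exists tauT : T -> R[i],
        [/\ is_tensor_state iota tau tauT, faithful tauT, tracial tauT
          & relative_dixmier (tensor_subalgebra iota B) tauT]) /\
     cstar_irreducible (tensor_subalgebra iota B)) /\
  (forall psi : forall i, A i -> R[i],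
     (forall i, [/\ is_state (psi i), faithful (psi i)
                  & relative_excision (B i) (psi i)]) ->
     (exists psiT : T -> R[i],
        [/\ is_tensor_state iota psi psiT, faithful psiT
          & relative_excision (tensor_subalgebra iota B) psiT]) /\
     ((forall i, cstar_simple (B i)) ->
      cstar_irreducible (tensor_subalgebra iota B))).
Proof.
split=> [tau H|psi H].
  have stau i : is_state (tau i) by have [] := H i.
  have ftau i : faithful (tau i) by have [] := H i.
  have ttau i : tracial (tau i) by have [] := H i.
  have dix i : relative_dixmier (B i) (tau i) by have [] := H i.
  have [tauT tT] := tensor_state_exists T_tensor stau.
  have fT := tensor_state_faithful T_tensor stau ftau tT.
  have trT := tensor_tracial T_tensor ttau tT.
  have dT := tensor_dixmier T_tensor B_sub stau ttau dix tT trT.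
  split; first by exists tauT.
  by have [sT _] := tT; exact: dixmier_irreducible sT fT dT.
have spsi i : is_state (psi i) by have [] := H i.
have fpsi i : faithful (psi i) by have [] := H i.
have exc i : relative_excision (B i) (psi i) by have [] := H i.
have [psiT tT] := tensor_state_exists T_tensor spsi.
have fT := tensor_state_faithful T_tensor spsi fpsi tT.
split.
  by exists psiT; split=> //; exact: tensor_excision.
by move=> simB; exact: excision_irreducible tT fT simB.
Qed.
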